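(* Let $(M,g)$ be a globally hyperbolic space-time, let $\phi,\varphi\in\mathcal{S}(M)$, and suppose that the time orientation of each of them is consistent. Then: (1) If the time orientations of $\phi$ and $\varphi$ are identical (both past-directed or both future-directed), then $\min\{\phi,\varphi\}\in\mathcal{S}(M)$. (2) If the time orientations of $\phi$ and $\varphi$ are different, then $\max\{\phi,\varphi\}\in\mathcal{S}(M)$.
   Context: A space-time $(M,g)$ is a connected, time-oriented smooth Lorentzian manifold of signature $(-,+,\dots,+)$. A tangent vector $V$ is timelike if $g(V,V)<0$, lightlike if $g(V,V)=0$ and $V\neq 0$, causal if it is timelike or lightlike. The time orientation is given by a continuous nowhere vanishing timelike vector field $X$; a causal $V\in T_pM$ is past-directed if $g(X(p),V)>0$ and future-directed if $g(X(p),V)<0$. A continuous piecewise $C^1$ curve is causal, future-directed, etc. if its tangent vectors are. Write $p\leq q$ if there is a future-directed causal (or constant) curve from $p$ to $q$; $J^+(p)=\{q: p\leq q\}$, $J^-(p)=\{q: q\leq p\}$. $(M,g)$ is globally hyperbolic if it has no causal loops and $J^+(p)\cap J^-(q)$ is compact for all $p,q$. $h$ is an auxiliary complete Riemannian metric on $M$; $\nabla$ is the gradient with respect to $g$. Viscosity solutions: for continuous $f$, $V\in T_pM$ is a subgradient (resp. supergradient) of $f$ at $p$, written $V\in\nabla^-f(p)$ (resp. $V\in\nabla^+f(p)$), if there are a neighborhood $O$ of $p$ and a $C^1$ function $\psi:O\to\mathbb{R}$ with $\psi(p)=f(p)$, $\psi\leq f$ (resp. $\psi\geq f$) on $O$,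 $\nabla\psi(p)=V$. $f$ is a viscosity solution of $g(\nabla u,\nabla u)=-1$ if for every $p$, $g(V,V)\leq-1$ for all $V\in\nabla^+f(p)$ and $g(V,V)\geq-1$ for all $V\in\nabla^-f(p)$. $\mathcal{S}(M)$ is the set of functions on $M$ that are locally Lipschitz (w.r.t. $h$) and viscosity solutions on all of $M$. Time orientation: $\nabla^*f(p)$ is the set of all $V\in T_pM$ with $V=\lim_k\nabla f(p_k)$ for some $p_k\to p$, $p_k\neq p$, with $f$ differentiable at each $p_k$. The time orientation of $f$ is consistent if for any two points $x,y\in M$ all vectors in $\nabla^*f(x)$ and $\nabla^*f(y)$ have the same time orientation; i.e. either all limiting gradients at all points are past-directed timelike (time orientation of $f$ past-directed) or all are future-directed timelike (time orientation of $f$ future-directed). *)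

(* Defs.v *)
From HB Require Import structures.
From mathcomp Require Import all_boot all_order all_algebra.
From mathcomp Require Import all_classical all_reals all_analysis.

Set Implicit Arguments.
Unset Strict Implicit.
Unset Printing Implicit Defensive.

Import Order.TTheory GRing.Theory Num.Theory.
Import numFieldNormedType.Exports.

Local Open Scope classical_set_scope.
Local Open Scope ring_scope.

Section Charts.
Context {R : realType} {n : nat}.
Local Notation E := 'rV[R]_n.+1.

(* f is of class C^k on the open set U; values of f outside U are irrelevant.
   C^(k+1) means Frechet differentiable with partial derivatives of class C^k. *)
Fixpoint Ck (k : nat) (U : set E) (f : E -> R) : Prop :=
  match k with
  | 0 => forall x, U x -> {for x, continuous f}
  | k'.+1 => (forall x, U x -> differentiable f x) /\
             (forall i, Ck k' U (fun x => 'D_(delta_mx 0 i) f x))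
  end.

Definition smooth_on (U : set E) (f : E -> R) : Prop := forall k, Ck k U f.

(* cmap and cinv are total functions, meaningful only on dom and on the image
   of dom, respectively. *)
Record chart (M : topologicalType) := Chart {
  dom : set M;
  cmap : M -> E;
  cinv : E -> M;
  dom_open : open dom;
  img_open : open (cmap @` dom);
  cmapK : forall p, dom p -> cinv (cmap p) = p;
  cmap_continuous : {within dom, continuous cmap};
  cinv_continuous : {within cmap @` dom, continuous cinv}
}.

End Charts.

Arguments chart : clear implicits.

(* A smooth (Hausdorff, second countable) manifold of dimension n + 1.  The
   atlas is indexed by the points of the manifold, at p p being a chart around
   p: any smooth structure is given by such an atlas, choosing one of its charts
   around each point. *)
Record manifold (R : realType) (n : nat) := Manifold {
  carrier :> topologicalType;
  manifold_hausdorff : hausdorff_space carrier;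
  manifold_second_countable : @second_countable carrier;
  at_ : carrier -> chart R n carrier;
  at_dom : forall p, dom (at_ p) p;
  at_compatible : forall p q (j : 'I_n.+1),
    smooth_on (cmap (at_ p) @` (dom (at_ p) `&` dom (at_ q)))
              (fun x => cmap (at_ q) (cinv (at_ p) x) 0 j)
}.

Section Manifolds.
Context {R : realType} {n : nat} (M : manifold R n).
Local Notation E := 'rV[R]_n.+1.
Implicit Types (p q : M) (v w : E).

(* A tangent vector v in T_pM is given by its coordinates in the chart at_ p.
   An element of E is thus a tangent vector only relatively to a base point;
   tcoord and tvec pass to and from the coordinates in another chart c
   around p. *)
Definition tcoord (c : chart R n M) p v : E :=
  'd (cmap c \o cinv (at_ p)) (cmap (at_ p) p) v.

Definition tvec (c : chart R n M) p v : E :=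
  'd (cmap (at_ p) \o cinv c) (cmap c p) v.

(* Convergence of (q t, v t) to (p, V) in the tangent bundle. *)
Definition tangent_cvg {T : Type} (F : set_system T) (q : T -> M) (v : T -> E)
    p (V : E) : Prop :=
  q t @[t --> F] --> p /\ tcoord (at_ p) (q t) (v t) @[t --> F] --> V.

Definition differentiable_at (f : M -> R) p : Prop :=
  differentiable (f \o cinv (at_ p)) (cmap (at_ p) p).

Definition differential (f : M -> R) p v : R :=
  'd (f \o cinv (at_ p)) (cmap (at_ p) p) v.

Definition C1_on (O : set M) (f : M -> R) : Prop :=
  forall p, Ck 1 (cmap (at_ p) @` (dom (at_ p) `&` O)) (f \o cinv (at_ p)).

(* A field of bilinear forms on the tangent spaces, by its Gram matrices in the
   coordinates of the charts at_ p. *)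
Definition ip (g : M -> 'M[R]_n.+1) p v w : R := (v *m g p *m w^T) 0 0.

Definition smooth_form (g : M -> 'M[R]_n.+1) : Prop :=
  forall p (i j : 'I_n.+1),
    let c := at_ p in
    smooth_on (cmap c @` dom c)
      (fun x => let q := cinv c x in
         ip g q (tvec c q (delta_mx 0 i)) (tvec c q (delta_mx 0 j))).

Definition lorentzian (g : M -> 'M[R]_n.+1) : Prop :=
  smooth_form g /\
  forall p, exists2 P : 'M[R]_n.+1, P \in unitmx &
    P *m g p *m P^T = diag_mx (\row_i (if i == 0 then -1 else 1)).

Definition riemannian (h : M -> 'M[R]_n.+1) : Prop :=
  [/\ smooth_form h, forall p, (h p)^T = h p &
      forall p v, v != 0 -> 0 < ip h p v v].

Definition continuous_field (X : M -> E) : Prop :=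
  forall p, tangent_cvg (nbhs p) id X p (X p).

(* gam is C^1 on [s, t], one-sidedly at s and t, with velocity w r in the
   tangent space at gam r. *)
Definition C1_curve (gam : R -> M) (w : R -> E) (s t : R) : Prop :=
  forall r, r \in `[s, t] ->
    let c := at_ (gam r) in
    (u - r)^-1 *: (cmap c (gam u) - cmap c (gam r))
      @[u --> within [set` `[s, t]] (r^')] --> w r /\
    tangent_cvg (within [set` `[s, t]] (nbhs r)) gam w (gam r) (w r).

(* gam : [a, b] -> M is continuous and piecewise C^1: it is C^1, with velocity
   w i, on each interval [t i, t i.+1] of the subdivision
   a = t 0 < t 1 < ... < t k = b; the velocities of two successive pieces may
   differ at their common end point. *)
Definition piecewise_C1 (gam : R -> M) (a b : R) (k : nat) (t : nat -> R)
    (w : nat -> R -> E) : Prop :=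
  [/\ a < b, t 0%N = a, t k = b &
      forall i, (i < k)%N -> t i < t i.+1 /\ C1_curve gam (w i) (t i) (t i.+1)].

Definition curve_length (h : M -> 'M[R]_n.+1) (gam : R -> M) (k : nat)
    (t : nat -> R) (w : nat -> R -> E) : R :=
  \sum_(i < k) \int[lebesgue_measure]_(r in [set` `[t i, t i.+1]])
    Num.sqrt (ip h (gam r) (w i r) (w i r)).

Definition rdist (h : M -> 'M[R]_n.+1) p q : R :=
  inf [set l | exists gam a b k t (w : nat -> R -> E),
    [/\ piecewise_C1 gam a b k t w, gam a = p, gam b = q &
        l = curve_length h gam k t w]].

Definition complete_riemannian (h : M -> 'M[R]_n.+1) : Prop :=
  riemannian h /\
  forall u : nat -> M,
    (forall e : R, 0 < e -> exists N : nat, forall i j,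
        (N <= i)%N -> (N <= j)%N -> rdist h (u i) (u j) < e) ->
    exists p, rdist h (u i) p @[i --> \oo] --> (0 : R).

Definition locally_lipschitz (h : M -> 'M[R]_n.+1) (f : M -> R) : Prop :=
  forall p, exists U : set M, nbhs p U /\
    exists L : R, forall x y, U x -> U y -> `|f x - f y| <= L * rdist h x y.

End Manifolds.

Record spacetime (R : realType) (n : nat) := Spacetime {
  st_manifold :> manifold R n;
  metric : st_manifold -> 'M[R]_n.+1;
  orient : st_manifold -> 'rV[R]_n.+1;
  st_connected : connected [set: st_manifold];
  metric_lorentzian : lorentzian metric;
  orient_continuous : continuous_field orient;
  orient_timelike : forall p, ip metric p (orient p) (orient p) < 0
}.

Section Spacetimes.
Context {R : realType} {n : nat} (M : spacetime R n).
Local Notation E := 'rV[R]_n.+1.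
Local Notation g := (@metric R n M).
Implicit Types (p q x y : M) (V : E) (f : M -> R).

Definition timelike p V : Prop := ip g p V V < 0.
Definition lightlike p V : Prop := ip g p V V = 0 /\ V <> 0.
Definition causal p V : Prop := timelike p V \/ lightlike p V.
Definition past_directed p V : Prop := causal p V /\ 0 < ip g p (orient p) V.
Definition future_directed p V : Prop := causal p V /\ ip g p (orient p) V < 0.

Definition future_causal_curve (p q : M) : Prop :=
  exists gam a b k t (w : nat -> R -> E),
    [/\ piecewise_C1 gam a b k t w, gam a = p, gam b = q &
        forall (i : nat) (r : R), (i < k)%N -> r \in `[t i, t i.+1] ->
          future_directed (gam r) (w i r)].

Definition causal_le (p q : M) : Prop := p = q \/ future_causal_curve p q.
Definition Jplus p : set M := [set q | causal_le p q].
Definition Jminus p : set M := [set q | causal_le q p].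

Definition globally_hyperbolic : Prop :=
  (forall p, ~ future_causal_curve p p) /\
  (forall p q, compact (Jplus p `&` Jminus q)).

(* V is the gradient of f at p with respect to g. *)
Definition is_gradient f p V : Prop :=
  differentiable_at f p /\ forall v : E, ip g p V v = differential f p v.

Definition subgradient f p V : Prop :=
  exists (O : set M) (psi : M -> R),
    [/\ open_nbhs p O, C1_on O psi, psi p = f p,
        forall q, O q -> psi q <= f q & is_gradient psi p V].

Definition supergradient f p V : Prop :=
  exists (O : set M) (psi : M -> R),
    [/\ open_nbhs p O, C1_on O psi, psi p = f p,
        forall q, O q -> f q <= psi q & is_gradient psi p V].

Definition viscosity_solution f : Prop :=
  continuous f /\
  forall p, (forall V, supergradient f p V -> ip g p V V <= -1) /\
            (forall V, subgradient f p V -> -1 <= ip g p V V).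

Definition solutions (h : M -> 'M[R]_n.+1) : set (M -> R) :=
  [set f | locally_lipschitz h f /\ viscosity_solution f].

Definition limiting_gradient f p V : Prop :=
  exists (q : nat -> M) (v : nat -> E),
    [/\ forall k, q k <> p, forall k, is_gradient f (q k) (v k) &
        tangent_cvg \oo q v p V].

Definition past_oriented f : Prop :=
  forall x V, limiting_gradient f x V -> timelike x V /\ past_directed x V.

Definition future_oriented f : Prop :=
  forall x V, limiting_gradient f x V -> timelike x V /\ future_directed x V.

Definition consistent f : Prop := past_oriented f \/ future_oriented f.

End Spacetimes.

(* Main.v *)
From HB Require Import structures.
Require Import Defs.
From mathcomp Require Import all_boot all_order all_algebra.
From mathcomp Require Import all_classical all_reals all_analysis.
From mathcomp Require Import ring lra.
Set Implicit Arguments.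
Unset Strict Implicit.
Unset Printing Implicit Defensive.
Import Order.TTheory GRing.Theory Num.Theory.
Import numFieldNormedType.Exports.
Local Open Scope classical_set_scope.
Local Open Scope ring_scope.

(** Why the minimum or the maximum of two solutions is again a solution.

    A C^1 function touching min{phi, varphi} from below at p also touches from
    below the one of the two functions which attains the minimum at p, so the
    minimum inherits the inequality for subgradients; in the same way the maximum
    inherits the inequality for supergradients.  The content of the theorem is
    therefore that supergradients V of the minimum satisfy g(V,V) <= -1, and
    that subgradients V of the maximum satisfy g(V,V) >= -1.

    Everything local is done in the coordinates of a chart composed with an
    affine map, chosen so that the coordinate frame at p is g-orthonormal with
    timelike first vector.  Sub- and supergradients become covectors a at y of
    test functions touching u from below or above ([touched_below],
    [touched_above]), and the equation becomes Q(y,a) >= -1, resp. Q(y,a) <= -1,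
    where Q, the inverse metric, is close to the Minkowski form near 0
    ([cometric_near_minkowski]).

    Orientation.  For a solution f with past-directed limiting gradients, all
    supergradients are past-directed ([supergradient_past]).  Indeed, if a
    supergradient at p were future-directed, then so would be all those at nearby
    points ([future_supergradient_near]): a function with a strict local maximum
    along a timelike segment has a supergradient orthogonal to it, which cannot
    satisfy g(V,V) <= -1.  By time reversal it is enough to exclude that a
    solution with past-directed supergradients near p has only future-directed
    limiting gradients ([past_near_not_future]).  Such a solution is
    differentiable wherever it has a subgradient
    ([differentiable_at_subgradient_past]), and points with a subgradient are
    dense, so limiting gradients of the wrong orientation can be exhibited.

    Minimum.  If the supergradients of f are past-directed, then f grows along
    timelike vectors at least as fast as proper time ([flat_increasing_of_touching],
    by the reverse Cauchy-Schwarz inequality).  This growth is obviously inherited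
    by the minimum of two such functions, and conversely a C^1 function touching
    a function with this growth, from whichever side, has a past-directed
    gradient V with g(V,V) <= -1 ([increasing_touch]).  For two future-oriented
    solutions the time orientation is reversed.

    Maximum.  Let phi be past-oriented, varphi future-oriented, and let V be a
    subgradient of the maximum at p with g(V,V) < -1.  Only the case
    phi(p) = varphi(p) is not immediate; reversing time and exchanging phi and
    varphi if necessary, V is past-directed.  In a frame adapted to V, the covector of V is lam times the
    time coordinate with lam > 1.  Towards the future of p the function phi
    increases while varphi decreases, so the maximum is phi there, and phi grows
    with slope larger than 1 on every narrow cone around the time axis.  The
    Lipschitz bound spreads this growth to the top of a cone slightly
    wider than the light cone, and a barrier blowing up at the boundary of that
    wider cone then touches phi from below with a covector too steep for a
    subgradient ([steep_on_cone_false]).  The Lipschitz bound in coordinates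
    comes from comparing the Riemannian distance with the length of coordinate
    segments ([locally_lipschitz_chart]). *)

(** * Time and space coordinates *)

Section Coordinates.
Context {R : realType} {n : nat}.
Local Notation E := 'rV[R]_n.+1.
Implicit Types (a b v w x y z : E) (c r e : R).

(** Coordinate 0 is time; [lift ord0] runs over the spatial coordinates. *)
Definition sdot a b : R := \sum_(i < n) a 0 (lift ord0 i) * b 0 (lift ord0 i).
Definition dot a b : R := a 0 0 * b 0 0 + sdot a b.
Definition mink a b : R := - (a 0 0 * b 0 0) + sdot a b.

Lemma dotE a b : dot a b = (a *m b^T) 0 0.
Proof. by rewrite mxE big_ord_recl !mxE; congr (_ + _); apply: eq_bigr => i _; rewrite !mxE. Qed.

Lemma sdotC a b : sdot a b = sdot b a.
Proof. by apply: eq_bigr => i _; rewrite mulrC. Qed.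

Lemma sdotDl a b w : sdot (a + b) w = sdot a w + sdot b w.
Proof. by rewrite -big_split; apply: eq_bigr => i _; rewrite mxE mulrDl. Qed.

Lemma sdotZl c a w : sdot (c *: a) w = c * sdot a w.
Proof. by rewrite mulr_sumr; apply: eq_bigr => i _; rewrite mxE mulrA. Qed.

Lemma sdotDr w a b : sdot w (a + b) = sdot w a + sdot w b.
Proof. by rewrite sdotC sdotDl !(sdotC w). Qed.

Lemma sdotZr c w a : sdot w (c *: a) = c * sdot w a.
Proof. by rewrite sdotC sdotZl (sdotC w). Qed.

Lemma sdotNl a w : sdot (- a) w = - sdot a w.
Proof. by rewrite -scaleN1r sdotZl mulN1r. Qed.

Lemma sdotNr w a : sdot w (- a) = - sdot w a.
Proof. by rewrite -scaleN1r sdotZr mulN1r. Qed.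

Definition sdotE := (sdotDl, sdotDr, sdotZl, sdotZr, sdotNl, sdotNr).

Lemma dotC a b : dot a b = dot b a.
Proof. by rewrite /dot mulrC sdotC. Qed.

Lemma dotDl a b w : dot (a + b) w = dot a w + dot b w.
Proof. by rewrite /dot sdotE mxE; ring. Qed.

Lemma dotZl c a w : dot (c *: a) w = c * dot a w.
Proof. by rewrite /dot sdotE mxE; ring. Qed.

Lemma dotDr w a b : dot w (a + b) = dot w a + dot w b.
Proof. by rewrite dotC dotDl !(dotC w). Qed.

Lemma dotZr c w a : dot w (c *: a) = c * dot w a.
Proof. by rewrite dotC dotZl (dotC w). Qed.

Lemma dotNl a w : dot (- a) w = - dot a w.
Proof. by rewrite -scaleN1r dotZl mulN1r. Qed.

Lemma dotNr w a : dot w (- a) = - dot w a.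
Proof. by rewrite -scaleN1r dotZr mulN1r. Qed.

Lemma dot0l w : dot 0 w = 0.
Proof. by rewrite -(scale0r (0 : E)) dotZl mul0r. Qed.

Lemma dot_delta w (i : 'I_n.+1) : dot w (delta_mx 0 i) = w 0 i.
Proof.
rewrite dotE mxE (bigD1 i)//= !mxE !eqxx mulr1 big1 ?addr0// => j ji.
by rewrite !mxE (negPf ji) andbF mulr0.
Qed.

Lemma sdot_ge0 a : 0 <= sdot a a.
Proof. by apply: sumr_ge0 => i _; rewrite -expr2 sqr_ge0. Qed.

Lemma sdot_CS a b : sdot a b ^+ 2 <= sdot a a * sdot b b.
Proof.
have [b0|b0] := eqVneq (sdot b b) 0.
  suff -> : sdot a b = 0 by rewrite b0 mulr0 expr0n.
  apply: big1 => i _.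
  have /eqP := b0; rewrite psumr_eq0 => [/allP/(_ i)|j _]; last first.
    by rewrite -expr2 sqr_ge0.
  by rewrite mem_index_enum mulf_eq0 orbb => /(_ isT)/eqP ->; rewrite mulr0.
have bgt : 0 < sdot b b by rewrite lt0r b0 sdot_ge0.
have := sdot_ge0 (sdot b b *: a - sdot a b *: b).
rewrite !sdotE (sdotC b a) => H.
have : 0 <= sdot b b * (sdot a a * sdot b b - sdot a b ^+ 2).
  by move: H; congr (0 <= _); ring.
by rewrite pmulr_rge0// subr_ge0.
Qed.

Lemma sdotD_le a b : sdot (a + b) (a + b) <= 2 * (sdot a a + sdot b b).
Proof.
have := sdot_ge0 (a - b); rewrite !sdotE (sdotC b a); lra.
Qed.

Lemma coord_le_norm y i : `|y 0 i| <= `|y|.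
Proof.
by rewrite [leRHS]mx_normrE; exact: (le_bigmax _ (fun i : 'I_1 * 'I_n.+1 => `|y i.1 i.2|) (0, i)).
Qed.

Lemma norm_le_coord y r : 0 <= r -> (forall i, `|y 0 i| <= r) -> `|y| <= r.
Proof.
move=> r0 H; rewrite [leLHS]mx_normrE; apply: bigmax_le => // -[i j] _ /=.
by rewrite ord1.
Qed.

Lemma sdot_le_norm y : sdot y y <= n%:R * `|y| ^+ 2.
Proof.
rewrite -[n in n%:R]card_ord -sumr_const mulr_suml ler_sum// => i _.
rewrite mul1r -expr2 -(real_normK (num_real (y 0 _))).
by rewrite ler_pXn2r// ?nnegrE// coord_le_norm.
Qed.

Lemma norm_le_sdot y r : 0 <= r -> `|y 0 0| <= r -> sdot y y <= r ^+ 2 -> `|y| <= r.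
Proof.
move=> r0 y0 yr; apply: norm_le_coord => // i.
have [->//|ij] := eqVneq i 0.
rewrite -(@ler_pXn2r _ 2)// ?nnegrE// real_normK ?num_real//.
apply: le_trans yr; have [j ->] : exists j, i = lift ord0 j.
  by case: (unliftP ord0 i) ij => [j -> _|->]; [exists j|rewrite eqxx].
rewrite /sdot (bigD1 j)//= -expr2 lerDl sumr_ge0// => k _.
by rewrite -expr2 sqr_ge0.
Qed.

Lemma dot_le_norm a b : `|dot a b| <= n.+1%:R * `|a| * `|b|.
Proof.
rewrite dotE mxE (le_trans (ler_norm_sum _ _ _))//.
rewrite -[X in X%:R]card_ord -sumr_const !mulr_suml ler_sum// => i _.
by rewrite mul1r normrM !mxE ler_pM// coord_le_norm.
Qed.

End Coordinates.

(** * Functions of class C^1 with a given gradient *)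

Section Gradients.
Context {R : realType} {n : nat}.
Local Notation E := 'rV[R]_n.+1.
Implicit Types (a b v w x y z : E) (c r e : R) (O : set E).

Lemma dot_is_linear w : linear (dot w : E -> R).
Proof. by move=> c a b; rewrite dotDr dotZr. Qed.

HB.instance Definition _ w :=
  GRing.isLinear.Build R E R *:%R (dot w) (dot_is_linear w).

Lemma dot_continuous w : continuous (dot w : E -> R).
Proof.
apply/linear_bounded_continuous.
by apply/linear_boundedP; near=> k; move=> y /=; apply: le_trans (dot_le_norm _ _) _;
 rewrite ler_wpM2r//; near: k; exact: nbhs_pinfty_ge.
Unshelve. all: by end_near. Qed.

Definition has_gradient (f : E -> R) x w := is_diff x f (dot w : E -> R).

(** The unfolded form, with explicit constants, is what the comparison of a
    function with its test functions uses. *)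
Lemma has_gradientP f x w : has_gradient f x w <->
  forall e, 0 < e -> \forall h \near (0 : E), `|f (h + x) - f x - dot w h| <= e * `|h|.
Proof.
split=> [[fx fw]|H].
  have /eqaddoP H := diff_locally fx.
  move=> e e0; have := H _ e0; apply: filterS => h.
  by rewrite /= fw opprD addrA.
have cw := @dot_continuous w.
have H' : (f : E -> R^o) \o shift x = cst (f x) + (dot w : E -> R^o) +o_ (0 : E) id.
  apply/eqaddoP => e e0; have := H _ e0; apply: filterS => h /=; rewrite -addrA -opprD; exact.
split; last exact: diff_unique.
apply/diff_locallyP; have := diff_unique cw H' => /[dup] D ->; split => //.
Qed.

(** The gradient is carried as a function so that test functions can be built by
    sums, products and compositions, without mentioning partial derivatives. *)
Definition C1_gradient O (f : E -> R) (w : E -> E) :=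
  forall z, O z -> has_gradient f z (w z) /\ {for z, continuous w}.

Lemma is_diff_dot_eq x f df w : is_diff x f df -> df =1 dot w ->
  has_gradient f x w.
Proof. by move=> H /funext dE; apply: is_diff_eq H _. Qed.

Lemma C1_gradient_cst O c : C1_gradient O (fun=> c) (fun=> 0).
Proof.
move=> z _; split; last exact: cst_continuous.
by apply: is_diff_dot_eq => v; rewrite dot0l.
Qed.

Lemma C1_gradient_dot O w : C1_gradient O (dot w) (fun=> w).
Proof.
move=> z _; split; last exact: cst_continuous.
by split; [apply: linear_differentiable|apply: diff_lin]; exact: dot_continuous.
Qed.

Arguments C1_gradient_cst : clear implicits.
Arguments C1_gradient_dot : clear implicits.

Lemma C1_gradientD O f g wf wg : C1_gradient O f wf -> C1_gradient O g wg ->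
  C1_gradient O (fun z => f z + g z) (fun z => wf z + wg z).
Proof.
move=> Hf Hg z Oz; have [df cf] := Hf z Oz; have [dg cg] := Hg z Oz; rewrite /has_gradient in dg.
split; last exact: continuousD.
by rewrite /has_gradient in df *; apply: is_diff_dot_eq => v; rewrite /= dotDl.
Qed.

Lemma C1_gradientN O f wf : C1_gradient O f wf -> C1_gradient O (fun z => - f z) (fun z => - wf z).
Proof.
move=> Hf z Oz; have [df cf] := Hf z Oz.
split; last exact: continuousN.
by rewrite /has_gradient in df *; apply: is_diff_dot_eq => v; rewrite /= dotNl.
Qed.

Lemma has_gradient_continuous f x w : has_gradient f x w -> {for x, continuous f}.
Proof. by move=> [fx _]; exact: differentiable_continuous. Qed.

Lemma C1_gradientM O f g wf wg : C1_gradient O f wf -> C1_gradient O g wg ->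
  C1_gradient O (fun z => f z * g z) (fun z => f z *: wg z + g z *: wf z).
Proof.
move=> Hf Hg z Oz; have [df cf] := Hf z Oz; have [dg cg] := Hg z Oz; rewrite /has_gradient in dg.
split.
  by rewrite /has_gradient in df *; apply: is_diff_dot_eq => v; rewrite /= dotDl !dotZl.
have ff := has_gradient_continuous df; have gg := has_gradient_continuous dg.
by apply: continuousD; apply: continuousZ.
Qed.

Lemma C1_gradient_comp O f wf (h h' : R -> R) : C1_gradient O f wf ->
  (forall z, O z -> is_derive (f z) 1 h (h' (f z)) /\ {for f z, continuous h'}) ->
  C1_gradient O (fun z => h (f z)) (fun z => h' (f z) *: wf z).
Proof.
move=> Hf Hh z Oz; have [df cf] := Hf z Oz; have [dh ch] := Hh z Oz.
have ff := has_gradient_continuous df.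
have dh' : is_diff (f z) h ( *:%R^~ (h' (f z)) : R -> R).
  have [dh0 dh1] := dh; apply: DiffDef; first exact/derivable1_diffP.
  by rewrite (deriv1E dh0) derive1E dh1.
split; last by apply: (@continuousZ _ _ _ (h' \o f)) => //; exact: continuous_comp.
have D := is_diff_comp (df : is_diff z f _) dh'.
apply: (is_diff_dot_eq (df := ( *:%R^~ (h' (f z)) \o dot (wf z)))) => // v.
by rewrite /= dotZl mulrC.
Qed.

Lemma C1_gradient_eq O f f' (w w' : E -> E) : C1_gradient O f w -> f =1 f' -> w =1 w' ->
  C1_gradient O f' w'.
Proof. by move=> H /funext <- /funext <-. Qed.

Lemma C1_gradient_sub O O' f (w : E -> E) : C1_gradient O f w -> O' `<=` O ->
  C1_gradient O' f w.
Proof. by move=> H OO z /OO; exact: H. Qed.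

Lemma C1_gradient_sum O k (f : 'I_k -> E -> R) (w : 'I_k -> E -> E) :
  (forall i, C1_gradient O (f i) (w i)) ->
  C1_gradient O (fun z => \sum_i f i z) (fun z => \sum_i w i z).
Proof.
move=> H.
apply: (@C1_gradient_eq _ (\sum_i f i) _ (\sum_i w i)); last 2 first.
- by move=> z; rewrite fct_sumE.
- by move=> z; rewrite fct_sumE.
apply: (big_ind2 (fun (f : E -> R) (w : E -> E) => C1_gradient O f w)).
- exact: C1_gradient_cst.
- by move=> f1 w1 f2 w2; exact: C1_gradientD.
- by move=> i _; exact: H.
Qed.

Definition spatial y : E := \row_i if i == 0 then 0 else y 0 i.

Lemma dot_spatial y v : dot (spatial y) v = sdot y v.
Proof.
by rewrite /dot !mxE/= mul0r add0r; apply: eq_bigr => i _; rewrite mxE.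
Qed.

Lemma spatial0 y : spatial y 0 0 = 0.
Proof. by rewrite mxE. Qed.

Lemma sdot_spatial y v : sdot (spatial y) v = sdot y v.
Proof. by apply: eq_bigr => i _; rewrite mxE. Qed.

Lemma dot_row a b : (forall v, dot a v = dot b v) -> a = b.
Proof. by move=> H; apply/rowP => i; rewrite -!dot_delta. Qed.

Lemma C1_gradient_sdot O : C1_gradient O (fun y => sdot y y) (fun y => 2 *: spatial y).
Proof.
have H (i : 'I_n) := C1_gradientM (C1_gradient_dot O (delta_mx 0 (lift ord0 i)))
  (C1_gradient_dot O (delta_mx 0 (lift ord0 i))).
apply: C1_gradient_eq (C1_gradient_sum _) _ _; first exact: H.
- by move=> y /=; apply: eq_bigr => i _; rewrite /= dotC dot_delta.
- move=> y /=; apply: dot_row => v; rewrite dotZl dot_spatial mulr_sumr.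
  rewrite (big_morph (dot^~ v) (fun a b => dotDl a b v) (dot0l v)).
  by apply: eq_bigr => i _; rewrite dotDl !dotZl !(dotC (delta_mx _ _)) !dot_delta; ring.
Qed.

End Gradients.

Arguments C1_gradient_cst {R n} O c _ _.
Arguments C1_gradient_dot {R n} O w _ _.
Arguments C1_gradient_sdot {R n} O _ _.

(** * Test functions touching a continuous function *)

Section Touching.
Context {R : realType} {n : nat}.
Local Notation E := 'rV[R]_n.+1.
Implicit Types (a b v w x y z : E) (c r e : R) (O : set E) (u : E -> R).

(** The vectors a form the subdifferential of u at z, defined by C^1 test
    functions. *)
Definition touched_below u z a := exists O (f : E -> R) (df : E -> E),
  [/\ open O, O z, C1_gradient O f df, f z = u z & df z = a] /\
  forall y, O y -> f y <= u y.

Definition touched_above u z a := exists O (f : E -> R) (df : E -> E),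
  [/\ open O, O z, C1_gradient O f df, f z = u z & df z = a] /\
  forall y, O y -> u y <= f y.

Lemma touched_aboveN u z a : touched_below (fun y => - u y) z (- a) -> touched_above u z a.
Proof.
move=> [ O [f [df [[oO Oz Cf fz dfz] fu]]]].
exists O, (fun y => - f y), (fun y => - df y); split; last by move=> y /fu; rewrite lerNr.
split; [exact: oO|exact: Oz|exact: C1_gradientN| |].
- by rewrite fz opprK.
- by rewrite dfz opprK.
Qed.

(** If u - f is larger outside O than at the reference point z, its minimum over
    the compact set C lies in O, and there f, shifted by a constant, touches u
    from below. All the subgradients below come from this principle; only f and C
    vary. *)
Lemma min_touch u (f : E -> R) (df : E -> E) (C : set E) O z :
  compact C -> open O -> O `<=` C -> C z ->
  (forall y, C y -> {for y, continuous u}) ->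
  (forall y, C y -> {for y, continuous f}) ->
  C1_gradient O f df ->
  (forall y, C y -> ~ O y -> u z - f z < u y - f y) ->
  exists2 y, O y & touched_below u y (df y).
Proof.
move=> cC oO OC Cz cu cf Cf H.
have C0 : C !=set0 by exists z.
have cuf : {within C, continuous (u - f)}.
  apply: continuous_in_subspaceT => y; rewrite inE => Cy.
  by apply: continuousB; [exact: cu|exact: cf].
have [y /set_mem Cy ymin] := EVT_min_rV C0 cC cuf.
have Oy : O y.
  apply: contrapT => nOy; have := H y Cy nOy; rewrite ltNge => /negP; apply.
  exact/ymin/mem_set.
exists y => //; exists O, (fun v => f v + (u y - f y)), (fun v => df v + 0); split; last first.
  move=> v Ov; have := ymin v (mem_set (OC v Ov)); rewrite !fctE; lra.
split; [exact: oO|exact: Oy| | |].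
- exact: C1_gradientD Cf (C1_gradient_cst O _).
- by lra.
- by rewrite addr0.
Qed.

Lemma max_touch u (f : E -> R) (df : E -> E) (C : set E) O z :
  compact C -> open O -> O `<=` C -> C z ->
  (forall y, C y -> {for y, continuous u}) ->
  (forall y, C y -> {for y, continuous f}) ->
  C1_gradient O f df ->
  (forall y, C y -> ~ O y -> u y - f y < u z - f z) ->
  exists2 y, O y & touched_above u y (df y).
Proof.
move=> cC oO OC Cz cu cf Cf H.
have [||||y Oy uy] := min_touch (u := fun y => - u y) (f := fun y => - f y) (df := fun y => - df y) cC oO OC Cz.
- by move=> y /cu; exact: continuousN.
- by move=> y /cf; exact: continuousN.
- exact: C1_gradientN.
- by move=> y Cy nOy; have := H y Cy nOy; lra.
- by exists y => //; exact: touched_aboveN.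
Qed.

Lemma closed_le_fun (f : E -> R) c : continuous f -> closed [set y | f y <= c].
Proof. by move=> cf; exact: (preimage_closed (fun y _ => cf y) (@closed_le _ c)). Qed.

Lemma open_lt_fun (f : E -> R) c : continuous f -> open [set y | f y < c].
Proof. by move=> cf; apply: (open_comp (fun y _ => cf y) (@open_lt _ c)). Qed.

Lemma closed_ge_fun (f : E -> R) c : continuous f -> closed [set y | c <= f y].
Proof. by move=> cf; exact: (preimage_closed (fun y _ => cf y) (@closed_ge _ c)). Qed.

Lemma open_gt_fun (f : E -> R) c : continuous f -> open [set y | c < f y].
Proof. by move=> cf; apply: (open_comp (fun y _ => cf y) (@open_gt _ c)). Qed.

Lemma compact_norm_bounded (C : set E) r : closed C -> (forall y, C y -> `|y| <= r) ->
  compact C.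
Proof.
move=> cC H; apply: bounded_closed_compact => //.
exists r; split; first exact: num_real.
by move=> s rs y /H yr; exact: le_trans (ltW rs).
Qed.

Lemma C1_gradient_continuous O (f : E -> R) (df : E -> E) y : C1_gradient O f df ->
  O y -> {for y, continuous f}.
Proof. by move=> H /H[+ _]; exact: has_gradient_continuous. Qed.

Lemma continuous_eps u z e : {for z, continuous u} -> 0 < e ->
  exists2 d, 0 < d & forall y, `|y - z| < d -> `|u y - u z| < e.
Proof.
move=> cu e0; have /cvgrPdist_lt/(_ e e0)/nbhs_ballP[d d0 H] := cu.
exists d => // y yz; rewrite distrC; apply: H.
by rewrite -ball_normE/= distrC.
Qed.

Lemma segment_norm_lt z w (s t0 t : R) r : s <= t0 <= t -> `|z + s *: w| < r ->
  `|z + t *: w| < r -> `|z + t0 *: w| < r.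
Proof.
move=> /andP[st0 t0t] zs zt.
have [st|ts] := ltP s t; last first.
  by have -> : t0 = s by apply/eqP; rewrite eq_le st0 andbT (le_trans t0t).
have ts0 : 0 < t - s by rewrite subr_gt0.
have -> : z + t0 *: w = ((t - t0) / (t - s)) *: (z + s *: w) +
                       ((t0 - s) / (t - s)) *: (z + t *: w).
  apply/rowP => i; rewrite !mxE; field; lra.
rewrite (le_lt_trans (ler_normD _ _))// !normrZ.
rewrite !ger0_norm ?mulr_ge0 ?invr_ge0 ?subr_ge0 ?(ltW st)//.
set m := Num.max `|z + s *: w| `|z + t *: w|.
have mr : m < r by rewrite gt_max zs zt.
apply: le_lt_trans mr; rewrite -[leRHS]mul1r.
have -> : 1 = (t - t0) / (t - s) + (t0 - s) / (t - s) by field; lra.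
rewrite [leRHS]mulrDl lerD// ler_wpM2l ?mulr_ge0 ?invr_ge0 ?subr_ge0// ?(ltW st)// le_max lexx ?orbT//.
Qed.

(** A supergradient of u with a prescribed derivative along w: if u - h has an
    interior maximum along the segment, then penalizing the distance q to the line
    makes it a local maximum in a thin tube around the segment. The penalty does
    not affect the derivative along w, which is that of h. *)
Lemma touch_along_line u z w (s t : R) (h h' : R -> R) r :
  w 0 0 != 0 -> s < 0 < t ->
  (forall y, `|y| < r -> {for y, continuous u}) ->
  `|z + s *: w| < r -> `|z + t *: w| < r ->
  (forall c, s <= c <= t -> is_derive c 1 h (h' c) /\ {for c, continuous h'}) ->
  u (z + s *: w) - h s < u z - h 0 ->
  u (z + t *: w) - h t < u z - h 0 ->
  exists y a c, [/\ `|y| < r, s < c < t, touched_above u y a & dot a w = h' c].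
Proof.
move=> w0 /andP[s0 t0] cu zs zt Ch us ut.
(* lam is the parameter of the point of the line with the same time coordinate as
   y, and pr y is the displacement from that point, which is spatial; q is its
   squared length. *)
pose lam y : R := (y 0 0 - z 0 0) / w 0 0.
pose pr y : E := y - z - lam y *: w.
pose cf (i : 'I_n) : E := delta_mx 0 (lift ord0 i) - (w 0 (lift ord0 i) / w 0 0) *: delta_mx 0 0.
pose q y := sdot (pr y) (pr y).
pose dq y : E := \sum_(i < n) (pr y 0 (lift ord0 i) *: cf i + pr y 0 (lift ord0 i) *: cf i).
have C1lam A : C1_gradient A lam (cst ((w 0 0)^-1 *: delta_mx 0 0)).
  apply: C1_gradient_eq (C1_gradientD (C1_gradient_dot A ((w 0 0)^-1 *: delta_mx 0 0))
    (C1_gradient_cst A (- (z 0 0 / w 0 0)))) _ _.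
  - by move=> y; rewrite /= dotZl dotC dot_delta /lam mulrBl mulrC.
  - by move=> y; rewrite /= addr0.
have prE i y : pr y 0 (lift ord0 i) = dot (cf i) y - dot (cf i) z.
  by rewrite /pr /cf /lam !mxE !dotDl !dotNl !dotZl !(dotC (delta_mx _ _)) !dot_delta; field.
have pr00 y : pr y 0 0 = 0 by rewrite /pr /lam !mxE; field.
have C1q A : C1_gradient A q dq.
  apply: C1_gradient_sum => i.
  have F := C1_gradientD (C1_gradient_dot A (cf i)) (C1_gradient_cst A (- dot (cf i) z)).
  apply: C1_gradient_eq (C1_gradientM F F) _ _.
  - by move=> y; rewrite /= -!prE.
  - by move=> y; rewrite /= -!prE !addr0.
have clam : continuous lam by move=> y; exact: (C1_gradient_continuous (C1lam setT)).
have cq : continuous q by move=> y; exact: (C1_gradient_continuous (C1q setT)).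
have dqw y : dot (dq y) w = 0.
  rewrite /dq (big_morph (dot^~ w) (fun a b => dotDl a b w) (dot0l w)) big1// => i _.
  suff H : dot (cf i) w = 0 by rewrite dotDl dotZl H; ring.
  by rewrite /cf dotDl dotNl dotZl !(dotC (delta_mx _ _)) !dot_delta; field.
have yE y : y = z + lam y *: w + pr y by apply/rowP => i; rewrite !mxE; ring.
have pr_le y e : 0 <= e -> q y <= e ^+ 2 -> `|pr y| <= e.
  by move=> e0; apply: norm_le_sdot => //; rewrite pr00 normr0.
pose d := Num.min (u z - h 0 - (u (z + s *: w) - h s)) (u z - h 0 - (u (z + t *: w) - h t)).
have d0 : 0 < d by rewrite lt_min !subr_gt0 us ut.
have [d1 d10 Hd1] := continuous_eps (cu _ zs) d0.
have [d2 d20 Hd2] := continuous_eps (cu _ zt) d0.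
pose m := Num.max `|z + s *: w| `|z + t *: w|.
have mr : m < r by rewrite gt_max zs zt.
pose rho := Num.min (Num.min d1 d2) (r - m) / 2.
have rho0 : 0 < rho by rewrite divr_gt0// !lt_min d10 d20 subr_gt0 mr.
have rho1 : rho < d1 /\ rho < d2 /\ rho < r - m.
  have : 2 * rho = Num.min (Num.min d1 d2) (r - m) by rewrite /rho; field.
  have : Num.min (Num.min d1 d2) (r - m) <= d1 by rewrite !ge_min lexx.
  have : Num.min (Num.min d1 d2) (r - m) <= d2 by rewrite !ge_min lexx orbT.
  have : Num.min (Num.min d1 d2) (r - m) <= r - m by rewrite !ge_min lexx orbT.
  by split; [|split]; lra.
have [rho_d1 [rho_d2 rho_m]] := rho1.
pose C := [set y | s <= lam y] `&` [set y | lam y <= t] `&` [set y | q y <= rho ^+ 2].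
pose O := [set y | s < lam y] `&` [set y | lam y < t] `&` [set y | q y < rho ^+ 2].
have OC : O `<=` C.
  by move=> y [[/= H1 H2] H3]; split; [split|]; exact: ltW.
have Cr y : C y -> `|y| < r.
  move=> [[/= H1 H2] H3]; rewrite [y]yE (le_lt_trans (ler_normD _ _))//.
  have := pr_le y _ (ltW rho0) H3.
  have : `|z + lam y *: w| <= m.
    rewrite leNgt; apply/negP => ml.
    suff : `|z + lam y *: w| < `|z + lam y *: w| by rewrite ltxx.
    apply: (@segment_norm_lt z w s (lam y) t); first by rewrite H1 H2.
    - by apply: le_lt_trans ml; rewrite le_max lexx.
    - by apply: le_lt_trans ml; rewrite le_max lexx orbT.
  lra.
have cC : compact C.
  apply: (@compact_norm_bounded _ r); last by move=> y /Cr/ltW.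
  apply: closedI; last exact: closed_le_fun.
  by apply: closedI; [exact: closed_ge_fun|exact: closed_le_fun].
have oO : open O.
  apply: openI; last exact: open_lt_fun.
  by apply: openI; [exact: open_gt_fun|exact: open_lt_fun].
have lamz : lam z = 0 by rewrite /lam subrr mul0r.
have qz : q z = 0.
  by rewrite /q /pr lamz scale0r subrr subr0 /sdot big1// => i _; rewrite mxE mul0r.
have Cz : C z by split; [split|] => /=; rewrite ?lamz ?qz ?ltW// exprn_gt0.
have C1h : C1_gradient C (fun y => h (lam y)) (fun y => h' (lam y) *: ((w 0 0)^-1 *: delta_mx 0 0)).
  apply: C1_gradient_comp (C1lam C) _ => y [[/= H1 H2] _].
  by apply: Ch; rewrite H1 H2.
have ch y : C y -> {for y, continuous (fun y => h (lam y))}.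
  exact: C1_gradient_continuous C1h.
have cu' y : C y -> {for y, continuous u} by move=> /Cr; exact: cu.
have [||ym /set_mem Cym ymax] := @EVT_max_rV _ _ (fun y => u y - h (lam y)) C _ cC.
- by exists z.
- apply: continuous_in_subspaceT => y; rewrite inE => Cy.
  by apply: continuousB; [exact: cu'|exact: ch].
pose B := u ym - h (lam ym).
have HB y : C y -> u y - h (lam y) <= B by move=> Cy; exact/ymax/mem_set.
(* The penalty exceeds the oscillation of u - h on the wall of the tube. *)
pose M := (B - (u z - h 0) + 1) / rho ^+ 2.
have B0 : u z - h 0 <= B by rewrite -[in h 0]lamz; exact: HB.
have M0 : 0 < M by rewrite divr_gt0 ?exprn_gt0//; lra.
have Mrho : M * rho ^+ 2 = B - (u z - h 0) + 1 by rewrite /M; field; rewrite gt_eqF.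
pose df y : E := h' (lam y) *: ((w 0 0)^-1 *: delta_mx 0 0) + M *: dq y.
have C1f : C1_gradient C (fun y => h (lam y) + M * q y) df.
  apply: C1_gradient_eq (C1_gradientD C1h (C1_gradientM (C1_gradient_cst C M) (C1q C))) _ _ => //.
  by move=> y; rewrite /df /= scaler0 addr0.
have q0 y : 0 <= q y by exact: sdot_ge0.
have [||y Oy uy] := max_touch cC oO OC Cz cu' _ (C1_gradient_sub C1f OC).
- by move=> y; exact: C1_gradient_continuous C1f.
- move=> y Cy nOy; rewrite lamz qz mulr0 addr0.
  have [[/= H1 H2] H3] := Cy.
  have Mq : 0 <= M * q y by rewrite mulr_ge0// ltW.
  have := pr_le y _ (ltW rho0) H3 => py.
  have [sl|ls] := ltP s (lam y); last first.
    have le : lam y = s by apply/eqP; rewrite eq_le ls H1.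
    have := Hd1 y; rewrite {1}[y]yE le addrAC subrr add0r => /(_ (le_lt_trans py rho_d1)).
    rewrite ltr_norml => /andP[_ ].
    have : d <= u z - h 0 - (u (z + s *: w) - h s) by rewrite ge_min lexx.
    lra.
  have [lt|tl] := ltP (lam y) t; last first.
    have le : lam y = t by apply/eqP; rewrite eq_le tl H2.
    have := Hd2 y; rewrite {1}[y]yE le addrAC subrr add0r => /(_ (le_lt_trans py rho_d2)).
    rewrite ltr_norml => /andP[_ ].
    have : d <= u z - h 0 - (u (z + t *: w) - h t) by rewrite ge_min lexx orbT.
    lra.
  have [qr|rq] := ltP (q y) (rho ^+ 2); first by case: nOy.
  have -> : q y = rho ^+ 2 by apply/eqP; rewrite eq_le rq H3.
  by rewrite Mrho; have := HB y Cy; lra.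
exists y, (df y), (lam y); have [[/= H1 H2] H3] := Oy; split => //.
- exact/Cr/OC.
- by rewrite H1 H2.
- rewrite /df dotDl !dotZl dqw (dotC (delta_mx _ _)) dot_delta.
  by rewrite mulr0 addr0 mulVf// mulr1.
Qed.

End Touching.

(** * Growth along timelike vectors *)

Section Monotonicity.
Context {R : realType} {n : nat}.
Local Notation E := 'rV[R]_n.+1.
Implicit Types (a b v w x y z : E) (c r e : R) (O : set E) (u : E -> R).

(** All that the arguments in coordinates retain of the inverse metric Q y a,
    where y is the point and a the covector. *)
Definition near_minkowski (Q : E -> E -> R) := forall e, 0 < e ->
  exists2 r, 0 < r & forall y a, `|y| < r -> `|Q y a - mink a a| <= e * dot a a.

(** Growth at the rate of proper time along timelike vectors; the loss e absorbs
    the deviation of the metric from its value at the origin. *)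
Definition flat_increasing u := forall e, 0 < e < 1 -> exists2 r, 0 < r &
  forall z w c, `|z| < r -> `|z + w| < r -> 0 < w 0 0 -> 0 <= c ->
  c ^+ 2 <= w 0 0 ^+ 2 / (1 + e) - sdot w w / (1 - e) -> u z + c <= u (z + w).

(** A mean value inequality: u cannot increase along w by less than the
    supergradients allow. Otherwise, for some function h of the parameter with
    slope smaller than c, u - h has an interior maximum along the segment. *)
Lemma increase_along_vector u z w c r : w 0 0 != 0 ->
  (forall y, `|y| < r -> {for y, continuous u}) ->
  `|z| < r -> `|z + w| < r ->
  (forall y a, `|y| < r -> touched_above u y a -> c <= dot a w) ->
  u z + c <= u (z + w).
Proof.
move=> w0 cu zr zwr H; rewrite leNgt; apply/negP => lt.
pose d := (u z + c - u (z + w)) / 2.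
have d0 : 0 < d by rewrite /d; lra.
have uzw : u (z + w) = u z + (c - d) - d by rewrite /d; field.
have wn0 : 0 < `|w|.
  by rewrite normr_gt0; apply: contra_neq w0 => ->; rewrite mxE.
pose th := (r - `|z|) / (2 * `|w|).
have th0 : 0 < th by rewrite divr_gt0 ?subr_gt0 ?mulr_gt0.
have thw : th * `|w| = (r - `|z|) / 2 by rewrite /th; field; rewrite gt_eqF.
have zin s : 0 <= s <= th -> `|z - s *: w| < r.
  move=> /andP[s0 sth]; rewrite (le_lt_trans (ler_normB _ _))// normrZ ger0_norm//.
  have : s * `|w| <= th * `|w| by rewrite ler_wpM2r.
  lra.
have thth : 0 <= th <= th by rewrite lexx ltW.
have [dl dl0 Hdl] := continuous_eps (cu _ (zin _ thth)) ltr01.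
pose mu := d * th / 2.
have mu0 : 0 < mu by rewrite divr_gt0// mulr_gt0.
pose B : R := `|u (z - th *: w)| + 1 + `|c - d| * th + `|u z| + mu / th.
have B0 : 0 < B.
  rewrite /B; have := mulr_ge0 (normr_ge0 (c - d)) (ltW th0).
  have := normr_ge0 (u (z - th *: w)); have := normr_ge0 (u z).
  by have := divr_gt0 mu0 th0; lra.
pose eta := Num.min (Num.min (th / 2) (dl / (2 * `|w|))) (mu / B).
have eta0 : 0 < eta.
  rewrite !lt_min (divr_gt0 mu0 B0) andbT (divr_gt0 th0 (ltr0Sn _ 1))/= divr_gt0//.
  exact: mulr_gt0.
have eta1 : eta <= th / 2 by rewrite !ge_min lexx.
have eta2 : eta * `|w| < dl.
  have : eta <= dl / (2 * `|w|) by rewrite !ge_min lexx orbT.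
  move=> /(ler_wpM2r (ltW wn0)) H1; apply: le_lt_trans H1 _.
  have -> : dl / (2 * `|w|) * `|w| = dl / 2 by field; rewrite gt_eqF.
  lra.
have eta3 : B <= mu / eta.
  rewrite ler_pdivlMr// mulrC -ler_pdivlMr//.
  by rewrite !ge_min lexx !orbT.
(* The slope of h is less than c - d, and the pole at -th makes h large at the
   lower end of the slightly extended segment, so that u - h is larger at 0 than
   at both ends. *)
pose h (s : R) := (c - d) * s + mu * (s + th)^-1.
pose h' (s : R) := (c - d) - mu * ((s + th)^-1 * (s + th)^-1).
have Hh s : - (th - eta) <= s <= 1 -> is_derive s 1 h (h' s) /\ {for s, continuous h'}.
  move=> /andP[s1 s2]; have sth : s + th != 0 by rewrite gt_eqF//; lra.
  split; last first.
    apply: continuousB; first exact: cst_continuous.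
    apply: continuousM; first exact: cst_continuous.
    have cV : {for s, continuous (fun s : R => (s + th)^-1)}.
      apply: continuousV => //.
      by apply: continuousD; [exact: cvg_id|exact: cst_continuous].
    exact: continuousM.
  have D : is_derive s 1 (fun s : R => (s + th)^-1) (- (s + th) ^- 2).
    have D0 : is_derive s 1 (fun s : R => s + th) (1 + 0) by exact: is_deriveD.
    have -> : - (s + th) ^- 2 = - (s + th) ^- 2 *: (1 + 0) by rewrite addr0 [RHS]mulr1.
    by split; [apply: derivableV => //|rewrite deriveV// derive_val].
  have -> : h' s = (c - d) *: 1 + mu *: (- (s + th) ^- 2).
    by rewrite /h' [_ *: 1]mulr1 [_ *: - _]mulrN expr2 invfM.
  by apply: is_deriveD.
have [|||||||] := @touch_along_line _ _ u z w (- (th - eta)) 1 h h' r w0.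
- by apply/andP; split; lra.
- by move=> y; exact: cu.
- by rewrite scaleNr; apply: zin; apply/andP; split; lra.
- by rewrite scale1r.
- exact: Hh.
- rewrite /h add0r mulr0 add0r.
  have -> : - (th - eta) + th = eta by ring.
  have : `|u (z - (th - eta) *: w) - u (z - th *: w)| < 1.
    apply: Hdl; have -> : z - (th - eta) *: w - (z - th *: w) = eta *: w.
      by apply/rowP => i; rewrite !mxE; ring.
    by rewrite normrZ gtr0_norm.
  rewrite ltr_norml => /andP[_ ]; rewrite scaleNr.
  have := ler_norm (u (z - th *: w)); have := ler_norm (- u z); rewrite normrN.
  have : (c - d) * (th - eta) <= `|c - d| * th.
    apply: le_trans (ler_norm _) _; rewrite normrM ler_wpM2l//.
    by rewrite ger0_norm; lra.
  by move: eta3; rewrite /B; lra.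
- rewrite scale1r uzw /h add0r mulr0 mulr1.
  have : mu * th^-1 = d / 2 by rewrite /mu; field; rewrite gt_eqF.
  have : 0 < mu * (1 + th)^-1 by rewrite divr_gt0//; lra.
  lra.
- move=> y [a [s [yr /andP[s1 s2] uy aw]]]; have := H y a yr uy.
  have sth : 0 < s + th by lra.
  have : 0 < mu * ((s + th)^-1 * (s + th)^-1) by apply: (mulr_gt0 mu0); apply: mulr_gt0; rewrite invr_gt0.
  by rewrite aw /h'; lra.
Qed.

(** The reverse Cauchy-Schwarz inequality for a timelike covector a and a timelike
    vector w, with a margin e which makes it apply to any metric close to the
    Minkowski metric. *)
Lemma reverse_CS a w c e : 0 < e < 1 -> 0 < a 0 0 -> 0 < w 0 0 -> 0 <= c ->
  1 + (1 - e) * sdot a a <= (1 + e) * a 0 0 ^+ 2 ->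
  c ^+ 2 <= w 0 0 ^+ 2 / (1 + e) - sdot w w / (1 - e) ->
  c <= dot a w.
Proof.
move=> /andP[e0 e1] a0 w0 c0 Ha Hw.
set al := (1 - e) * sdot a a; set be := sdot w w / (1 - e).
have al0 : 0 <= al by rewrite mulr_ge0 ?sdot_ge0//; lra.
have be0 : 0 <= be by rewrite divr_ge0 ?sdot_ge0//; lra.
have albe : al * be = sdot a a * sdot w w by rewrite /al /be; field; lra.
pose k := Num.sqrt al * Num.sqrt be.
have k0 : 0 <= k by rewrite mulr_ge0 ?sqrtr_ge0.
have k2 : k ^+ 2 = al * be by rewrite exprMn !sqr_sqrtr.
have xk : - k <= sdot a w.
  suff : `|sdot a w| <= k by rewrite ler_norml => /andP[].
  rewrite -(@ler_pXn2r _ 2)// ?nnegrE// real_normK ?num_real// k2 albe.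
  exact: sdot_CS.
suff : c + k <= a 0 0 * w 0 0 by rewrite /dot; lra.
rewrite -(@ler_pXn2r _ 2)// ?nnegrE ?addr_ge0// ?mulr_ge0 ?(ltW a0) ?(ltW w0)//.
have H1 : (c + k) ^+ 2 <= (1 + al) * (c ^+ 2 + be).
  have : 0 <= (c * Num.sqrt al - Num.sqrt be) ^+ 2 by exact: sqr_ge0.
  have := sqr_sqrtr al0; have := sqr_sqrtr be0.
  by rewrite /k; nra.
apply: le_trans H1 _.
have -> : (a 0 0 * w 0 0) ^+ 2 = ((1 + e) * a 0 0 ^+ 2) * (w 0 0 ^+ 2 / (1 + e)) by field; lra.
by apply: ler_pM; rewrite ?addr_ge0 ?sqr_ge0//; move: Hw; rewrite -/be; lra.
Qed.

Lemma flat_increasing_of_touching Q u r : near_minkowski Q -> 0 < r ->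
  (forall y, `|y| < r -> {for y, continuous u}) ->
  (forall y a, `|y| < r -> touched_above u y a -> Q y a <= -1 /\ 0 < a 0 0) ->
  flat_increasing u.
Proof.
move=> HQ r0 cu H e e01; have /andP[e0 e1] := e01.
have [r1 r10 H1] := HQ e e0.
have [rr rr1] : Num.min r r1 <= r /\ Num.min r r1 <= r1 by rewrite !ge_min !lexx orbT.
exists (Num.min r r1); first by rewrite lt_min r0 r10.
move=> z w c zr zwr w0 c0 cw.
apply: (@increase_along_vector _ _ _ _ (Num.min r r1)) => //.
- by rewrite gt_eqF.
- by move=> y yr; apply: cu; lra.
move=> y a yr uya; have [Qa a0] := H y a (lt_le_trans yr rr) uya.
apply: (@reverse_CS _ _ _ e) => //.
have := H1 y a (lt_le_trans yr rr1); rewrite ler_norml => /andP[+ _].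
by rewrite /mink /dot; nra.
Qed.

Lemma gradient_eps_at (f : E -> R) x a e : has_gradient f x a -> 0 < e ->
  exists2 r, 0 < r & forall y, `|y| < r -> `|f (y + x) - f x - dot a y| <= e * `|y|.
Proof.
move=> /has_gradientP/(_ e) + e0 => /(_ e0)/nbhs_ballP[r r0 H].
exists r => // y yr; apply: H.
by rewrite -ball_normE/= sub0r normrN.
Qed.

Lemma gradient_eps (f : E -> R) a e : has_gradient f 0 a -> 0 < e ->
  exists2 r, 0 < r & forall y, `|y| < r -> `|f y - f 0 - dot a y| <= e * `|y|.
Proof.
move=> fa /(gradient_eps_at fa)[r r0 H].
by exists r => // y /H; rewrite addr0.
Qed.

Lemma near0_eps (P : E -> Prop) : (\forall y \near (0 : E), P y) ->
  exists2 r, 0 < r & forall y, `|y| < r -> P y.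
Proof.
move=> /nbhs_ballP[r r0 H]; exists r => // y yr; apply: H.
by rewrite -ball_normE/= sub0r normrN.
Qed.

(** At small scale the gradient of the test function dominates, so that it
    inherits the growth of u in the limit where the loss e vanishes. A function
    touching from above is compared at w, one touching from below at -w. *)
Lemma increasing_touch_dot u (f : E -> R) a w c :
  flat_increasing u -> has_gradient f 0 a -> f 0 = u 0 ->
  (\forall y \near (0 : E), u y <= f y) \/ (\forall y \near (0 : E), f y <= u y) ->
  0 < w 0 0 -> 0 <= c -> c ^+ 2 < w 0 0 ^+ 2 - sdot w w -> c <= dot a w.
Proof.
move=> uinc fa f0 uf w0 c0 cw.
have Sw := sdot_ge0 w.
set D := w 0 0 ^+ 2 - sdot w w - c ^+ 2.
have D0 : 0 < D by rewrite /D; lra.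
have W0 : 0 < w 0 0 ^+ 2 by rewrite exprn_gt0.
pose e := Num.min 2^-1 (D / (4 * w 0 0 ^+ 2)).
have e0 : 0 < e by rewrite lt_min invr_gt0 ltr0n/=; apply: divr_gt0 => //; exact: mulr_gt0.
have e2 : e <= 2^-1 by rewrite ge_min lexx.
have eD : e * w 0 0 ^+ 2 <= D / 4.
  have : e <= D / (4 * w 0 0 ^+ 2) by rewrite ge_min lexx orbT.
  by move=> /(ler_wpM2r (ltW W0)); congr (_ <= _); field; rewrite gt_eqF.
have cwe : c ^+ 2 <= w 0 0 ^+ 2 / (1 + e) - sdot w w / (1 - e).
  have H1 : w 0 0 ^+ 2 * (1 - e) <= w 0 0 ^+ 2 / (1 + e).
    rewrite ler_pdivlMr; last lra.
    have : 0 <= w 0 0 ^+ 2 * e ^+ 2 by rewrite mulr_ge0 ?sqr_ge0.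
    by lra.
  have H2 : sdot w w / (1 - e) <= sdot w w * (1 + 2 * e).
    rewrite ler_pdivrMr; last lra.
    have e12 : 0 <= e * (1 - 2 * e) by apply: mulr_ge0; lra.
    by have := mulr_ge0 Sw e12; lra.
  have : sdot w w * e <= w 0 0 ^+ 2 * e.
    by rewrite ler_wpM2r; [by []|lra|move: D0; rewrite /D; have := sqr_ge0 c; lra].
  by move: eD; rewrite /D; move: H1 H2; lra.
have e01 : 0 < e < 1 by apply/andP; split; lra.
have [r1 r10 H1] := uinc e e01.
rewrite leNgt; apply/negP => lt.
have wn0 : 0 < `|w|.
  by rewrite normr_gt0; apply/eqP => w00; move: w0; rewrite w00 mxE ltxx.
pose d := (c - dot a w) / (2 * `|w|).
have d0 : 0 < d by rewrite divr_gt0 ?mulr_gt0// subr_gt0.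
have dE : d * `|w| = (c - dot a w) / 2 by rewrite /d; field; rewrite gt_eqF.
have [r2 r20 H2] := gradient_eps fa d0.
pose t0 r := r / (2 * `|w|).
have t0P r t : 0 < r -> 0 < t -> t <= t0 r -> `|t *: w| < r.
  move=> r0 t0' tr; rewrite normrZ gtr0_norm//.
  have := ler_wpM2r (ltW wn0) tr.
  have -> : t0 r * `|w| = r / 2 by rewrite /t0; field; rewrite gt_eqF.
  lra.
have t0_gt0 r : 0 < r -> 0 < t0 r by move=> r0; rewrite divr_gt0// mulr_gt0.
have ct t : 0 < t -> (t * c) ^+ 2 <= (t *: w) 0 0 ^+ 2 / (1 + e) -
    sdot (t *: w) (t *: w) / (1 - e).
  move=> t_gt0; rewrite !mxE !sdotE.
  have -> : (t * w 0 0) ^+ 2 / (1 + e) - t * (t * sdot w w) / (1 - e) =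
    t ^+ 2 * (w 0 0 ^+ 2 / (1 + e) - sdot w w / (1 - e)) by ring.
  by rewrite exprMn ler_wpM2l// sqr_ge0.
have {}H2 t : 0 < t -> t <= t0 r2 -> f 0 + t * dot a w - t * ((c - dot a w) / 2) <=
    f (t *: w) <= f 0 + t * dot a w + t * ((c - dot a w) / 2) /\
    f 0 - t * dot a w - t * ((c - dot a w) / 2) <= f (- (t *: w)).
  move=> t_gt0 tr; have := H2 _ (t0P _ _ r20 t_gt0 tr).
  have := H2 (- (t *: w)); rewrite normrN => /(_ (t0P _ _ r20 t_gt0 tr)).
  rewrite dotNr dotZr normrZ gtr0_norm// -dE !ler_norml mulrCA.
  clear -fa.
  by move=> /andP[A1 A2] /andP[A3 A4]; split; [apply/andP; split|]; lra.
case: uf => /near0_eps[r3 r30 H3].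
all: pose t := Num.min (t0 r1) (Num.min (t0 r2) (t0 r3)).
all: have t_gt0 : 0 < t by rewrite !lt_min !t0_gt0.
all: have tr1 : `|t *: w| < r1 by apply: t0P => //; rewrite ge_min lexx.
all: have tr2 : t <= t0 r2 by rewrite !ge_min lexx orbT.
all: have tr3 : `|t *: w| < r3 by apply: t0P => //; rewrite !ge_min lexx !orbT.
all: have tw0 : 0 < (t *: w) 0 0 by rewrite mxE mulr_gt0.
all: have tc0 : 0 <= t * c by rewrite mulr_ge0// ltW.
- have := H1 0 (t *: w) (t * c); rewrite normr0 add0r => /(_ r10 tr1 tw0 tc0 (ct _ t_gt0)).
  have := H3 _ tr3; have [/andP[_ +] _] := H2 t t_gt0 tr2.
  rewrite -f0; have : 0 < t * (c - dot a w) by rewrite mulr_gt0// subr_gt0.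
  lra.
- have := H1 (- (t *: w)) (t *: w) (t * c); rewrite normrN addNr normr0.
  move=> /(_ tr1 r10 tw0 tc0 (ct _ t_gt0)).
  have := H3 (- (t *: w)); rewrite normrN => /(_ tr3).
  have [_ +] := H2 t t_gt0 tr2.
  rewrite -f0; have : 0 < t * (c - dot a w) by rewrite mulr_gt0// subr_gt0.
  lra.
Qed.

(** The converse of the reverse Cauchy-Schwarz inequality: a covector that is at
    least as large as proper time on every vector w timelike with w00 > 0 has
    positive time component and Minkowski square at most -1. It is enough to test
    it on the vector where the reverse inequality is sharp. *)
Lemma increasing_touch u (f : E -> R) a :
  flat_increasing u -> has_gradient f 0 a -> f 0 = u 0 ->
  (\forall y \near (0 : E), u y <= f y) \/ (\forall y \near (0 : E), f y <= u y) ->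
  0 < a 0 0 /\ mink a a <= -1.
Proof.
move=> uinc fa f0 uf.
have Sa := sdot_ge0 a.
pose k := Num.sqrt (1 + sdot a a).
have k2 : k ^+ 2 = 1 + sdot a a by rewrite sqr_sqrtr//; lra.
have k0 : 0 < k by rewrite sqrtr_gt0; lra.
(* Up to sign, w is the Minkowski dual of the unit timelike covector with the
   spatial part of a; at this w the reverse Cauchy-Schwarz inequality is sharp. *)
pose w : E := k *: delta_mx 0 0 - spatial a.
have w0 : w 0 0 = k by rewrite !mxE/=; ring.
have sw v : sdot w v = - sdot a v.
  rewrite /w sdotDl sdotZl sdotNl sdot_spatial.
  suff -> : sdot (delta_mx 0 0) v = 0 by rewrite mulr0 add0r.
  by rewrite /sdot big1// => i _; rewrite mxE mul0r.
have Hc c : 0 <= c -> c < 1 -> c <= a 0 0 * k - sdot a a.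
  move=> c0 c1; have -> : a 0 0 * k - sdot a a = dot a w.
    by rewrite /dot w0 (sdotC a) sw.
  apply: (increasing_touch_dot uinc fa f0 uf) => //; rewrite w0//.
  have -> : sdot w w = sdot a a by rewrite sw sdotC sw opprK.
  have : 0 <= c * (1 - c) by rewrite mulr_ge0// subr_ge0 ltW.
  by rewrite k2; lra.
have {}Hc : 1 <= a 0 0 * k - sdot a a.
  rewrite leNgt; apply/negP => lt.
  have := Hc ((1 + Num.max 0 (a 0 0 * k - sdot a a)) / 2).
  have : 0 <= Num.max 0 (a 0 0 * k - sdot a a) by rewrite le_max lexx.
  have : a 0 0 * k - sdot a a <= Num.max 0 (a 0 0 * k - sdot a a) by rewrite le_max lexx orbT.
  have : Num.max 0 (a 0 0 * k - sdot a a) < 1 by rewrite gt_max ltr01 lt.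
  move: (Num.max _ _) => m m1 m2 m3 /(_ _ _)H; have : 0 <= (1 + m) / 2 by lra.
  by move=> /H; lra.
have ka : k <= a 0 0.
  by rewrite -(ler_pM2r k0) -expr2 k2; lra.
split; first exact: lt_le_trans ka.
rewrite /mink; have : k * k <= a 0 0 * a 0 0 by rewrite ler_pM// ltW.
by rewrite -expr2 k2; lra.
Qed.

(** The sign of the time component of supergradients is locally constant. The test
    function forces u to decrease strictly over a fixed distance along the time
    axis, and this persists nearby. A supergradient with the opposite sign at a
    nearby y would make u larger at y than on both sides along the time axis,
    hence give a supergradient without time component, which H forbids. *)
Lemma touched_above_future u (f : E -> R) a r : 0 < r ->
  (forall y, `|y| < r -> {for y, continuous u}) ->
  (forall y b, `|y| < r -> touched_above u y b -> b 0 0 != 0) ->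
  has_gradient f 0 a -> f 0 = u 0 -> (\forall y \near (0 : E), u y <= f y) -> a 0 0 < 0 ->
  exists2 s, 0 < s & forall y b, `|y| < s -> touched_above u y b -> b 0 0 < 0.
Proof.
move=> r0 cu H fa f0 /near0_eps[r1 r10 H1] a0.
pose e0 : E := delta_mx 0 0.
have ne0 : `|e0| <= 1.
  apply: norm_le_coord => // i; rewrite mxE /=; case: eqP => _ /=.
  - by rewrite normr1.
  - by rewrite normr0.
have norme t : 0 <= t -> `|t *: e0| <= t.
  by move=> t0; rewrite normrZ ger0_norm// ler_piMr.
have a2 : 0 < - a 0 0 / 2 by lra.
have [r2 r20 H2] := gradient_eps fa a2.
pose t := Num.min r (Num.min r1 r2) / 4.
have t0 : 0 < t by rewrite divr_gt0// !lt_min r0 r10 r20.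
have [tr [tr1 tr2]] : t <= r / 4 /\ t < r1 /\ t < r2.
  have : Num.min r (Num.min r1 r2) <= r by rewrite ge_min lexx.
  have : Num.min r (Num.min r1 r2) <= r1 by rewrite !ge_min lexx orbT.
  have : Num.min r (Num.min r1 r2) <= r2 by rewrite !ge_min lexx !orbT.
  by rewrite /t; move: (Num.min _ _) => m; lra.
have tn := norme t (ltW t0).
have ut : u (t *: e0) < u 0.
  have := H1 _ (le_lt_trans tn tr1); have := H2 _ (le_lt_trans tn tr2).
  rewrite ler_norml dotZr dot_delta -f0 => /andP[_ ].
  have : - a 0 0 / 2 * `|t *: e0| <= - a 0 0 / 2 * t by rewrite ler_wpM2l//; lra.
  have : 0 < t * - a 0 0 by apply: mulr_gt0 => //; lra.
  lra.
have [d1 d10 Hd1] : exists2 d, 0 < d & forall y, `|y| < d -> u (y + t *: e0) < u y.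
  pose e := (u 0 - u (t *: e0)) / 2.
  have e0' : 0 < e by rewrite divr_gt0// subr_gt0.
  have zr : `|0 : E| < r by rewrite normr0.
  have tr' : `|t *: e0| < r by lra.
  have [d1 d10 Hd1] := continuous_eps (cu _ zr) e0'.
  have [d2 d20 Hd2] := continuous_eps (cu _ tr') e0'.
  exists (Num.min d1 d2); first by rewrite lt_min d10 d20.
  move=> y; rewrite lt_min => /andP[y1 y2].
  have := Hd1 y; rewrite subr0 => /(_ y1); have := Hd2 (y + t *: e0).
  by rewrite addrK => /(_ y2); rewrite !ltr_norml /e => /andP[_ +] /andP[+ _]; lra.
exists (Num.min d1 (r / 4)); first by rewrite lt_min d10 divr_gt0.
move=> y b; rewrite lt_min => /andP[yd yr] uyb.
have yr' : `|y| < r by lra.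
rewrite ltNge; apply/negP; rewrite le_eqVlt eq_sym (negPf (H _ _ yr' uyb))/= => b0.
move: uyb => [ O [g [dg [[oO Oy Cg gy dgy] ug]]]].
have [dg' _] := Cg y Oy; rewrite dgy in dg'.
pose c := b 0 0 / 2.
have c0 : 0 < c by rewrite divr_gt0.
have [r4 r40 H4] := gradient_eps_at dg' c0.
have [r5 r50 H5] : exists2 s, 0 < s & forall v, `|v| < s -> O (y + v).
  have /nbhs_ballP[s s0 Hs] := open_nbhs_nbhs (conj oO Oy).
  by exists s => // v vs; apply: Hs; rewrite -ball_normE/= opprD addNKr normrN.
pose s := Num.min (r / 4) (Num.min r4 r5) / 2.
have s0 : 0 < s by rewrite divr_gt0// !lt_min r40 r50 divr_gt0.
have [sr [sr4 sr5]] : s <= r / 8 /\ s < r4 /\ s < r5.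
  have : Num.min (r / 4) (Num.min r4 r5) <= r / 4 by rewrite ge_min lexx.
  have : Num.min (r / 4) (Num.min r4 r5) <= r4 by rewrite !ge_min lexx orbT.
  have : Num.min (r / 4) (Num.min r4 r5) <= r5 by rewrite !ge_min lexx !orbT.
  by rewrite /s; move: (Num.min _ _) => m; lra.
have sn : `|- s *: e0| <= s by rewrite scaleNr normrN norme// ltW.
have us : u (y + - s *: e0) < u y.
  have := ug _ (H5 _ (le_lt_trans sn sr5)); have := H4 _ (le_lt_trans sn sr4).
  rewrite ler_norml dotZr dot_delta gy (addrC _ y) => /andP[_ ].
  have : c * `|- s *: e0| <= c * s by rewrite ler_wpM2l// ltW.
  rewrite /c; have : 0 < s * b 0 0 by exact: mulr_gt0.
  lra.
have e00 : e0 0 0 != 0 by rewrite mxE/= oner_eq0.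
have [|||||||] := @touch_along_line _ _ u y e0 (- s) t (fun=> 0) (fun=> 0) r e00.
- by rewrite t0 oppr_lt0 s0.
- exact: cu.
- by apply: le_lt_trans (ler_normD _ _) _; lra.
- by apply: le_lt_trans (ler_normD _ _) _; lra.
- by move=> k _; split; [exact: is_derive_cst|exact: cst_continuous].
- by rewrite !subr0.
- by rewrite !subr0; exact: Hd1.
- move=> y1 [a1 [k [y1r _ /(H _ _ y1r) + ]]].
  by rewrite dot_delta => /eqP.
Qed.
End Monotonicity.

(** * Differentiability at points with a subgradient *)

Section Differentiability.
Context {R : realType} {n : nat}.
Local Notation E := 'rV[R]_n.+1.
Implicit Types (a b v w x y z : E) (c r e : R) (O : set E) (u : E -> R).

Lemma C1_gradient_parabola O a k :
  C1_gradient O (fun y => dot a y + k * sdot y y)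
    (fun y => a + k *: (2 *: spatial y)).
Proof.
apply: C1_gradientD; first exact: C1_gradient_dot.
apply: C1_gradient_eq (C1_gradientM (C1_gradient_cst O k) (C1_gradient_sdot O)) _ _ => //.
by move=> y; rewrite scaler0 addr0.
Qed.

Lemma dot_e0 v : dot (delta_mx 0 0) v = v 0 0.
Proof. by rewrite dotC dot_delta. Qed.

Lemma sdot_e0 v : sdot (delta_mx 0 0) v = 0.
Proof. by rewrite /sdot big1// => i _; rewrite mxE mul0r. Qed.

Lemma sdot_continuous : continuous (fun y : E => sdot y y).
Proof. by move=> y; exact: (C1_gradient_continuous (C1_gradient_sdot setT)). Qed.

Lemma coord0_continuous : continuous (fun y : E => y 0 0).
Proof. by move=> y; exact: coord_continuous. Qed.

(** The arithmetic of the growth from a point z up to the top of a box of height K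
    * rho around the origin, rho being the norm of z: the increment w between the
    two is so steep, K being large in terms of eta, that growth at the rate of
    proper time loses at most eta * rho / 2 on w00. *)
Lemma top_growth (eta K e rho w00 Sw N : R) :
  0 < eta <= 1 -> 0 <= N -> K = 3 + 2 * (1 + 4 * (1 + N)) / eta ->
  0 < e -> e <= 2^-1 -> e * (K + 1) <= eta / 2 ->
  0 < rho -> (K - 1) * rho <= w00 -> w00 <= (K + 1) * rho ->
  0 <= Sw -> Sw <= 2 * (1 + N) * rho ^+ 2 ->
  0 <= w00 - eta * rho / 2 /\
  (w00 - eta * rho / 2) ^+ 2 <= w00 ^+ 2 / (1 + e) - Sw / (1 - e).
Proof.
move=> /andP[eta0 eta1] N0 KE e0 e2 eK rho0 w1 w2 S0 S1.
have er0 : 0 < eta * rho by exact: mulr_gt0.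
have er1 : eta * rho <= rho by rewrite ler_piMl// ltW.
have KE' : eta * (K - 1) = 2 * eta + 2 * (1 + 4 * (1 + N)).
  by rewrite KE; field; rewrite gt_eqF.
have K3 : 3 <= K.
  rewrite KE lerDl divr_ge0//; last exact: ltW.
  lra.
have w0 : 2 * rho <= w00 by apply: le_trans w1; rewrite ler_wpM2r//; [exact: ltW|lra].
split; first lra.
have W0 : 0 < w00 ^+ 2 by rewrite exprn_gt0//; lra.
have H1 : w00 ^+ 2 * (1 - e) <= w00 ^+ 2 / (1 + e).
  rewrite ler_pdivlMr; last lra.
  have : 0 <= w00 ^+ 2 * e ^+ 2 by rewrite mulr_ge0 ?sqr_ge0.
  by lra.
have H2 : Sw / (1 - e) <= 2 * Sw.
  rewrite ler_pdivrMr; last lra.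
  have : 0 <= Sw * (1 - 2 * e) by rewrite mulr_ge0//; lra.
  lra.
have H3 : e * w00 ^+ 2 <= eta * rho * w00 / 2.
  have : e * w00 <= e * (K + 1) * rho by rewrite -mulrA ler_wpM2l// ltW.
  have : e * (K + 1) * rho <= eta / 2 * rho by rewrite ler_wpM2r// ltW.
  move=> A B; have : e * w00 <= eta / 2 * rho by exact: le_trans B A.
  have w00' : 0 <= w00 by lra.
  by move=> /(ler_wpM2r w00'); rewrite expr2; lra.
have H4 : eta * rho ^+ 2 * (K - 1) <= eta * rho * w00.
  have : eta * rho * ((K - 1) * rho) <= eta * rho * w00 by rewrite ler_wpM2l// ltW.
  by rewrite expr2; lra.
have H5 : eta * rho ^+ 2 * (K - 1) = rho ^+ 2 * (2 * eta + 2 * (1 + 4 * (1 + N))).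
  by rewrite -KE'; ring.
have H6 : (eta * rho) ^+ 2 <= rho ^+ 2 by rewrite ler_pXn2r ?nnegrE// ltW.
have H7 : 0 <= rho ^+ 2 * eta by rewrite mulr_ge0 ?sqr_ge0// ltW.
have H8 : 0 <= rho ^+ 2 * N by rewrite mulr_ge0 ?sqr_ge0.
have -> : (w00 - eta * rho / 2) ^+ 2 = w00 ^+ 2 - eta * rho * w00 + (eta * rho) ^+ 2 / 4 by field.
have := sqr_ge0 rho; lra.
Qed.

(** If u lies above u 0 + y00, up to a small multiple of |y|, and strictly above
    by eta * s / (2 * K) on the middle of the top of a box of size s, then the
    concave parabola of slope 1 + mu in time touches it from below inside the box;
    the covector of the parabola there is too steep for a subgradient. *)
Lemma boxed_subgradient_false (Q : E -> E -> R) u (s K mu eta del r : R) : 0 < s -> 3 <= K ->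
  0 < mu -> 4 * mu * (2 * K ^+ 2) ^+ 2 <= 1 -> mu < eta / (2 * K) -> 2 * del <= mu -> 0 < del ->
  s < r ->
  (forall y, `|y| < r -> {for y, continuous u}) ->
  (forall y a, `|y| < r -> touched_below u y a -> -1 <= Q y a) ->
  (forall y a, `|y| < r -> `|Q y a - mink a a| <= mu / 10 * dot a a) ->
  (forall y, `|y| < r -> u 0 + y 0 0 - del * `|y| <= u y) ->
  (forall y, `|y| < r -> y 0 0 = s -> sdot y y <= (s / K) ^+ 2 ->
      u 0 + s + eta * (s / K) / 2 <= u y) -> False.
Proof.
move=> s0 K3 mu0 muC muK dmu d0 sr cu Qu Qm ulow utop.
pose C := 2 * K ^+ 2.
have K29 : 9 <= K ^+ 2.
  by have : 3 * 3 <= K * K by [apply: ler_pM; lra]; rewrite expr2; lra.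
have C0 : 18 <= C by rewrite /C; lra.
have C2 : 324 <= C ^+ 2.
  by have : 18 * 18 <= C * C by [apply: ler_pM; lra]; rewrite expr2; lra.
have mu1 : mu <= 1.
  have : mu * 324 <= mu * C ^+ 2 by rewrite ler_wpM2l// ltW.
  by move: muC; rewrite -/C; lra.
(* The parabola loses mu * C * s over the radius s, which beats the error on the
   walls of the box; by muC its spatial slope stays below sqrt mu, so that its
   covector remains steeper than 1. *)
pose k := - (mu * C / s).
have sn0 : s != 0 by rewrite gt_eqF.
have K0 : K != 0 by rewrite gt_eqF//; lra.
have ks : k * s ^+ 2 = - (mu * C * s) by rewrite /k; field.
pose f y := dot ((1 + mu) *: delta_mx 0 0) y + k * sdot y y.
have fE y : f y = (1 + mu) * y 0 0 + k * sdot y y by rewrite /f dotZl dot_e0.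
pose B := [set y : E | - s <= y 0 0] `&` [set y | y 0 0 <= s] `&` [set y | sdot y y <= s ^+ 2].
pose O := [set y : E | - s < y 0 0] `&` [set y | y 0 0 < s] `&` [set y | sdot y y < s ^+ 2].
have OB : O `<=` B by move=> y [[/= H1 H2] H3]; split; [split|]; exact: ltW.
have Bs y : B y -> `|y| <= s.
  by move=> [[/= H1 H2] H3]; apply: norm_le_sdot; rewrite ?(ltW s0)// ler_norml H1 H2.
have Br y : B y -> `|y| < r by move=> /Bs ys; exact: le_lt_trans sr.
have cB : compact B.
  apply: (@compact_norm_bounded _ _ _ s) => //.
  apply: closedI; last exact: closed_le_fun sdot_continuous.
  by apply: closedI; [apply: closed_ge_fun|apply: closed_le_fun]; exact: coord0_continuous.
have oO : open O.
  apply: openI; last exact: open_lt_fun sdot_continuous.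
  by apply: openI; [apply: open_gt_fun|apply: open_lt_fun]; exact: coord0_continuous.
have sdot0 : sdot (0 : E) 0 = 0 by rewrite /sdot big1// => i _; rewrite mxE mul0r.
have B0 : B 0.
  by split; [split|] => /=; rewrite ?sdot0 ?mxE ?oppr_le0 ?sqr_ge0 ?(ltW s0).
have C1f A := @C1_gradient_parabola A ((1 + mu) *: delta_mx 0 0) k.
have f0 : f 0 = 0 by rewrite fE sdot0 mxE !mulr0 addr0.
have cuB y : B y -> {for y, continuous u} by move=> /Br; exact: cu.
have cfB y : B y -> {for y, continuous (fun y => dot ((1 + mu) *: delta_mx 0 0) y + k * sdot y y)}.
  exact: C1_gradient_continuous (C1f B).
have [|y Oy uy] := min_touch cB oO OB B0 cuB cfB (C1f O).
  move=> y By nOy; have yr := Br y By.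
  rewrite -[dot _ 0 + _]/(f 0) -[dot _ y + _]/(f y) f0 fE.
  have [[/= H1 H2] H3] := By.
  have S0 := sdot_ge0 y.
  have kS : - (mu * C * s) <= k * sdot y y <= 0.
    rewrite -ks; have k0 : k <= 0 by rewrite /k oppr_le0 divr_ge0 ?mulr_ge0 ?(ltW mu0) ?(ltW s0)//; lra.
    by rewrite mulr_le0_ge0// andbT ler_wnM2l.
  have /andP[kS1 kS2] := kS.
  have low : u 0 + y 0 0 - del * s <= u y.
    have := ulow y yr; have : del * `|y| <= del * s by rewrite ler_wpM2l ?Bs// ltW.
    lra.
  have dms : 2 * del * s <= mu * s by rewrite ler_wpM2r// ltW.
  have ms0 : 0 < mu * s by exact: mulr_gt0.
  have my : mu * y 0 0 <= mu * s by rewrite ler_wpM2l// ltW.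
  have [ly|yl] := ltP (- s) (y 0 0); last first.
    have ye : y 0 0 = - s by apply/eqP; rewrite eq_le yl H1.
    by rewrite ye in low *; clear -low dms ms0 kS2; lra.
  have [qr|rq] := ltP (sdot y y) (s ^+ 2); last first.
    have qe : sdot y y = s ^+ 2 by apply/eqP; rewrite eq_le rq H3.
    rewrite qe ks.
    have : 18 * (mu * s) <= C * (mu * s) by rewrite ler_wpM2r// ltW.
    by clear -low dms ms0 my; lra.
  have [yt|ty] := ltP (y 0 0) s; first by case: nOy.
  have ye : y 0 0 = s by apply/eqP; rewrite eq_le ty H2.
  have [Sk|kSy] := lerP (sdot y y) ((s / K) ^+ 2).
    have := utop y yr ye Sk; rewrite ye.
    have : mu * s < eta / (2 * K) * s by rewrite ltr_pM2r.
    have -> : eta / (2 * K) * s = eta * (s / K) / 2 by field.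
    by clear -kS2; lra.
  have : k * sdot y y <= - (2 * (mu * s)).
    have -> : - (2 * (mu * s)) = k * (s / K) ^+ 2.
      by rewrite /k /C; field; rewrite K0 sn0.
    rewrite ler_wnM2l ?(ltW kSy)// /k oppr_le0 divr_ge0 ?mulr_ge0 ?(ltW mu0) ?(ltW s0)//; lra.
  by rewrite ye in low *; clear -low dms ms0; lra.
set a : E := _ + _ in uy.
have yr := Br y (OB y Oy).
have a0 : a 0 0 = 1 + mu by rewrite /a !mxE/=; ring.
have sa : sdot a a = (2 * k) ^+ 2 * sdot y y.
  rewrite /a !sdotE !(sdotC _ (delta_mx _ _)) !sdot_e0 !sdot_spatial.
  by rewrite (sdotC y (spatial y)) sdot_spatial; ring.
have Sa : sdot a a <= mu.
  have [_ /= /ltW Sy] := Oy.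
  have : sdot a a <= (2 * k) ^+ 2 * s ^+ 2 by rewrite sa ler_wpM2l// sqr_ge0.
  have -> : (2 * k) ^+ 2 * s ^+ 2 = mu * (4 * mu * C ^+ 2) by rewrite /k; field.
  have : mu * (4 * mu * C ^+ 2) <= mu * 1 by rewrite ler_wpM2l// ltW.
  lra.
have := Qm y a yr; rewrite ler_norml => /andP[_ ].
have := Qu y a yr uy.
have S0 := sdot_ge0 a.
rewrite /mink /dot a0 -expr2 => H1 H2.
have H3 : mu ^+ 2 <= mu by rewrite expr2 ler_piMl// ltW.
have : mu / 10 * ((1 + mu) ^+ 2 + sdot a a) <= mu / 10 * 5.
  by rewrite ler_wpM2l//; [lra|]; clear -H3 mu1 Sa; lra.
by have := sqr_ge0 mu; clear -H1 H2 Sa mu0 mu1; lra.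
Qed.

(** The covector e0 is a subgradient at 0; the point is the matching upper bound.
    If u exceeded u 0 + z00 by eta * |z| at some z, growth would carry this excess
    up to the top of a box of size comparable to |z|, and a steeper parabola would
    fit below u. *)
Lemma differentiable_at_subgradient (Q : E -> E -> R) u r0 : near_minkowski Q ->
  flat_increasing u -> 0 < r0 ->
  (forall y, `|y| < r0 -> {for y, continuous u}) ->
  (forall y a, `|y| < r0 -> touched_below u y a -> -1 <= Q y a) ->
  (forall d, 0 < d -> exists2 r, 0 < r & forall y, `|y| < r -> u 0 + y 0 0 - d * `|y| <= u y) ->
  has_gradient u 0 (delta_mx 0 0).
Proof.
move=> HQ uinc r00 cu Qu ulow.
apply/has_gradientP => e e0.
pose eta := Num.min e 1.
have eta0 : 0 < eta by rewrite lt_min e0 ltr01.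
have eta1 : eta <= 1 by rewrite ge_min lexx orbT.
have etae : eta <= e by rewrite ge_min lexx.
pose N : R := n%:R.
have N0 : 0 <= N by rewrite ler0n.
(* K is the height of the box in units of the norm of z, as required by
   top_growth. *)
pose K := 3 + 2 * (1 + 4 * (1 + N)) / eta.
have K3 : 3 <= K by rewrite lerDl divr_ge0 ?(ltW eta0)//; lra.
have C2 : 0 < (2 * K ^+ 2) ^+ 2.
  by rewrite exprn_gt0// mulr_gt0// exprn_gt0//; lra.
pose mu := Num.min (1 / (4 * (2 * K ^+ 2) ^+ 2)) (eta / (4 * K)).
have etaK : 0 < eta / (4 * K) by rewrite divr_gt0//; lra.
have mu0 : 0 < mu by rewrite lt_min etaK andbT divr_gt0// mulr_gt0.
have muC : 4 * mu * (2 * K ^+ 2) ^+ 2 <= 1.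
  have : mu <= 1 / (4 * (2 * K ^+ 2) ^+ 2) by rewrite ge_min lexx.
  by rewrite ler_pdivlMr ?mulr_gt0//; lra.
have muK1 : mu <= eta / (4 * K) by rewrite ge_min lexx orbT.
have muK2 : eta / (4 * K) < eta / (2 * K).
  have -> : eta / (2 * K) = 2 * (eta / (4 * K)) by field; lra.
  by clear -etaK; lra.
have mueta : mu <= eta.
  apply: le_trans muK1 _; rewrite ler_pdivrMr; last lra.
  by rewrite ler_peMr// ?(ltW eta0)//; lra.
have mu10 : 0 < mu / 10 by rewrite divr_gt0.
pose em := Num.min 2^-1 (eta / (2 * (K + 1))).
have em0 : 0 < em by rewrite lt_min invr_gt0 ltr0n/= divr_gt0//; lra.
have em2 : em <= 2^-1 by rewrite ge_min lexx.
have emK : em * (K + 1) <= eta / 2.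
  have : em <= eta / (2 * (K + 1)) by rewrite ge_min lexx orbT.
  rewrite ler_pdivlMr; last lra.
  lra.
have em01 : 0 < em < 1 by rewrite em0/=; lra.
have [r1 r10 H1] := HQ _ mu10.
have [r2 r20 H2] := uinc _ em01.
have del0 : 0 < mu / 2 by rewrite divr_gt0.
have [r3 r30 H3] := ulow _ del0.
pose r := Num.min (Num.min r0 r1) (Num.min r2 r3).
have r_gt0 : 0 < r by rewrite !lt_min r00 r10 r20 r30.
have [rr0 [rr1 [rr2 rr3]]] : r <= r0 /\ r <= r1 /\ r <= r2 /\ r <= r3.
  by rewrite /r !ge_min !lexx !orbT.
apply/nbhs_ballP; exists (r / K) => /=; first by rewrite divr_gt0//; lra.
move=> z; rewrite -ball_normE/= sub0r normrN addr0 => zr.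
have zr' : `|z| * K < r by move: zr; rewrite ltr_pdivlMr//; lra.
have [z0|z0] := eqVneq z 0.
  by rewrite z0 subrr dotC dot0l subr0 !normr0 mulr0.
have rho0 : 0 < `|z| by rewrite normr_gt0.
have rhoK : `|z| * 3 <= `|z| * K by rewrite ler_wpM2l.
have zr3 : `|z| < r by clear -rhoK zr' rho0; lra.
rewrite dot_e0.
have low : - (eta * `|z|) <= u z - u 0 - z 0 0.
  have := H3 z (lt_le_trans zr3 rr3).
  have : mu * `|z| <= eta * `|z| by rewrite ler_wpM2r// ltW.
  have := mulr_gt0 mu0 rho0.
  by clear; lra.
have ee : eta * `|z| <= e * `|z| by rewrite ler_wpM2r// ltW.
rewrite ler_norml; apply/andP; split; first by clear -low ee; lra.
apply: le_trans ee; rewrite leNgt; apply/negP => up.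
have sK : K * `|z| / K = `|z| by field; lra.
apply: (@boxed_subgradient_false Q u (K * `|z|) K mu eta (mu / 2) r) => //.
- by rewrite mulr_gt0//; lra.
- exact: le_lt_trans muK2.
- by clear; lra.
- by rewrite mulrC.
- by move=> y yr; apply: cu; exact: lt_le_trans rr0.
- by move=> y a yr; apply: Qu; exact: lt_le_trans rr0.
- by move=> y a yr; apply: H1; exact: lt_le_trans rr1.
- by move=> y yr; apply: H3; exact: lt_le_trans rr3.
move=> y yr y0; rewrite sK => Sy.
pose w := y - z.
have w0 : w 0 0 = K * `|z| - z 0 0 by rewrite !mxE y0.
have zc := coord_le_norm z 0; rewrite ler_norml in zc; have /andP[zc1 zc2] := zc.
have Sw : sdot w w <= 2 * (1 + N) * `|z| ^+ 2.
  have := sdotD_le y (- z); rewrite sdotNl sdotNr opprK -/w.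
  have := sdot_le_norm z; rewrite -/N.
  by clear -Sy; lra.
have [|||||||||||c0 c1] := @top_growth eta K em `|z| (w 0 0) (sdot w w) N.
- by rewrite eta0.
- exact: N0.
- by [].
- exact: em0.
- exact: em2.
- exact: emK.
- exact: rho0.
- by rewrite w0; clear -zc1 zc2; lra.
- by rewrite w0; clear -zc1 zc2; lra.
- exact: sdot_ge0.
- exact: Sw.
have w00 : 0 < w 0 0.
  have : 0 < eta * `|z| / 2 by rewrite divr_gt0// mulr_gt0.
  by clear -c0; lra.
have := H2 z w _ (lt_le_trans zr3 rr2) _ w00 c0 c1.
rewrite /w subrKC => /(_ (lt_le_trans yr rr2)).
move: up; rewrite -/w w0; clear; lra.
Qed.

End Differentiability.

(** * A barrier in a cone wider than the light cone *)

Section SteepCone.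
Context {R : realType} {n : nat}.
Local Notation E := 'rV[R]_n.+1.
Implicit Types (a b v w x y z : E) (c r e : R) (O : set E) (u : E -> R).

(** The gradient of the barrier below is lam * e0 plus a multiple of a vector c *
    e0 + s with |s| <= 1, and c > 1 makes the latter timelike: the sum is steeper
    than lam > 1 whatever the multiple is. *)
Lemma steeper_covector (lam c e X a0 Sa : R) : 1 < lam -> 1 < c -> 0 < e -> 0 <= X ->
  a0 = lam + c * X -> Sa <= X ^+ 2 -> 4 * (e * lam ^+ 2) <= lam ^+ 2 - 1 ->
  e * (2 * c ^+ 2 + 1) <= c ^+ 2 - 1 ->
  - (a0 * a0) + Sa + e * (a0 * a0 + Sa) < -1.
Proof.
move=> lam1 c1 e0 X0 -> SX e1 e2.
have lX : 0 <= lam * (c * X) by rewrite !mulr_ge0//; lra.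
have X2 : 0 <= X ^+ 2 by exact: sqr_ge0.
have H1 : (lam + c * X) * (lam + c * X) <= 2 * (lam ^+ 2 + c ^+ 2 * X ^+ 2).
  by have := sqr_ge0 (lam - c * X); lra.
have H2 : e * ((lam + c * X) * (lam + c * X) + Sa) <=
    e * (2 * (lam ^+ 2 + c ^+ 2 * X ^+ 2) + X ^+ 2).
  by rewrite ler_pM2l//; lra.
have H3 : e * (2 * c ^+ 2 + 1) * X ^+ 2 <= (c ^+ 2 - 1) * X ^+ 2 by rewrite ler_wpM2r.
have H4 : 1 < lam ^+ 2 by rewrite expr2; have := mulr_gt0 (_ : 0 < lam - 1) (_ : 0 < lam - 1); nra.
by clear -H1 H2 H3 H4 lX e1 SX; lra.
Qed.

Lemma is_derive_inv (x : R) : x != 0 -> is_derive x 1 (fun y : R => y^-1) (- x ^- 2).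
Proof.
move=> x0.
have D0 : is_derive x 1 (fun s : R => s) 1 by exact: is_derive_id.
have -> : - x ^- 2 = - x ^- 2 *: 1 by rewrite [RHS]mulr1.
by split; [exact: derivableV|rewrite deriveV// derive_val].
Qed.

(** The barrier l * y00 - mu / rho, where rho vanishes on the boundary of the cone
    of aperture c > 1 with vertex -t * e0, tends to minus infinity on that
    boundary. It lies below u on the top slice y00 = s, hence touches u from below
    inside the cone, and there its covector is too steep. *)
Lemma cone_barrier_false (Q : E -> E -> R) u (c d e l M r s t : R) : 1 < l -> 1 < c -> 0 < d ->
  0 < e -> 4 * (e * l ^+ 2) <= l ^+ 2 - 1 -> e * (2 * c ^+ 2 + 1) <= c ^+ 2 - 1 ->
  0 < s -> 0 < t <= s -> c * (s + t) <= 2 * s -> 2 * s < r -> 0 <= M ->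
  (forall y, `|y| < r -> {for y, continuous u}) ->
  (forall y a, `|y| < r -> touched_below u y a -> -1 <= Q y a) ->
  (forall y a, `|y| < r -> `|Q y a - mink a a| <= e * dot a a) ->
  (forall y, `|y| < r -> u 0 - M <= u y) ->
  (forall y, y 0 0 = s -> sdot y y <= (c * (s + t)) ^+ 2 -> u 0 + (l + d) * s <= u y) ->
  False.
Proof.
move=> l1 c1 d0 e0 e1 e2 s0 /andP[t0 ts] st sr M0 cu Qu Qm ulow uslice.
have c0 : 0 < c by clear -c1; lra.
have l0 : 0 < l by clear -l1; lra.
have ct0 : 0 < c ^+ 2 * t ^+ 2 by rewrite mulr_gt0 ?exprn_gt0.
(* With this mu the barrier starts at u 0 - d * s / 2 at the origin, and where rho
   = del it is lower than u 0 - M. *)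
pose mu := c ^+ 2 * t ^+ 2 * (d * s / 2).
have ds0 : 0 < d * s by exact: mulr_gt0.
have ls0 : 0 < l * s by exact: mulr_gt0.
have mu0 : 0 < mu by rewrite mulr_gt0// divr_gt0.
have muE : mu / (c ^+ 2 * t ^+ 2) = d * s / 2.
  by rewrite /mu mulrAC divff ?mul1r// gt_eqF.
pose D := M + l * s + d * s.
have D0 : 0 < D by rewrite /D; clear -M0 ls0 ds0; lra.
have Dd : d * s / 2 < D by rewrite /D; clear -M0 ls0 ds0; lra.
pose del := mu / D.
have del0 : 0 < del by rewrite divr_gt0.
have delE : mu / del = D by rewrite /del invf_div mulrC mulfVK ?gt_eqF.
have del_ct : del < c ^+ 2 * t ^+ 2 by rewrite /del ltr_pdivrMr// /mu ltr_pM2l.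
clearbody mu del.
pose rho y : R := c ^+ 2 * (y 0 0 + t) ^+ 2 - sdot y y.
pose drho y : E := (2 * c ^+ 2 * (y 0 0 + t)) *: delta_mx 0 0 - 2 *: spatial y.
have C1rho A : C1_gradient A rho drho.
  have F0 := C1_gradientD (C1_gradient_dot A (delta_mx 0 0)) (C1_gradient_cst A t).
  have F1 := C1_gradientM (C1_gradient_cst A (c ^+ 2)) (C1_gradientM F0 F0).
  apply: C1_gradient_eq (C1_gradientD F1 (C1_gradientN (C1_gradient_sdot A))) _ _.
  - by move=> y; rewrite dot_e0 /rho; ring.
  - by move=> y; rewrite dot_e0 /drho; apply/rowP => i; rewrite !mxE; ring.
have crho : continuous rho by move=> y; exact: (C1_gradient_continuous (C1rho setT)).
pose C := [set y : E | - t <= y 0 0] `&` [set y | y 0 0 <= s] `&` [set y | del <= rho y].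
pose O := [set y : E | - t < y 0 0] `&` [set y | y 0 0 < s] `&` [set y | del < rho y].
have OC : O `<=` C by move=> y [[/= A1 A2] A3]; split; [split|]; exact: ltW.
have Cs y : C y -> `|y| <= 2 * s /\ sdot y y <= (c * (y 0 0 + t)) ^+ 2.
  move=> [[/= A1 A2] A3]; have S2 : sdot y y <= (c * (y 0 0 + t)) ^+ 2.
    by rewrite exprMn; move: A3; rewrite /rho; clear -del0; lra.
  have yt0 : 0 <= c * (y 0 0 + t) by rewrite mulr_ge0 ?(ltW c0)//; clear -A1; lra.
  have yt1 : c * (y 0 0 + t) <= 2 * s.
    by apply: le_trans st; rewrite ler_pM2l//; clear -A2; lra.
  have s20 : 0 <= 2 * s by clear -s0; lra.
  split => //; apply: norm_le_sdot => //.
  - by rewrite ler_norml; apply/andP; split; clear -A1 A2 ts s0; lra.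
  - by apply: le_trans S2 _; rewrite ler_pXn2r// nnegrE.
have Cr y : C y -> `|y| < r by move=> /Cs[ys _]; exact: le_lt_trans sr.
have cC : compact C.
  apply: (@compact_norm_bounded _ _ _ r); last by move=> y /Cr/ltW.
  apply: closedI; last exact: closed_ge_fun crho.
  by apply: closedI; [apply: closed_ge_fun|apply: closed_le_fun]; exact: coord0_continuous.
have oO : open O.
  apply: openI; last exact: open_gt_fun crho.
  by apply: openI; [apply: open_gt_fun|apply: open_lt_fun]; exact: coord0_continuous.
have sdot0 : sdot (0 : E) 0 = 0 by rewrite /sdot big1// => i _; rewrite mxE mul0r.
have rho0 : rho 0 = c ^+ 2 * t ^+ 2 by rewrite /rho sdot0 mxE add0r subr0.
have C0 : C 0.
  by split; [split|] => /=; rewrite ?rho0 ?mxE ?oppr_le0 ?(ltW s0) ?(ltW t0) ?(ltW del_ct).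
pose f y := l * y 0 0 - mu * (rho y)^-1.
pose df y : E := l *: delta_mx 0 0 + (mu * (rho y) ^- 2) *: drho y.
have C1f : C1_gradient C f df.
  have F0 : C1_gradient C (fun y => (rho y)^-1) (fun y => - (rho y) ^- 2 *: drho y).
    have F := @C1_gradient_comp _ _ C rho drho (fun x : R => x^-1) (fun x : R => - x ^- 2) (C1rho C).
    apply: F => y [_ /= A3]; have ry : rho y != 0 by rewrite gt_eqF// (lt_le_trans del0).
    split; first exact: is_derive_inv.
    apply: continuousN.
    have -> : (fun x : R => x ^- 2) = (fun x : R => x^-1 * x^-1).
      by apply/funext => x; rewrite expr2 invfM.
    by apply: continuousM; apply: continuousV => //; exact: cvg_id.
  have F1 := C1_gradientM (C1_gradient_cst C (- mu)) F0.
  apply: C1_gradient_eq (C1_gradientD (C1_gradient_dot C (l *: delta_mx 0 0)) F1) _ _.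
  - by move=> y; rewrite /f dotZl dot_e0; ring.
  - by move=> y; rewrite scaler0 addr0 scalerA mulrNN.
have cuC y : C y -> {for y, continuous u} by move=> /Cr yr; exact: cu.
have cfC y : C y -> {for y, continuous f} by exact: C1_gradient_continuous C1f.
have f0 : f 0 = - (d * s / 2) by rewrite /f rho0 mxE mulr0 muE sub0r.
have [|y Oy uy] := min_touch (u := u) cC oO OC C0 cuC cfC (C1_gradient_sub C1f OC).
  move=> y Cy nOy; have yr := Cr y Cy; have [ys ySc] := Cs y Cy.
  have [[/= A1 A2] A3] := Cy.
  have rho_gt0 : 0 < rho y by exact: lt_le_trans A3.
  have ls : l * y 0 0 <= l * s by rewrite ler_pM2l.
  have [rd|dr] := ltP del (rho y); last first.
    have re : rho y = del by apply/eqP; rewrite eq_le dr A3.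
    have := ulow y yr.
    by rewrite f0 /f re delE /D; clear -ls ds0; lra.
  have [ty|yt] := ltP (- t) (y 0 0); last first.
    have ye : y 0 0 = - t by apply/eqP; rewrite eq_le yt A1.
    have := sdot_ge0 y; move: rho_gt0; rewrite /rho ye addNr expr0n mulr0.
    by clear; lra.
  have [yt|sy] := ltP (y 0 0) s; first by case: nOy.
  have ye : y 0 0 = s by apply/eqP; rewrite eq_le sy A2.
  rewrite ye in ySc; have := uslice y ye ySc.
  have : 0 < mu * (rho y)^-1 by rewrite divr_gt0.
  by rewrite f0 /f ye; clear -ds0; lra.
have [[/= A1 A2] A3] := Oy; have Cy := OC y Oy.
have yr := Cr y Cy; have [_ ySc] := Cs y Cy.
have rho_gt0 : 0 < rho y by exact: lt_trans A3.
pose k := 2 * mu * rho y ^- 2.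
have k0 : 0 < k by rewrite divr_gt0 ?exprn_gt0// mulr_gt0.
have dfE : df y = (l + c * (k * (c * (y 0 0 + t)))) *: delta_mx 0 0 - k *: spatial y.
  apply/rowP => i; rewrite /df /drho /k !mxE; ring.
clearbody k.
pose X := k * (c * (y 0 0 + t)); rewrite -/X in dfE.
have a0 : df y 0 0 = l + c * X by rewrite dfE !mxE/=; ring.
have Sa : sdot (df y) (df y) <= X ^+ 2.
  have -> : sdot (df y) (df y) = k ^+ 2 * sdot y y.
    rewrite dfE !sdotE !(sdotC _ (delta_mx _ _)) !sdot_e0 !sdot_spatial.
    by rewrite (sdotC y (spatial y)) sdot_spatial; ring.
  by rewrite /X exprMn ler_wpM2l// sqr_ge0.
have X0 : 0 <= X by rewrite mulr_ge0 ?(ltW k0)// mulr_ge0 ?(ltW c0)//; clear -A1; lra.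
have := steeper_covector l1 c1 e0 X0 a0 Sa e1 e2.
have := Qm y (df y) yr; rewrite ler_norml => /andP[_ ].
have := Qu y (df y) yr uy.
by rewrite /mink /dot; clear; lra.
Qed.

(** Growth on the cone of aperture 1 - nu is carried by the Lipschitz bound to the
    cone of aperture (1 + nu)^2, at the same height, at the cost of a small
    multiple of the height. *)
Lemma lipschitz_slice u (nu s lam L r : R) : 0 < nu <= 4^-1 -> 0 < s -> 2 * s < r -> 0 <= L ->
  (forall y z, `|y| < r -> `|z| < r -> `|u y - u z| <= L * `|y - z|) ->
  (forall z, `|z| < r -> 0 <= z 0 0 -> sdot z z <= ((1 - nu) * z 0 0) ^+ 2 ->
     u 0 + lam * z 0 0 <= u z) ->
  forall y, y 0 0 = s -> sdot y y <= ((1 + nu) ^+ 2 * s) ^+ 2 ->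
    u 0 + lam * s - L * (4 * nu) * s <= u y.
Proof.
move=> /andP[nu0 nu4] s0 sr L0 uL Hcone y y0 Sy.
pose c := (1 + nu) ^+ 2.
have nu2 : nu * nu <= nu * 4^-1 by rewrite ler_wpM2l// ltW.
have nu20 : 0 < nu * nu by exact: mulr_gt0.
have cE : c = 1 + 2 * nu + nu * nu by rewrite /c; ring.
have c1 : 1 < c by rewrite cE; clear -nu0 nu20; lra.
have c2 : c <= 2 by rewrite cE; clear -nu4 nu2; lra.
have c0 : c != 0 by rewrite gt_eqF// (lt_trans ltr01).
rewrite -/c in Sy; have {}cE : c - (1 - nu) <= 4 * nu by rewrite cE; clear -nu0 nu4 nu2; lra.
clearbody c.
have cs0 : 0 <= c * s by rewrite mulr_ge0 ?(ltW s0)//; clear -c1; lra.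
have s20 : 0 <= 2 * s by clear -s0; lra.
have cs2 : c * s <= 2 * s by rewrite ler_pM2r.
have yr : `|y| < r.
  apply: le_lt_trans sr; apply: norm_le_sdot => //.
    by rewrite y0 ger0_norm ?(ltW s0)//; clear -s0; lra.
  by apply: le_trans Sy _; rewrite ler_pXn2r// nnegrE.
pose th := (1 - nu) / c.
have thc : th * c = 1 - nu by rewrite /th divfK.
have th1 : 0 <= 1 - th.
  rewrite subr_ge0 /th ler_pdivrMr; last by clear -c1; lra.
  by clear -nu0 c1; lra.
clearbody th.
pose z : E := s *: delta_mx 0 0 + th *: spatial y.
have z0 : z 0 0 = s by rewrite !mxE/=; ring.
have Sz : sdot z z = th ^+ 2 * sdot y y.
  rewrite /z !sdotE !(sdotC _ (delta_mx _ _)) !sdot_e0 !sdot_spatial.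
  by rewrite (sdotC y (spatial y)) sdot_spatial; ring.
have Sz2 : sdot z z <= ((1 - nu) * s) ^+ 2.
  by rewrite -thc -mulrA exprMn Sz ler_wpM2l// sqr_ge0.
have nus0 : 0 <= (1 - nu) * s by apply: mulr_ge0 (ltW s0); clear -nu4; lra.
have nus1 : (1 - nu) * s <= s by apply: ler_piMl (ltW s0) _; clear -nu0; lra.
have zr : `|z| < r.
  apply: le_lt_trans sr; apply: norm_le_sdot => //.
    by rewrite z0 ger0_norm ?(ltW s0)//; clear -s0; lra.
  apply: le_trans Sz2 _; rewrite ler_pXn2r ?nnegrE//.
  by clear -nus1 s0; lra.
have yz : `|y - z| <= 4 * nu * s.
  have -> : y - z = (1 - th) *: spatial y.
    by apply/rowP => i; rewrite !mxE eqxx; case: (eqVneq i 0) => [->|_] /=; rewrite ?y0; ring.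
  rewrite normrZ ger0_norm//.
  have : `|spatial y| <= c * s.
    apply: norm_le_sdot => //.
    - by rewrite spatial0 normr0.
    - by rewrite sdot_spatial sdotC sdot_spatial.
  move=> /(ler_wpM2l th1)/le_trans; apply.
  have -> : (1 - th) * (c * s) = (c - (1 - nu)) * s by rewrite -thc; ring.
  by rewrite ler_pM2r.
have := Hcone z zr; rewrite z0 => /(_ (ltW s0) Sz2) uz.
have := uL y z yr zr; rewrite ler_norml => /andP[uyz _].
have : L * `|y - z| <= L * (4 * nu * s) by rewrite ler_wpM2l.
by move: uz uyz; clear; lra.
Qed.

(** The Lipschitz bound is what makes the light cone harmless: it passes from
    cones narrower than the light cone, where the growth is known, to a wider one,
    where the barrier lives. *)
Lemma steep_on_cone_false (Q : E -> E -> R) u lam L r0 : near_minkowski Q -> 0 < r0 ->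
  1 < lam -> 0 <= L ->
  (forall y z, `|y| < r0 -> `|z| < r0 -> `|u y - u z| <= L * `|y - z|) ->
  (forall y, `|y| < r0 -> {for y, continuous u}) ->
  (forall y a, `|y| < r0 -> touched_below u y a -> -1 <= Q y a) ->
  (forall c, 0 < c < 1 -> exists2 r, 0 < r & forall z, `|z| < r -> 0 <= z 0 0 ->
     sdot z z <= (c * z 0 0) ^+ 2 -> u 0 + lam * z 0 0 <= u z) -> False.
Proof.
move=> HQ r00 lam1 L0 uL cu Qu Hcone.
(* The excess 3 * d of the slope is shared between the slope l of the barrier, the
   loss of the Lipschitz bound and the margin on the top slice. *)
pose d := (lam - 1) / 3.
have d0 : 0 < d by rewrite /d; clear -lam1; lra.
have lamE : lam = 1 + 3 * d by rewrite /d; field.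
clearbody d.
pose l := 1 + d.
have l1 : 1 < l by rewrite /l; clear -d0; lra.
have l2 : 1 < l ^+ 2 by rewrite exprn_egt1.
pose nu := Num.min 4^-1 (d / (4 * (L + 1))).
have L1 : 0 < 4 * (L + 1) by clear -L0; lra.
have nu0 : 0 < nu by rewrite lt_min invr_gt0 ltr0n/= divr_gt0.
have nu4 : nu <= 4^-1 by rewrite ge_min lexx.
have nuL : L * (4 * nu) <= d.
  have : nu <= d / (4 * (L + 1)) by rewrite ge_min lexx orbT.
  by rewrite ler_pdivlMr//; clear -nu0; lra.
clearbody nu.
pose c := 1 + nu.
have c1 : 1 < c by rewrite /c; clear -nu0; lra.
have c2 : 1 < c ^+ 2 by rewrite exprn_egt1.
have cc : c ^+ 2 <= 2.
  rewrite /c; have : nu * nu <= nu * 4^-1 by rewrite ler_wpM2l// ltW.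
  by clear -nu4 nu0; lra.
pose e := Num.min ((l ^+ 2 - 1) / (4 * l ^+ 2)) ((c ^+ 2 - 1) / (2 * c ^+ 2 + 1)).
have l40 : 0 < 4 * l ^+ 2 by clear -l2; lra.
have c40 : 0 < 2 * c ^+ 2 + 1 by clear -c2; lra.
have e0 : 0 < e by rewrite lt_min; apply/andP; split; apply: divr_gt0; rewrite // subr_gt0.
have e1 : 4 * (e * l ^+ 2) <= l ^+ 2 - 1.
  have : e <= (l ^+ 2 - 1) / (4 * l ^+ 2) by rewrite ge_min lexx.
  by rewrite ler_pdivlMr//; clear; lra.
have e2 : e * (2 * c ^+ 2 + 1) <= c ^+ 2 - 1.
  have : e <= (c ^+ 2 - 1) / (2 * c ^+ 2 + 1) by rewrite ge_min lexx orbT.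
  by rewrite ler_pdivlMr//; clear; lra.
clearbody e.
have nu1 : 0 < 1 - nu < 1 by apply/andP; split; clear -nu0 nu4; lra.
have [r1 r10 H1] := HQ e e0.
have [r2 r20 H2] := Hcone _ nu1.
pose r := Num.min r0 (Num.min r1 r2).
have r_gt0 : 0 < r by rewrite !lt_min r00 r10 r20.
have [rr0 [rr1 rr2]] : r <= r0 /\ r <= r1 /\ r <= r2.
  by rewrite /r !ge_min !lexx !orbT.
clearbody r.
pose s := r / 4.
have s0 : 0 < s by rewrite divr_gt0.
have sr : 2 * s < r by rewrite /s; clear -r_gt0; lra.
clearbody s.
pose t := nu * s.
have t0 : 0 < t by exact: mulr_gt0.
have ts : t <= s by rewrite /t ler_piMl ?(ltW s0)//; clear -nu4; lra.
have cst : c * (s + t) = c ^+ 2 * s by rewrite /c /t; ring.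
have nr0 y : `|y| < r -> `|y| < r0 by move=> yr; exact: lt_le_trans rr0.
have uLr y z : `|y| < r -> `|z| < r -> `|u y - u z| <= L * `|y - z|.
  by move=> /nr0 yr /nr0 zr; exact: uL.
apply: (@cone_barrier_false Q u c d e l (L * r) r s t) => //.
- by rewrite t0 ts.
- by rewrite cst ler_pM2r.
- by rewrite mulr_ge0// ltW.
- by move=> y /nr0; exact: cu.
- by move=> y a /nr0; exact: Qu.
- by move=> y a yr; apply: H1; exact: lt_le_trans rr1.
- move=> y yr; have zr : `|0 : E| < r by rewrite normr0.
  have := uLr y 0 yr zr; rewrite subr0 ler_norml => /andP[A1 _].
  have : L * `|y| <= L * r by rewrite ler_wpM2l// ltW.
  by move: A1; clear; lra.
- move=> y y0; rewrite cst => Sy.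
  have nu04 : 0 < nu <= 4^-1 by rewrite nu0.
  have := lipschitz_slice nu04 s0 sr L0 uLr _ y0 Sy.
  move=> /(_ lam)H; have {}H : u 0 + lam * s - L * (4 * nu) * s <= u y.
    by apply: H => z zr; apply: H2; exact: lt_le_trans rr2.
  have : L * (4 * nu) * s <= d * s by rewrite ler_pM2r.
  by move: H; rewrite lamE /l; clear; lra.
Qed.

End SteepCone.

(** * Density of the points with a subgradient *)

Section Density.
Context {R : realType} {n : nat}.
Local Notation E := 'rV[R]_n.+1.
Implicit Types (a b v w x y z : E) (c r e : R) (O : set E) (u : E -> R).

Lemma C1_gradient_quadratic O a k :
  C1_gradient O (fun y => dot a y + k * dot y y) (fun y => a + k *: (2 *: y)).
Proof.
have F0 := C1_gradient_dot O (delta_mx 0 0).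
have F1 := C1_gradientM (C1_gradient_cst O k) (C1_gradientM F0 F0).
apply: C1_gradient_eq (C1_gradientD F1 (@C1_gradient_parabola _ _ O a k)) _ _.
- by move=> y; rewrite dot_e0 {3}/dot; ring.
- move=> y; rewrite dot_e0; apply/rowP => i; rewrite !mxE eqxx; case: (eqVneq i 0) => [->|_] /=; ring.
Qed.

Lemma norm_sq_le_dot y : `|y| ^+ 2 <= dot y y.
Proof.
have S0 := sdot_ge0 y.
have D0 : 0 <= dot y y by rewrite /dot addr_ge0// -expr2 sqr_ge0.
rewrite -[leRHS]sqr_sqrtr// ler_pXn2r ?nnegrE ?sqrtr_ge0//.
apply: norm_le_sdot; rewrite ?sqrtr_ge0 ?sqr_sqrtr//.
- by rewrite -sqrtr_sqr ler_sqrt// /dot -expr2 lerDl.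
- by rewrite /dot lerDr -expr2 sqr_ge0.
Qed.

(** A concave parabola of which the graph is raised until it touches u; k controls
    how far from 0 this happens. *)
Lemma quadratic_touch u a k r : 0 < r ->
  (forall y, `|y| <= r -> {for y, continuous u}) ->
  (forall y, `|y| = r -> u 0 < u y - (dot a y - k * r ^+ 2)) -> 0 <= k ->
  exists2 z, `|z| < r & touched_below u z (a - (2 * k) *: z).
Proof.
move=> r0 cu H k0.
pose C := [set y : E | `|y| <= r]; pose O := [set y : E | `|y| < r].
have cN : continuous (fun y : E => `|y|) by move=> y; exact: norm_continuous.
have OC : O `<=` C by move=> y; exact: ltW.
have cC : compact C by apply: (@compact_norm_bounded _ _ _ r) => //; exact: closed_le_fun cN.
have oO : open O by exact: open_lt_fun cN.
have C0 : C 0 by rewrite /C /= normr0 ltW.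
have cf y : C y -> {for y, continuous (fun y => dot a y + - k * dot y y)}.
  exact: C1_gradient_continuous (@C1_gradient_quadratic C a (- k)).
have [|y Oy uy] := min_touch (u := u) cC oO OC C0 cu cf (@C1_gradient_quadratic O a (- k)).
- move=> y Cy nOy.
  have yr : `|y| = r.
    by apply/eqP; rewrite eq_le Cy /= leNgt; apply/negP.
  have := H y yr; have := norm_sq_le_dot y; rewrite yr.
  move=> /(ler_wpM2l k0).
  by rewrite !(dotC _ 0) !dot0l; lra.
- exists y => //; move: uy; congr touched_below.
  by apply/rowP => i; rewrite !mxE; ring.
Qed.

(** A parabola steep enough to exceed the oscillation of u on a ball touches u
    inside the ball. *)
Lemma exists_touched_below u r : 0 < r -> (forall y, `|y| < r -> {for y, continuous u}) ->
  exists z a, `|z| < r /\ touched_below u z a.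
Proof.
move=> r0 cu; pose s := r / 2.
have s0 : 0 < s by rewrite divr_gt0.
have sr : s < r by rewrite /s; lra.
pose C := [set y : E | `|y| <= s].
have cN : continuous (fun y : E => `|y|) by move=> y; exact: norm_continuous.
have cC : compact C by apply: (@compact_norm_bounded _ _ _ s) => //; exact: closed_le_fun cN.
have cu' y : `|y| <= s -> {for y, continuous u}.
  by move=> ys; apply: cu; exact: le_lt_trans sr.
have C0 : C !=set0 by exists 0; rewrite /C /= normr0 ltW.
have [|m Cm um] := @EVT_min_rV _ _ u C C0 cC.
  by apply: continuous_in_subspaceT => y; rewrite inE; exact: cu'.
have um0 : u m <= u 0 by apply: um; rewrite inE /C /= normr0 ltW.
pose k := (u 0 - u m + 1) / s ^+ 2.
have ks : k * s ^+ 2 = u 0 - u m + 1 by rewrite /k; field; rewrite gt_eqF.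
have k0 : 0 <= k by rewrite divr_ge0 ?sqr_ge0//; lra.
have [|z zs uz] := quadratic_touch (a := 0) s0 cu' _ k0.
  move=> y ys; have : u m <= u y by apply: um; rewrite inE /C /= ys.
  by rewrite dot0l ks; lra.
by exists z, (0 - (2 * k) *: z); split => //; exact: lt_trans sr.
Qed.

Lemma touched_below_gradient u a b : has_gradient u 0 a -> touched_below u 0 b -> b = a.
Proof.
move=> ua [ O [f [df [[oO O0 Cf f0 df0] fu]]]].
have [fb _] := Cf 0 O0; rewrite df0 in fb.
apply/eqP; rewrite -subr_eq0; apply/negPn/negP => ba.
set w := b - a in ba.
have w0 : 0 < `|w| by rewrite normr_gt0.
have q0 : 0 < dot w w by apply: lt_le_trans (norm_sq_le_dot w); rewrite exprn_gt0.
pose e := dot w w / (4 * `|w|).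
have e0 : 0 < e by rewrite divr_gt0// mulr_gt0.
have ew : e * `|w| = dot w w / 4 by rewrite /e; field; rewrite gt_eqF.
have [r1 r10 H1] := gradient_eps ua e0.
have [r2 r20 H2] := gradient_eps fb e0.
have [r3 r30 H3] := near0_eps (open_nbhs_nbhs (conj oO O0)).
pose r := Num.min r1 (Num.min r2 r3).
have r0 : 0 < r by rewrite !lt_min r10 r20 r30.
have [rr1 [rr2 rr3]] : r <= r1 /\ r <= r2 /\ r <= r3 by rewrite /r !ge_min !lexx !orbT.
pose t := r / (2 * `|w|).
have t0 : 0 < t by rewrite divr_gt0// mulr_gt0.
have tn : `|t *: w| = t * `|w| by rewrite normrZ gtr0_norm.
have tw : `|t *: w| < r.
  have -> : `|t *: w| = r / 2 by rewrite tn /t; field; rewrite gt_eqF.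
  lra.
have := H1 _ (lt_le_trans tw rr1); have := H2 _ (lt_le_trans tw rr2).
rewrite !ler_norml !dotZr tn => /andP[A1 _] /andP[_ A2].
have := fu _ (H3 _ (lt_le_trans tw rr3)); rewrite -f0 in A2 * => A3.
have bw : dot b w = dot a w + dot w w by rewrite -dotDl /w subrKC.
have : t * dot w w <= 2 * (t * (e * `|w|)).
  by move: A1 A2 A3; rewrite bw; clear; lra.
by rewrite ew; have := mulr_gt0 t0 q0; clear; lra.
Qed.

(** The parabola is centred off the origin by tilting it by 3 * eta * e1: it
    cannot touch at the origin, where the only subgradient is a. *)
Lemma touched_below_near_gradient u a r : 0 < r ->
  (forall y, `|y| < r -> {for y, continuous u}) -> has_gradient u 0 a ->
  forall e, 0 < e -> exists z b, [/\ z != 0, `|z| < e, touched_below u z b & `|b - a| <= e].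
Proof.
move=> r0 cu ua e e0.
pose eta := e / 20.
have eta0 : 0 < eta by rewrite divr_gt0.
have [r1 r10 H1] := gradient_eps ua eta0.
pose s := Num.min r (Num.min r1 e) / 2.
have s0 : 0 < s by rewrite divr_gt0// !lt_min r0 r10 e0.
have [sr [sr1 se]] : s < r /\ s < r1 /\ s < e.
  have : Num.min r (Num.min r1 e) <= r by rewrite ge_min lexx.
  have : Num.min r (Num.min r1 e) <= r1 by rewrite !ge_min lexx orbT.
  have : Num.min r (Num.min r1 e) <= e by rewrite !ge_min lexx !orbT.
  move: s0; rewrite /s; move: (Num.min _ _) => m; clear; lra.
clearbody s.
(* On the sphere of radius s the parabola drops by 8 * eta * s, more than the tilt
   and the error of the first order expansion of u can compensate. *)
pose k := 8 * eta / s.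
have k0 : 0 <= k by rewrite divr_ge0 ?(ltW s0)// mulr_ge0// ltW.
have ks : k * s = 8 * eta by rewrite /k; field; rewrite gt_eqF.
pose e1 : E := delta_mx 0 0.
have ne1 : `|e1| <= 1.
  apply: norm_le_coord => // i; rewrite mxE /=; case: eqP => _ /=.
  - by rewrite normr1.
  - by rewrite normr0.
have cu' y : `|y| <= s -> {for y, continuous u}.
  by move=> ys; apply: cu; exact: le_lt_trans sr.
have [|z zs uz] := quadratic_touch (a := a + (3 * eta) *: e1) s0 cu' _ k0.
  move=> y ys; have yr1 : `|y| < r1 by rewrite ys.
  have := H1 y yr1; rewrite ler_norml ys => /andP[A1 _].
  rewrite dotDl dotZl dot_e0 expr2 mulrA ks.
  have := coord_le_norm y 0; rewrite ys ler_norml => /andP[_ /(ler_wpM2l (ltW eta0))].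
  by have := mulr_gt0 eta0 s0; move: A1; clear; lra.
exists z, (a + (3 * eta) *: e1 - (2 * k) *: z); split => //; last 1 first.
- have -> : a + (3 * eta) *: e1 - (2 * k) *: z - a = (3 * eta) *: e1 - (2 * k) *: z.
    by apply/rowP => i; rewrite !mxE; ring.
  have e3 : 0 <= 3 * eta by exact: mulr_ge0 (ltW eta0).
  have k2 : 0 <= 2 * k by exact: mulr_ge0.
  apply: le_trans (ler_normB _ _) _; rewrite (normrZ (3 * eta)) (normrZ (2 * k)) (ger0_norm e3) (ger0_norm k2).
  have : 3 * eta * `|e1| <= 3 * eta * 1 by rewrite ler_wpM2l.
  have : k * `|z| <= k * s by rewrite ler_wpM2l// ltW.
  by rewrite ks /eta; clear -e0; lra.
- apply/eqP => z0; rewrite z0 in uz.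
  have := touched_below_gradient ua uz.
  move=> /(congr1 (fun v : E => v 0 0)); rewrite !mxE /=; move: eta0; clear; lra.
- exact: lt_trans se.
Qed.

End Density.

(** * Differentials and limits *)

Section NearEquality.
Context {R : realType} {V W : normedModType R}.

(** Frechet differentiability and the differential only depend on the germ of the
    function. *)
Lemma near_differentiable (f g : V -> W) x : (\forall y \near x, f y = g y) ->
  differentiable f x -> differentiable g x /\ 'd g x = 'd f x :> (V -> W).
Proof.
move=> fg df; have fgx := nbhs_singleton fg.
have [df1 df2] := (diff_locallyP x f).1 df.
have H : g \o shift x = cst (g x) + 'd f x +o_ (0 : V) id.
  apply/eqaddoP => e e0; move/eqaddoP: df2 => /(_ e e0).
  have : \forall h \near (0 : V), f (h + x) = g (h + x).
    by move: fg; rewrite (near_shift 0) /=; apply: filterS => h; rewrite subr0.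
  apply: filterS2 => h e1.
  suff -> : (g \o shift x - (cst (g x) + 'd f x)) h =
    (f \o shift x - (cst (f x) + 'd f x)) h by exact.
  by rewrite -[LHS]/(g (h + x) - (g x + 'd f x h)) -e1 -fgx.
have D : 'd g x = 'd f x :> (V -> W) by exact: diff_unique.
by split; [apply/diff_locallyP; rewrite D|exact: D].
Qed.

End NearEquality.

Lemma near_diff_comp {R : realType} {U V W : normedModType R} (f : U -> V) (g : V -> W) (h : U -> W) x :
  (\forall y \near x, g (f y) = h y) -> differentiable f x -> differentiable g (f x) ->
  differentiable h x /\ forall v, 'd h x v = 'd g (f x) ('d f x v).
Proof.
move=> H df dg; have [D1 D2] := near_differentiable H (differentiable_comp df dg).
split => [//|v]; apply: etrans (congr1 (fun L : U -> W => L v) D2) _.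
exact: (congr1 (fun L : U -> W => L v) (diff_comp df dg)).
Qed.

Lemma diff_comp_at {R : realType} {U V W : normedModType R} (f : U -> V) (g : V -> W) x :
  differentiable f x -> differentiable g (f x) ->
  differentiable (g \o f) x /\ forall v, 'd (g \o f) x v = 'd g (f x) ('d f x v).
Proof. by apply: near_diff_comp; exact: nearW. Qed.

Section MatrixLimits.
Context {R : realType} {T : Type} {F : set_system T} {FF : Filter F}.

Lemma cvg_sumR (I : Type) (r : seq I) (f : I -> T -> R) (l : I -> R) :
  (forall i, f i t @[t --> F] --> l i) ->
  \sum_(i <- r) f i t @[t --> F] --> \sum_(i <- r) l i.
Proof.
move=> H; elim: r => [|i r IH].
  by rewrite big_nil; under eq_cvg do rewrite big_nil; exact: cvg_cst.
by rewrite big_cons; under eq_cvg do rewrite big_cons; exact: cvgD.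
Qed.

Lemma cvg_mx m k (A : T -> 'M[R]_(m, k)) (B : 'M[R]_(m, k)) :
  (forall i j, A t i j @[t --> F] --> B i j) -> A t @[t --> F] --> B.
Proof.
move=> H; apply/cvg_ballP => e e0.
have H' : \forall t \near F, forall i, forall j, ball (B i j) e (A t i j).
  by apply: filter_forall => i; apply: filter_forall => j; move/cvg_ballP: (H i j); exact.
by apply: filterS H' => t Ht; split.
Qed.

Lemma cvg_mx_entry m k (A : T -> 'M[R]_(m, k)) (B : 'M[R]_(m, k)) i j :
  A t @[t --> F] --> B -> A t i j @[t --> F] --> B i j.
Proof.
move=> AB; apply: (cvg_comp _ (fun M : 'M[R]_(m, k) => M i j)); first exact: AB.
exact: coord_continuous.
Qed.

Lemma cvg_mulmx m k l (A : T -> 'M[R]_(m, k)) (A' : T -> 'M[R]_(k, l))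
    (B : 'M[R]_(m, k)) (B' : 'M[R]_(k, l)) :
  A t @[t --> F] --> B -> A' t @[t --> F] --> B' -> A t *m A' t @[t --> F] --> B *m B'.
Proof.
move=> AB AB'; apply: cvg_mx => i j; rewrite mxE; under eq_cvg do rewrite mxE.
by apply: cvg_sumR => s; apply: cvgM; exact: cvg_mx_entry.
Qed.

Lemma cvg_trmx m k (A : T -> 'M[R]_(m, k)) (B : 'M[R]_(m, k)) :
  A t @[t --> F] --> B -> (A t)^T @[t --> F] --> B^T.
Proof.
move=> AB; apply: cvg_mx => i j; rewrite mxE; under eq_cvg do rewrite mxE.
exact: cvg_mx_entry.
Qed.

Lemma cvg_dot n (a b : T -> 'rV[R]_n.+1) (v w : 'rV[R]_n.+1) :
  a t @[t --> F] --> v -> b t @[t --> F] --> w -> dot (a t) (b t) @[t --> F] --> dot v w.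
Proof.
move=> av bw; rewrite dotE; under eq_cvg do rewrite dotE.
by apply: cvg_mx_entry; apply: cvg_mulmx => //; exact: cvg_trmx.
Qed.

End MatrixLimits.

Section Rows.
Context {R : realType} {n : nat}.
Local Notation E := 'rV[R]_n.+1.
Implicit Types (f g : E -> E) (x y v w : E).

Lemma row_expand v : v = \sum_i v 0 i *: (delta_mx 0 i : E).
Proof. by rewrite {1}[v]row_sum_delta. Qed.

Lemma linear_expand (U : lmodType R) (L : {linear E -> U}) v :
  L v = \sum_i v 0 i *: L (delta_mx 0 i).
Proof. by rewrite {1}(row_expand v) linear_sum; apply: eq_bigr => i _; rewrite linearZ. Qed.

Lemma differentiable_row f x : (forall j, differentiable (fun y => f y 0 j) x) ->
  differentiable f x.
Proof.
move=> H.
have -> : f = \sum_j (fun y => f y 0 j *: (delta_mx 0 j : E)).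
  by apply/funext => y; rewrite fct_sumE -row_expand.
by apply: differentiable_sum => j; exact: differentiableZl.
Qed.

Lemma diff_coord f x v j : differentiable f x ->
  'd (fun y => f y 0 j) x v = 'd f x v 0 j.
Proof.
move=> df.
have -> : (fun y => f y 0 j) = dot (delta_mx 0 j) \o f.
  by apply/funext => y /=; rewrite dotC dot_delta.
have [dd dE] : has_gradient (dot (delta_mx 0 j) : E -> R) (f x) (delta_mx 0 j).
  exact: (C1_gradient_dot setT (delta_mx 0 j) (f x) I).1.
by rewrite diff_comp// /= dE dotC dot_delta.
Qed.

End Rows.

Section Inverse.
Context {R : realType} {n : nat}.
Local Notation MT := 'M[R]_n.+1.

Lemma norm_mulmx (A B : MT) : `|A *m B| <= n.+1%:R * `|A| * `|B|.
Proof.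
rewrite [leLHS]mx_normrE; apply: bigmax_le => [|[i j] _ /=]; first by rewrite !mulr_ge0.
rewrite mxE (le_trans (ler_norm_sum _ _ _))//.
rewrite -[X in X%:R]card_ord -sumr_const !mulr_suml ler_sum// => k _.
rewrite mul1r normrM ler_pM//.
- by rewrite [leRHS]mx_normrE; exact: (le_bigmax _ (fun p : 'I_n.+1 * 'I_n.+1 => `|A p.1 p.2|) (i, k)).
- by rewrite [leRHS]mx_normrE; exact: (le_bigmax _ (fun p : 'I_n.+1 * 'I_n.+1 => `|B p.1 p.2|) (k, j)).
Qed.

(** The resolvent identity D^-1 - K = K (G - D) D^-1, for K = G^-1, first bounds
    the norm of K and then its distance to D^-1. *)
Lemma cvg_invmx (T : Type) (F : set_system T) (FF : Filter F) (G : T -> MT) (D : MT) :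
  D \in unitmx -> (\forall t \near F, G t \in unitmx) ->
  G t @[t --> F] --> D -> invmx (G t) @[t --> F] --> invmx D.
Proof.
move=> Du Gu GD; pose N : R := n.+1%:R.
have N0 : 0 < N by rewrite ltr0n.
pose d := `|invmx D|.
have d0 : 0 <= d by exact: normr_ge0.
apply/cvgrPdist_le => e e0.
pose a := Num.min (1 / (2 * (N * N * (d + 1)))) (e / (2 * (N * N * (d + 1) * (d + 1)))).
have dd : 0 < N * N * (d + 1) by rewrite !mulr_gt0//; lra.
have ddd : 0 < N * N * (d + 1) * (d + 1) by rewrite mulr_gt0//; lra.
have d2 : 0 < 2 * (N * N * (d + 1)) by clear -dd; lra.
have d3 : 0 < 2 * (N * N * (d + 1) * (d + 1)) by clear -ddd; lra.
have a0 : 0 < a by rewrite lt_min; apply/andP; split; exact: divr_gt0.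
have a1 : a * (N * N * (d + 1)) <= 1 / 2.
  have : a <= 1 / (2 * (N * N * (d + 1))) by rewrite ge_min lexx.
  by rewrite ler_pdivlMr//; clear; lra.
have a2 : 2 * (a * (N * N * (d + 1) * (d + 1))) <= e.
  have : a <= e / (2 * (N * N * (d + 1) * (d + 1))) by rewrite ge_min lexx orbT.
  by rewrite ler_pdivlMr//; clear; lra.
move/cvgrPdist_le: GD => /(_ a a0) GD.
apply: filterS2 Gu GD => t Gu GD.
set K := invmx (G t).
have KE : invmx D - K = K *m ((G t - D) *m invmx D).
  rewrite mulmxBl mulmxBr mulmxV// mulmx1 mulmxA mulVmx// mul1mx.
  by [].
have Gd : `|(G t - D) *m invmx D| <= N * a * d.
  apply: le_trans (norm_mulmx _ _) _; rewrite ler_wpM2r// -/N ler_wpM2l ?(ltW N0)//.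
  by rewrite distrC.
have H1 : `|invmx D - K| <= N * `|K| * (N * a * d).
  rewrite KE; apply: le_trans (norm_mulmx _ _) _; exact: ler_wpM2l.
have k0 : 0 <= `|K| by exact: normr_ge0.
have H2 : `|K| <= d + `|invmx D - K|.
  by rewrite -{1}[K](subKr (invmx D)) (le_trans (ler_normB _ _)).
clearbody K; move: H1 H2; move: `|invmx D - K| `|K| k0 => x k k0.
have -> : N * k * (N * a * d) = k * (a * (N * N) * d) by ring.
move=> H1 H2.
have A0 : 0 <= a * (N * N) by rewrite mulr_ge0 ?(ltW a0)// mulr_ge0.
have H3 : k * (a * (N * N) * d) <= k * (1 / 2).
  by rewrite ler_wpM2l//; move: a1 A0; clear; lra.
have k2 : k <= 2 * d by move: H1 H2 H3; clear; lra.
have H4 : k * (a * (N * N) * d) <= 2 * d * (a * (N * N) * d).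
  by rewrite ler_wpM2r// mulr_ge0.
have A1 : 0 <= a * (N * N) * d by rewrite mulr_ge0.
by move: H1 H4 a2 A0 A1; clear; lra.
Qed.

End Inverse.

(** * Charts and transition maps *)

Section ChartTopology.
Context {R : realType} {n : nat} {X : topologicalType} (c : chart R n X).
Local Notation E := 'rV[R]_n.+1.
Local Notation img := (cmap c @` dom c).

Lemma chart_image p : dom c p -> img (cmap c p).
Proof. by move=> cp; exists p. Qed.

Lemma cinv_dom x : img x -> dom c (cinv c x).
Proof. by move=> [p cp <-]; rewrite cmapK. Qed.

Lemma cinvK x : img x -> cmap c (cinv c x) = x.
Proof. by move=> [p cp <-]; rewrite cmapK. Qed.

Lemma cinv_cvg x : img x -> {for x, continuous (cinv c)}.
Proof.
move=> ix; have := cinv_continuous (c := c).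
by rewrite (continuous_open_subspace _ (@img_open _ _ _ c)) => H; apply: H; rewrite inE.
Qed.

Lemma cmap_cvg p : dom c p -> {for p, continuous (cmap c)}.
Proof.
move=> cp; have := cmap_continuous (c := c).
by rewrite (continuous_open_subspace _ (@dom_open _ _ _ c)) => H; apply: H; rewrite inE.
Qed.

Lemma near_chart_image x (O : set X) : img x -> open O -> O (cinv c x) ->
  \forall y \near x, img y /\ O (cinv c y).
Proof.
move=> ix oO Ox; apply: filterI; first exact: open_nbhs_nbhs (conj (@img_open _ _ _ c) ix).
by apply: (cinv_cvg ix); exact: open_nbhs_nbhs.
Qed.

End ChartTopology.

Section Transition.
Context {R : realType} {n : nat} (M : manifold R n).
Local Notation E := 'rV[R]_n.+1.
Implicit Types (p q m : M) (x y v w : E).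

(** Transition maps; [tcoord] and [tvec] are their differentials at the base
    point. *)
Definition trans p q : E -> E := cmap (at_ q) \o cinv (at_ p).

Definition trans_dom p q x := (cmap (at_ p) @` dom (at_ p)) x /\ dom (at_ q) (cinv (at_ p) x).

Lemma trans_domP p q x : trans_dom p q x -> (cmap (at_ p) @` (dom (at_ p) `&` dom (at_ q))) x.
Proof.
move=> [ix qx]; exists (cinv (at_ p) x); last exact: cinvK.
by split => //; exact: cinv_dom.
Qed.

Lemma trans_dom_at p q m : dom (at_ p) m -> dom (at_ q) m -> trans_dom p q (cmap (at_ p) m).
Proof. by move=> pm qm; split; [exact: chart_image|rewrite cmapK]. Qed.

Lemma near_trans_dom p q x : trans_dom p q x -> \forall y \near x, trans_dom p q y.
Proof. by move=> [ix qx]; apply: near_chart_image => //; exact: dom_open. Qed.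

Lemma differentiable_trans p q x : trans_dom p q x -> differentiable (trans p q) x.
Proof.
move=> /trans_domP px; apply: differentiable_row => j.
by have [/(_ _ px)] := at_compatible p q j 1.
Qed.

Lemma trans_continuous p q x : trans_dom p q x -> {for x, continuous (trans p q)}.
Proof. by move=> px; exact/differentiable_continuous/differentiable_trans. Qed.

(** Joint continuity of the differential of a transition map, in the point and in
    the vector, for an arbitrary filter, so that it serves sequences of tangent
    vectors and curves alike. *)
Lemma cvg_dtrans p q x v (T : Type) (F : set_system T) (FF : Filter F) (y : T -> E) (w : T -> E) :
  trans_dom p q x -> y t @[t --> F] --> x -> w t @[t --> F] --> v ->
  'd (trans p q) (y t) (w t) @[t --> F] --> 'd (trans p q) x v.
Proof.
move=> px yx wv; apply: cvg_mx => i j; rewrite ord1 => {i}.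
have E1 z u : trans_dom p q z -> 'd (trans p q) z u 0 j =
    \sum_i u 0 i * 'D_(delta_mx 0 i) (fun x => trans p q x 0 j) z.
  move=> pz; have dz := differentiable_trans pz.
  rewrite linear_expand summxE; apply: eq_bigr => i _; rewrite mxE; congr (_ * _).
  by rewrite deriveE ?diff_coord//; have [/(_ _ (trans_domP pz))] := at_compatible p q j 1.
have near_px : \forall t \near F, trans_dom p q (y t) by apply: yx; exact: near_trans_dom.
have H : \sum_i w t 0 i * 'D_(delta_mx 0 i) (fun x => trans p q x 0 j) (y t) @[t --> F] -->
    \sum_i v 0 i * 'D_(delta_mx 0 i) (fun x => trans p q x 0 j) x.
  apply: cvg_sumR => i; apply: cvgM; first exact: cvg_mx_entry.
  have c0 : {for x, continuous ('D_(delta_mx 0 i) (fun x => trans p q x 0 j))}.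
    by have [_ /(_ i)/(_ _ (trans_domP px))] := at_compatible p q j 1.
  exact: (@cvg_comp _ _ _ y ('D_(delta_mx 0 i) (fun x => trans p q x 0 j)) F (nbhs x) _ yx c0).
apply: (@eq_ind _ _ (fun l : R => 'd (trans p q) (y t) (w t) 0 j @[t --> F] --> l) _ _
  (esym (E1 x v px))).
apply: cvg_trans H; apply: near_eq_cvg.
by apply: filterS near_px => t pt; exact/esym/E1.
Qed.

Lemma dtrans_comp p q m x v : trans_dom p q x -> dom (at_ m) (cinv (at_ p) x) ->
  'd (trans q m) (trans p q x) ('d (trans p q) x v) = 'd (trans p m) x v.
Proof.
move=> px mx; have [ix qx] := px.
have qmx : trans_dom q m (trans p q x) by exact: trans_dom_at.
have d1 := differentiable_trans px; have d2 := differentiable_trans qmx.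
have H : \forall y \near x, trans q m (trans p q y) = trans p m y.
  apply: filterS (near_trans_dom px) => y [iy qy] /=.
  by rewrite /trans /= cmapK.
exact: esym ((near_diff_comp H d1 d2).2 v).
Qed.

Lemma dtrans_id p x v : (cmap (at_ p) @` dom (at_ p)) x -> 'd (trans p p) x v = v.
Proof.
move=> ix.
have H : \forall y \near x, id y = trans p p y.
  apply: filterS (near_chart_image ix openT I) => y [iy _].
  by rewrite /trans /= cinvK.
have [d1 D1] := is_diff_id x.
have [_ D] := near_differentiable H d1.
exact: etrans (congr1 (fun L : E -> E => L v) D) (congr1 (fun L : E -> E => L v) D1).
Qed.

Lemma trans_at p q m : dom (at_ p) m -> trans p q (cmap (at_ p) m) = cmap (at_ q) m.
Proof. by move=> pm; rewrite /trans /= cmapK. Qed.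

Lemma dtrans_at p q m r v : dom (at_ p) r -> dom (at_ q) r -> dom (at_ m) r ->
  'd (trans q m) (cmap (at_ q) r) ('d (trans p q) (cmap (at_ p) r) v) =
  'd (trans p m) (cmap (at_ p) r) v.
Proof.
move=> pr qr mr; have px := trans_dom_at pr qr.
have mr' : dom (at_ m) (cinv (at_ p) (cmap (at_ p) r)) by rewrite cmapK.
by have := dtrans_comp v px mr'; rewrite trans_at.
Qed.

Lemma tvecK p q v : dom (at_ p) q -> tvec (at_ p) q (tcoord (at_ p) q v) = v.
Proof.
move=> pq; have qq := at_dom q.
exact: etrans (dtrans_at v qq pq qq) (dtrans_id v (chart_image qq)).
Qed.

Lemma tcoordK p q v : dom (at_ p) q -> tcoord (at_ p) q (tvec (at_ p) q v) = v.
Proof.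
move=> pq; have qq := at_dom q.
exact: etrans (dtrans_at v pq qq pq) (dtrans_id v (chart_image pq)).
Qed.

Lemma tvec_id p v : tvec (at_ p) p v = v.
Proof. by apply: dtrans_id; exact/chart_image/at_dom. Qed.

Lemma differential_chart p q (f : M -> R) : dom (at_ p) q ->
  differentiable (f \o cinv (at_ p)) (cmap (at_ p) q) ->
  differentiable_at f q /\
  forall v, differential f q v = 'd (f \o cinv (at_ p)) (cmap (at_ p) q) (tcoord (at_ p) q v).
Proof.
move=> pq df.
have qp : trans_dom q p (cmap (at_ q) q) by apply: trans_dom_at => //; exact: at_dom.
have d1 := differentiable_trans qp.
have tq : trans q p (cmap (at_ q) q) = cmap (at_ p) q.
  by rewrite /trans /= cmapK//; exact: at_dom.
have d2 : differentiable (f \o cinv (at_ p)) (trans q p (cmap (at_ q) q)) by rewrite tq.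
have H : \forall y \near cmap (at_ q) q,
    (f \o cinv (at_ p)) (trans q p y) = (f \o cinv (at_ q)) y.
  apply: filterS (near_trans_dom qp) => y [iy py].
  by rewrite /trans /= cmapK.
have [D1 D2] := near_diff_comp H d1 d2.
split; first exact: D1.
move=> v; apply: etrans (D2 v) _.
exact: (congr1 (fun z : E => 'd (f \o cinv (at_ p)) z (tcoord (at_ p) q v)) tq).
Qed.

(** By the chain rule it is enough to check that a function is of class C^1 in one
    chart whose domain contains the open set, although [C1_on] refers to all the
    charts. *)
Lemma C1_on_chart p (O : set M) (f : M -> R) (df : E -> E) : open O -> O `<=` dom (at_ p) ->
  C1_gradient (cmap (at_ p) @` O) (f \o cinv (at_ p)) df -> C1_on O f.
Proof.
move=> oO Op Cf q.
have key x : (cmap (at_ q) @` (dom (at_ q) `&` O)) x ->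
  [/\ trans_dom q p x, (cmap (at_ p) @` O) (trans q p x) & O (cinv (at_ q) x)].
  move=> [m [qm Om] <-]; rewrite /trans /= cmapK//; split => //; last by exists m.
  by apply: trans_dom_at => //; exact: Op.
have near_key x : (cmap (at_ q) @` (dom (at_ q) `&` O)) x ->
   \forall y \near x, (cmap (at_ q) @` (dom (at_ q) `&` O)) y.
  move=> /[dup] xx /key[[ix _] _ Ox].
  apply: filterS (near_chart_image ix oO Ox) => y [iy Oy].
  by exists (cinv (at_ q) y); [split => //; exact: cinv_dom|exact: cinvK].
have dE x : (cmap (at_ q) @` (dom (at_ q) `&` O)) x ->
   differentiable (f \o cinv (at_ q)) x /\
   forall v, 'd (f \o cinv (at_ q)) x v = dot (df (trans q p x)) ('d (trans q p) x v).
  move=> /[dup] xx /key[qpx Ox _].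
  have [[d2 D2] _] := Cf _ Ox; have d1 := differentiable_trans qpx.
  have H : \forall y \near x, (f \o cinv (at_ p)) (trans q p y) = (f \o cinv (at_ q)) y.
    apply: filterS (near_key x xx) => y /key[[iy py] _ _].
    by rewrite /trans /= cmapK.
  have [D1' D2'] := near_diff_comp H d1 d2.
  split; [exact: D1'|move=> v].
  by apply: etrans (D2' v) _; exact: (congr1 (@^~ _) D2).
split; first by move=> x /dE[].
move=> i x xx.
have [qpx Ox _] := key x xx; have [_ cdf] := Cf _ Ox.
have H : \forall y \near x, dot (df (trans q p y)) ('d (trans q p) y (delta_mx 0 i)) =
    'D_(delta_mx 0 i) (f \o cinv (at_ q)) y.
  by apply: filterS (near_key x xx) => y /dE[D1 D2]; rewrite deriveE.
rewrite /prop_for /continuous_at -(nbhs_singleton H).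
apply: cvg_trans (near_eq_cvg H) _.
apply: cvg_dot; first exact: (continuous_comp (trans_continuous qpx) cdf).
by apply: cvg_dtrans => //; exact: cvg_cst.
Qed.

End Transition.

(** * Frames and their coordinates *)

Section Minkowski.
Context {R : realType} {n : nat}.
Local Notation E := 'rV[R]_n.+1.
Implicit Types (a b : E).

Definition minkmx : 'M[R]_n.+1 := diag_mx (\row_i (if i == 0 then -1 else 1)).

Lemma minkmxE a b : (a *m minkmx *m b^T) 0 0 = mink a b.
Proof.
rewrite /minkmx mul_mx_diag mxE big_ord_recl !mxE/= /mink; congr (_ + _); first by ring.
by apply: eq_bigr => i _; rewrite !mxE/= mulr1.
Qed.

Lemma minkmxK : minkmx *m minkmx = 1%:M.
Proof.
rewrite mulmx_diag -diag_const_mx; congr diag_mx; apply/rowP => i; rewrite !mxE.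
by case: ifP => _; rewrite ?mulrNN mulr1.
Qed.

Lemma minkmx_unit : minkmx \in unitmx.
Proof. by have [] := mulmx1_unit minkmxK. Qed.

Lemma invmx_minkmx : invmx minkmx = minkmx.
Proof. by rewrite -[RHS](mulKmx minkmx_unit) minkmxK mulmx1. Qed.

Lemma tr_minkmx : minkmx^T = minkmx.
Proof. exact: tr_diag_mx. Qed.

Lemma mulmx_tr_dot a b : (a *m b^T) 0 0 = dot a b.
Proof. by rewrite dotE. Qed.

Lemma dot_mulmx a b (A : 'M[R]_n.+1) : dot a (b *m A) = dot (a *m A^T) b.
Proof. by rewrite !dotE trmx_mul mulmxA. Qed.

Lemma quad_form_small (A : 'M[R]_n.+1) a :
  `|(a *m A *m a^T) 0 0| <= n.+1%:R * n.+1%:R * `|A| * dot a a.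
Proof.
have -> : (a *m A *m a^T) 0 0 = \sum_i \sum_j (a 0 i * A i j * a 0 j).
  rewrite mxE exchange_big/=; apply: eq_bigr => j _.
  by rewrite !mxE mulr_suml.
have H i j : `|a 0 i * A i j * a 0 j| <= `|A| * dot a a.
  rewrite !normrM mulrAC [leRHS]mulrC ler_pM ?mulr_ge0//; last first.
    by rewrite [leRHS]mx_normrE; exact: (le_bigmax _ (fun p : 'I_n.+1 * 'I_n.+1 => `|A p.1 p.2|) (i, j)).
  apply: le_trans (norm_sq_le_dot a).
  by rewrite expr2 ler_pM// coord_le_norm.
apply: le_trans (ler_norm_sum _ _ _) _.
apply: (@le_trans _ _ (\sum_(i < n.+1) n.+1%:R * (`|A| * dot a a))).
  apply: ler_sum => i _; apply: le_trans (ler_norm_sum _ _ _) _.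
  apply: (@le_trans _ _ (\sum_(i < n.+1) `|A| * dot a a)); first exact: ler_sum.
  by rewrite sumr_const card_ord mulr_natl.
by rewrite sumr_const card_ord -[leLHS]mulr_natl -!mulrA.
Qed.

End Minkowski.

Section Frame.
Context {R : realType} {n : nat} (M : manifold R n).
Local Notation E := 'rV[R]_n.+1.
Variables (p : M) (P : 'M[R]_n.+1).
Hypothesis Pu : P \in unitmx.
Implicit Types (a v w x y z : E) (q : M).

Local Notation img := (cmap (at_ p) @` dom (at_ p)).

Definition aff y : E := cmap (at_ p) p + y *m P.
Definition affinv x : E := (x - cmap (at_ p) p) *m invmx P.
(** The rows of P being a frame of the tangent space at p, these are the points
    with coordinates y in the chart at p, after the affine change of coordinates
    which sends p to 0 and the frame to the standard basis. *)
Definition param y : M := cinv (at_ p) (aff y).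
Definition coordf q : E := affinv (cmap (at_ p) q).
Definition param_dom y := img (aff y).
(** Its rows are the vectors at q of the coordinate frame of [param]. *)
Definition frame_mx q : 'M[R]_n.+1 := P *m lin1_mx (tvec (at_ p) q).
Definition coframe q v : E := tcoord (at_ p) q v *m invmx P.

Lemma affK : cancel aff affinv.
Proof. by move=> y; rewrite /aff /affinv addrC addKr mulmxK. Qed.

Lemma affinvK : cancel affinv aff.
Proof. by move=> x; rewrite /aff /affinv mulmxKV// addrC subrK. Qed.

Lemma aff0 : aff 0 = cmap (at_ p) p.
Proof. by rewrite /aff mul0mx addr0. Qed.

Lemma is_diff_mulmxr (A : 'M[R]_n.+1) y : is_diff y (fun v : E => v *m A) (fun v : E => v *m A).
Proof.
have cA : continuous (mulmxr A : {linear E -> E}).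
  move=> z; apply: (@cvg_mulmx _ _ (nbhs z) _ _ _ _ (fun v : E => v) (fun=> A) z A).
    exact: cvg_id.
  exact: cvg_cst.
split; first by apply: (linear_differentiable (f := mulmxr A)); exact: cA.
by apply: (diff_lin y (f := mulmxr A)); exact: cA.
Qed.

Lemma is_diff_aff y : is_diff y aff (fun v => v *m P).
Proof.
have D := is_diff_mulmxr P y.
have := @is_diffD _ _ _ (cst (cmap (at_ p) p)) _ _ _ y (is_diff_cst _ _) D.
by move=> D'; apply: is_diff_eq D' _; rewrite add0r.
Qed.

Lemma is_diff_affinv x : is_diff x affinv (fun v => v *m invmx P).
Proof.
have D := is_diff_mulmxr (invmx P) x.
have -> : affinv = (fun v => v *m invmx P) + cst (- cmap (at_ p) p *m invmx P).
  by apply/funext => v; rewrite /affinv mulmxBl mulNmx.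
have := @is_diffD _ _ _ _ _ _ _ x D (is_diff_cst (- cmap (at_ p) p *m invmx P) _).
by move=> D'; apply: is_diff_eq D' _; rewrite addr0.
Qed.

Lemma aff_continuous : continuous aff.
Proof. by move=> y; have [d _] := is_diff_aff y; exact: differentiable_continuous. Qed.

Lemma affinv_continuous : continuous affinv.
Proof. by move=> y; have [d _] := is_diff_affinv y; exact: differentiable_continuous. Qed.

Lemma param_dom0 : param_dom 0.
Proof. by rewrite /param_dom aff0; exact/chart_image/at_dom. Qed.

Lemma param0 : param 0 = p.
Proof. by rewrite /param aff0 cmapK//; exact: at_dom. Qed.

Lemma dom_param y : param_dom y -> dom (at_ p) (param y).
Proof. exact: cinv_dom. Qed.

Lemma cmap_param y : param_dom y -> cmap (at_ p) (param y) = aff y.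
Proof. exact: cinvK. Qed.

Lemma paramK y : param_dom y -> coordf (param y) = y.
Proof. by move=> yd; rewrite /coordf cmap_param// affK. Qed.

Lemma coordfK q : dom (at_ p) q -> param (coordf q) = q.
Proof. by move=> pq; rewrite /param affinvK cmapK. Qed.

Lemma param_continuous y : param_dom y -> {for y, continuous param}.
Proof.
by move=> yd; apply: continuous_comp; [exact: aff_continuous|exact: cinv_cvg].
Qed.

Lemma near_param y (O : set M) : param_dom y -> open O -> O (param y) ->
  \forall z \near y, param_dom z /\ O (param z).
Proof.
move=> yd oO Oy.
exact: (@aff_continuous y _ (near_chart_image (x := aff y) yd oO Oy)).
Qed.

Lemma param_dom_ball : exists2 r, 0 < r & forall y, `|y| < r -> param_dom y.
Proof.
have /near0_eps[r r0 H] := near_param param_dom0 openT I.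
by exists r => // y /H[].
Qed.

Lemma tvec_frame q w : tvec (at_ p) q (w *m P) = w *m frame_mx q.
Proof.
rewrite /frame_mx mulmxA.
exact/esym/(mul_rV_lin1 ('d (cmap (at_ q) \o cinv (at_ p)) (cmap (at_ p) q))).
Qed.

Lemma coframeK q v : dom (at_ p) q -> coframe q v *m frame_mx q = v.
Proof. by move=> pq; rewrite -tvec_frame /coframe mulmxKV// tvecK. Qed.

Lemma frameK q w : dom (at_ p) q -> coframe q (w *m frame_mx q) = w.
Proof. by move=> pq; rewrite -tvec_frame /coframe tcoordK// mulmxK. Qed.

Lemma tcoord_frame q w : dom (at_ p) q -> tcoord (at_ p) q (w *m frame_mx q) = w *m P.
Proof. by move=> pq; rewrite -tvec_frame tcoordK. Qed.

Lemma frame_mx0 : frame_mx p = P.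
Proof.
by apply/row_matrixP => i; rewrite !rowE -tvec_frame tvec_id.
Qed.

Lemma frame_mx_unit q : dom (at_ p) q -> frame_mx q \in unitmx.
Proof.
move=> pq.
pose L : 'M[R]_n.+1 := lin1_mx (tcoord (at_ p) q) *m invmx P.
have LE v : v *m L = coframe q v.
  rewrite /L mulmxA /coframe; congr (_ *m _).
  exact: (mul_rV_lin1 ('d (cmap (at_ p) \o cinv (at_ q)) (cmap (at_ q) q))).
suff : L *m frame_mx q = 1%:M by move=> /mulmx1_unit[].
apply/row_matrixP => i; rewrite !rowE mulmxA LE coframeK// mulmx1.
by [].
Qed.

Definition gram (g : M -> 'M[R]_n.+1) y : 'M[R]_n.+1 :=
  frame_mx (param y) *m g (param y) *m (frame_mx (param y))^T.

Lemma gramE (g : M -> 'M[R]_n.+1) y v w :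
  (v *m gram g y *m w^T) 0 0 = ip g (param y) (v *m frame_mx (param y)) (w *m frame_mx (param y)).
Proof. by rewrite /ip /gram (trmx_mul w) !mulmxA. Qed.

Lemma gram0 (g : M -> 'M[R]_n.+1) : gram g 0 = P *m g p *m P^T.
Proof. by rewrite /gram param0 frame_mx0. Qed.

Lemma gram_continuous (g : M -> 'M[R]_n.+1) y : smooth_form g -> param_dom y ->
  {for y, continuous (gram g)}.
Proof.
move=> sg yd.
pose J q : 'M[R]_n.+1 := lin1_mx (tvec (at_ p) q).
pose H y := J (param y) *m g (param y) *m (J (param y))^T.
suff cH : {for y, continuous H}.
  have -> : gram g = fun y => P *m H y *m P^T.
    by apply/funext => z; rewrite /gram /frame_mx /H trmx_mul !mulmxA.
  have cP A : (fun _ : E => A : 'M[R]_n.+1) @ nbhs y --> A by exact: cvg_cst.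
  exact: cvg_mulmx (cvg_mulmx (cP P) cH) (cP P^T).
apply: (@cvg_mx _ _ (nbhs y)) => i j.
have HE z : H z i j = ip g (param z) (tvec (at_ p) (param z) (delta_mx 0 i))
    (tvec (at_ p) (param z) (delta_mx 0 j)).
  have JE k : tvec (at_ p) (param z) (delta_mx 0 k) = delta_mx 0 k *m J (param z).
    exact/esym/(mul_rV_lin1 ('d (cmap (at_ (param z)) \o cinv (at_ p)) (cmap (at_ p) (param z)))).
  rewrite !JE /ip trmx_mul !mulmxA -(mulmxA (delta_mx 0 i)) -(mulmxA (delta_mx 0 i)).
  by rewrite -rowE trmx_delta -colE !mxE.
pose k z := ip g (param z) (tvec (at_ p) (param z) (delta_mx 0 i))
  (tvec (at_ p) (param z) (delta_mx 0 j)).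
have Hk : (fun z => H z i j) = k by apply/funext => z; exact: HE.
have ck : {for y, continuous k}.
  exact: (continuous_comp (@aff_continuous y) (sg p i j 0%N _ yd)).
exact: (eq_ind_r (fun f : E -> R => f z @[z --> y] --> f y) ck Hk).
Qed.

End Frame.

(** * The inverse metric; sub- and supergradients in coordinates *)

Section Cometric.
Context {R : realType} {n : nat} (M : spacetime R n).
Local Notation E := 'rV[R]_n.+1.
Local Notation g := (@metric R n M).
Implicit Types (p q : M) (P : 'M[R]_n.+1) (a v w x y z : E).

Definition orthonormal_frame p P := P *m g p *m P^T = minkmx.

Lemma frame_unit p P : orthonormal_frame p P -> P \in unitmx.
Proof.
move=> H; have := minkmx_unit (R := R) (n := n).
by rewrite -H !unitmx_mul => /andP[/andP[]].
Qed.

Lemma orthonormal_frame_exists p : exists P, orthonormal_frame p P.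
Proof. by have [_ /(_ p)[P _ H]] := metric_lorentzian M; exists P. Qed.

Lemma metric_unit p : g p \in unitmx.
Proof.
have [P H] := orthonormal_frame_exists p.
have := minkmx_unit (R := R) (n := n).
by rewrite -H !unitmx_mul => /andP[/andP[]].
Qed.

(** Symmetry of the metric is contained in the existence of orthonormal frames. *)
Lemma metric_sym p : (g p)^T = g p.
Proof.
have [P H] := orthonormal_frame_exists p; have Pu := frame_unit H.
have : (P *m g p *m P^T)^T = P *m g p *m P^T by rewrite H tr_minkmx.
rewrite !trmx_mul trmxK mulmxA.
have PTu : P^T \in unitmx by rewrite unitmx_tr.
move=> /(congr1 (fun A => invmx P *m A *m invmx P^T)).
by rewrite !mulmxA !mulVmx// !mul1mx !mulmxK.
Qed.

Lemma ipC p v w : ip g p v w = ip g p w v.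
Proof.
rewrite /ip -[LHS]/(((v *m g p *m w^T)) 0 0) -[in LHS](trmxK (v *m g p *m w^T)) mxE.
by rewrite !trmx_mul trmxK metric_sym mulmxA.
Qed.

Variables (p : M) (P : 'M[R]_n.+1).
Hypothesis frameP : orthonormal_frame p P.
Let Pu := frame_unit frameP.

(** The inverse metric, on the covectors at the point of coordinates y. *)
Definition cometric y a : R := (a *m invmx (gram p P g y) *m a^T) 0 0.

Lemma gram_unit y : param_dom p P y -> gram p P g y \in unitmx.
Proof.
move=> yd; have Fu := frame_mx_unit Pu (dom_param yd).
by rewrite /gram (unitmx_mul (_ *m _)) (unitmx_mul (frame_mx _ _ _)) unitmx_tr metric_unit Fu.
Qed.

Lemma cvg_cometric_mx : invmx (gram p P g y) @[y --> (0 : E)] --> (minkmx : 'M[R]_n.+1).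
Proof.
have [sg _] := metric_lorentzian M.
have cG : gram p P g y @[y --> (0 : E)] --> (minkmx : 'M[R]_n.+1).
  have := gram_continuous sg (param_dom0 p P).
  by rewrite /prop_for /continuous_at gram0 frameP.
have Gu : \forall y \near (0 : E), gram p P g y \in unitmx.
  by apply: filterS (near_param (param_dom0 p P) openT I) => y [yd _]; exact: gram_unit.
have H := cvg_invmx _ minkmx_unit Gu cG; rewrite invmx_minkmx in H; exact: H.
Qed.

Lemma cometric_near_minkowski : near_minkowski cometric.
Proof.
move=> e e0; pose N : R := n.+1%:R.
have N0 : 0 < N by rewrite ltr0n.
have e1 : 0 < e / (N * N) by rewrite divr_gt0// mulr_gt0.
have /cvgrPdist_lt/(_ _ e1)/near0_eps[r r0 H] := cvg_cometric_mx.
exists r => // y a /H {}H.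
rewrite /cometric -minkmxE.
have -> : (a *m invmx (gram p P g y) *m a^T) 0 0 - (a *m minkmx *m a^T) 0 0 =
    (a *m (invmx (gram p P g y) - minkmx) *m a^T) 0 0.
  by rewrite mulmxBr mulmxBl !mxE.
apply: le_trans (quad_form_small _ _) _.
have d0 : 0 <= dot a a by apply: le_trans (norm_sq_le_dot a); exact: sqr_ge0.
rewrite ler_wpM2r// -/N distrC mulrC -ler_pdivlMr ?mulr_gt0//.
exact: ltW.
Qed.

(** The gradient with respect to g of a function with differential a at the point
    of coordinates y. *)
Definition vector_of_covector y a : E := a *m invmx (gram p P g y) *m frame_mx p P (param p P y).

Lemma ip_vector_of_covector y a v : param_dom p P y ->
  ip g (param p P y) (vector_of_covector y a) v = dot a (coframe p P (param p P y) v).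
Proof.
move=> yd; have pq := dom_param yd.
rewrite -{1}(coframeK Pu v pq) -gramE mulmxKV ?gram_unit//.
by rewrite mulmx_tr_dot.
Qed.

Lemma ip_vector_of_covector_sq y a : param_dom p P y ->
  ip g (param p P y) (vector_of_covector y a) (vector_of_covector y a) = cometric y a.
Proof.
move=> yd; rewrite ip_vector_of_covector// /vector_of_covector frameK//; last exact: dom_param.
by rewrite /cometric dotC dotE.
Qed.

Lemma C1_gradient_affine_pullback (O : set E) (f : E -> R) (df : E -> E) x :
  C1_gradient O f df -> O (affinv p P x) ->
  has_gradient (f \o affinv p P) x (df (affinv p P x) *m (invmx P)^T) /\
  {for x, continuous (fun x => df (affinv p P x) *m (invmx P)^T)}.
Proof.
move=> Cf Ox; have [G cdf] := Cf _ Ox.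
split.
  have D2 := is_diff_affinv p P x.
  have D := is_diff_comp D2 (G : is_diff (affinv p P x) f _).
  apply: (is_diff_dot_eq (df := dot (df (affinv p P x)) \o mulmx^~ (invmx P))) => // v.
  exact: dot_mulmx.
have c1 : {for x, continuous (df \o affinv p P)}.
  exact: (continuous_comp (@affinv_continuous _ _ _ p P x) cdf).
have cP : (fun _ : E => (invmx P)^T : 'M[R]_n.+1) @ nbhs x --> (invmx P)^T by exact: cvg_cst.
exact: cvg_mulmx c1 cP.
Qed.

(** What makes touching functions in coordinates provide sub- and supergradients
    on the manifold. *)
Lemma chart_test_function (O : set E) (f : E -> R) (df : E -> E) y : param_dom p P y ->
  open O -> O y -> C1_gradient O f df ->
  let q := param p P y in let V := dom (at_ p) `&` (coordf p P @^-1` O) in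
  [/\ open_nbhs q V, C1_on V (f \o coordf p P) &
     is_gradient (f \o coordf p P) q (vector_of_covector y (df y))].
Proof.
move=> yd oO Oy Cf q V.
have pq : dom (at_ p) q := dom_param yd.
have qy : coordf p P q = y := paramK Pu yd.
have ccoord m : dom (at_ p) m -> {for m, continuous (coordf p P)}.
  move=> pm; apply: continuous_comp; first exact: cmap_cvg.
  exact: affinv_continuous.
have oV : open V.
  rewrite openE => m [pm Om]; apply: filterI.
    by apply: open_nbhs_nbhs; split => //; exact: dom_open.
  by apply: (ccoord m pm); exact: open_nbhs_nbhs.
have Vp : V `<=` dom (at_ p) by move=> m [].
have Cf' : C1_gradient (cmap (at_ p) @` V) ((f \o coordf p P) \o cinv (at_ p))
   (fun x => df (affinv p P x) *m (invmx P)^T).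
  move=> x [m [pm Om] <-].
  have [G1 G2] := C1_gradient_affine_pullback Cf Om; split => //.
  have [d D] := G1.
  have H : \forall x \near cmap (at_ p) m, (f \o affinv p P) x =
     ((f \o coordf p P) \o cinv (at_ p)) x.
    apply: filterS (near_chart_image (chart_image pm) openT I) => x' [ix _].
    by rewrite /= /coordf cinvK.
  have [d' D'] := near_differentiable H d.
  by split; [exact: d'|apply: etrans D' D].
split.
- by split => //; split => //; rewrite /= qy.
- exact: C1_on_chart oV Vp Cf'.
- have Vq : (cmap (at_ p) @` V) (cmap (at_ p) q).
    by exists q => //; split => //; rewrite /= qy.
  have [[d D] _] := Cf' _ Vq.
  have [D1 D2] := differential_chart pq d.
  split; first exact: D1.
  move=> v; rewrite ip_vector_of_covector// D2 D -dot_mulmx.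
  by rewrite -[affinv p P _]/(coordf p P q) qy.
Qed.

Lemma touched_above_super (f : M -> R) y a : param_dom p P y ->
  touched_above (f \o param p P) y a ->
  supergradient f (param p P y) (vector_of_covector y a).
Proof.
move=> yd [ O [h [dh [[oO Oy Ch hy <-] fh]]]].
have [oV C1V gV] := chart_test_function yd oO Oy Ch.
exists (dom (at_ p) `&` (coordf p P @^-1` O)), (h \o coordf p P); split => //.
- by rewrite /= paramK.
- by move=> q [pq Oq]; have := fh _ Oq; rewrite /= coordfK.
Qed.

Lemma touched_below_sub (f : M -> R) y a : param_dom p P y ->
  touched_below (f \o param p P) y a ->
  subgradient f (param p P y) (vector_of_covector y a).
Proof.
move=> yd [ O [h [dh [[oO Oy Ch hy <-] fh]]]].
have [oV C1V gV] := chart_test_function yd oO Oy Ch.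
exists (dom (at_ p) `&` (coordf p P @^-1` O)), (h \o coordf p P); split => //.
- by rewrite /= paramK.
- by move=> q [pq Oq]; have := fh _ Oq; rewrite /= coordfK.
Qed.

(** The differential, in the coordinates of [param], of a function with gradient V
    at p. *)
Definition covector (V : E) : E := V *m g p *m P^T.

Lemma gradient_param (f : M -> R) V : is_gradient f p V ->
  has_gradient (f \o param p P) 0 (covector V).
Proof.
move=> [df Df].
have [d2 D2] := is_diff_aff p P 0.
have df' : differentiable (f \o cinv (at_ p)) (aff p P 0) by rewrite aff0.
have [d3 D3] := diff_comp_at d2 df'.
split; first exact: d3.
apply/funext => v; apply: etrans (D3 v) _.
rewrite /covector dotE -mulmxA -trmx_mul -[RHS]/(ip g p V (v *m P)) Df.
rewrite -[v *m P]/((fun v => v *m P) v) -D2.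
exact: (congr1 (fun z : E => 'd (f \o cinv (at_ p)) z _) (aff0 p P)).
Qed.

Lemma gradient_param_inv (f : M -> R) a : has_gradient (f \o param p P) 0 a ->
  is_gradient f p (a *m minkmx *m P).
Proof.
move=> [df Df].
have [d2 D2] := is_diff_affinv p P (cmap (at_ p) p).
have A0 : affinv p P (cmap (at_ p) p) = 0 by rewrite -(aff0 p P) affK.
have df' : differentiable (f \o param p P) (affinv p P (cmap (at_ p) p)) by rewrite A0.
have H : \forall x \near cmap (at_ p) p, (f \o param p P) (affinv p P x) = (f \o cinv (at_ p)) x.
  by apply: (@nearW _ (nbhs (cmap (at_ p) p))) => x; rewrite /= /param affinvK.
have [d3 D3] := near_diff_comp H d2 df'.
split; first exact: d3.
move=> v; apply/esym; apply: etrans (D3 v) _.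
have -> : ip g p (a *m minkmx *m P) v = dot a (v *m invmx P).
  set w := v *m invmx P; have vE : v = w *m P by rewrite mulmxKV.
  rewrite /ip vE trmx_mul mulmxA -(mulmxA _ P) -(mulmxA _ (P *m g p)) frameP.
  by rewrite -(mulmxA a) minkmxK mulmx1 mulmx_tr_dot.
apply: etrans (congr1 (fun w => 'd (f \o param p P) (affinv p P (cmap (at_ p) p)) w)
  (congr1 (fun L : E -> E => L v) D2)) _.
apply: etrans _ (congr1 (fun L : E -> R => L (v *m invmx P)) Df).
exact: (congr1 (fun z : E => 'd (f \o param p P) z _) A0).
Qed.

Lemma vectorK V : covector V *m minkmx *m P = V.
Proof.
have PTu : P^T \in unitmx by rewrite unitmx_tr.
have gE : invmx (g p) = P^T *m (minkmx *m P).
  have : (P *m g p *m P^T) *m minkmx = 1%:M by rewrite frameP minkmxK.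
  move=> /(congr1 (fun A => invmx P *m A *m P)); rewrite mulmx1 mulVmx// !mulmxA mulVmx// mul1mx.
  rewrite -!mulmxA => /(congr1 (mulmx (invmx (g p)))).
  by rewrite mulmx1 mulKmx// metric_unit.
by rewrite /covector -!mulmxA -gE mulmxV ?mulmx1// metric_unit.
Qed.

Lemma mink_covector V W : mink (covector V) (covector W) = ip g p V W.
Proof.
have WE : (covector W)^T = P *m g p *m W^T.
  by rewrite /covector trmx_mul trmxK trmx_mul metric_sym mulmxA.
by rewrite -minkmxE WE !mulmxA vectorK.
Qed.

End Cometric.

(** * Orthonormal frames adapted to a timelike vector *)

Section AdaptedFrames.
Context {R : realType} {n : nat}.
Local Notation E := 'rV[R]_n.+1.
Implicit Types (y w : E).

Local Notation e0 := (delta_mx 0 0 : E).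

Lemma mink_delta0 w : mink e0 w = - w 0 0.
Proof. by rewrite /mink sdot_e0 mxE/= mul1r addr0. Qed.

Lemma minkC y w : mink y w = mink w y.
Proof. by rewrite /mink mulrC sdotC. Qed.

(** The Lorentzian reflection with respect to the hyperplane orthogonal to y + e0;
    this vector is timelike because y00 >= 0. *)
Lemma reflection_exists y : mink y y = -1 -> 0 <= y 0 0 ->
  exists2 H : 'M[R]_n.+1, H *m minkmx *m H^T = minkmx & e0 *m H = - y.
Proof.
move=> yy y0; pose w := y + e0.
have w0 : w 0 0 = y 0 0 + 1 by rewrite !mxE.
have ww : mink w w = -2 - 2 * y 0 0.
  have : mink w w = mink y y + 2 * mink e0 y + mink e0 e0.
    by rewrite /mink !sdotE !mxE !(sdotC y) !sdot_e0 /=; ring.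
  by rewrite yy !mink_delta0 mxE/=; lra.
pose N := mink w w.
have N0 : N != 0 by rewrite lt_eqF// /N ww; lra.
pose k := 2 / N; pose c := minkmx *m w^T.
have wc : w *m c = N%:M.
  by apply/rowP => i; rewrite ord1 mulmxA minkmxE [RHS]mxE eqxx mulr1n.
have ct : c^T = w *m minkmx by rewrite trmx_mul trmxK tr_minkmx.
exists (1%:M - k *: (c *m w)).
  have -> : (1%:M - k *: (c *m w))^T = 1%:M - k *: (w^T *m c^T).
    by rewrite linearB linearZ /= trmx1 trmx_mul.
  have kN : k * N = 2 by rewrite /k divfK.
  have cwT : c^T *m w^T = N%:M by rewrite ct -mulmxA -/c wc.
  have AwT : (minkmx - k *: (c *m c^T)) *m w^T = - c.
    rewrite mulmxBl -/c -scalemxAl -mulmxA cwT mul_mx_scalar scalerA kN.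
    by rewrite scaler_nat mulr2n opprD addrA subrr sub0r.
  rewrite mulmxBl mul1mx -scalemxAl -mulmxA -ct mulmxBr mulmx1 -scalemxAr mulmxA AwT.
  by rewrite mulNmx scalerN opprK subrK.
rewrite mulmxBr mulmx1 -scalemxAr mulmxA.
have -> : e0 *m c = (- w 0 0)%:M.
  by apply/rowP => i; rewrite ord1 mulmxA minkmxE mink_delta0 [RHS]mxE eqxx mulr1n.
rewrite mul_scalar_mx scalerA.
have -> : k * - w 0 0 = 1.
  have -> : - w 0 0 = N / 2 by rewrite /N ww w0; field.
  by rewrite /k; field.
by rewrite scale1r /w opprD addrC subrK.
Qed.

(** If y00 >= 0 the reflection sends e0 to -y, and a preceding reversal of time
    corrects the sign; otherwise the reflection built from -y sends e0 to y. *)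
Lemma lorentz_frame_exists y : mink y y = -1 ->
  exists2 H : 'M[R]_n.+1, H *m minkmx *m H^T = minkmx & e0 *m H = y.
Proof.
move=> yy; have [y0|y0] := leP 0 (y 0 0).
  have [H H1 H2] := reflection_exists yy y0.
  exists (minkmx *m H).
    rewrite trmx_mul tr_minkmx -!mulmxA (mulmxA minkmx H^T) (mulmxA H) (mulmxA H).
    rewrite -(mulmxA _ _ minkmx).
    by rewrite (mulmxA (H *m _)) H1 minkmxK mulmx1.
  have -> : e0 *m (minkmx *m H) = - (e0 *m H).
    rewrite mulmxA -mulNmx; congr (_ *m _).
    apply/rowP => i; rewrite mul_mx_diag !mxE.
    by rewrite eqxx; case: (i == 0); rewrite /= ?mul0r ?mul1r ?mulr0n ?mulr1n ?oppr0.
  by rewrite H2 opprK.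
have yy' : mink (- y) (- y) = -1 by rewrite -yy /mink sdotNl sdotNr !mxE; ring.
have [|H H1 H2] := reflection_exists yy'; first by rewrite mxE; lra.
by exists H => //; rewrite H2 opprK.
Qed.

(** A timelike covector cannot be orthogonal to a timelike vector x with x00 > 0:
    its pairing with x has the sign of its time component. The margin e allows for
    a metric that is only close to the Minkowski metric. *)
Lemma same_sign (e : R) (a x : E) : 0 < e < 1 -> 0 < x 0 0 ->
  0 < (1 - e) * (x 0 0 * x 0 0) - (1 + e) * sdot x x ->
  1 + (1 - e) * sdot a a <= (1 + e) * (a 0 0 * a 0 0) -> 0 < a 0 0 * dot a x.
Proof.
move=> /andP[e0 e1] x0 X1; rewrite /dot.
set s := sdot a x.
have CS := sdot_CS a x; have Sa := sdot_ge0 a; have Sx := sdot_ge0 x.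
pose b := a 0 0 * a 0 0.
rewrite -/b => B1.
have b0 : 0 < b.
  have : 0 <= (1 - e) * sdot a a by rewrite mulr_ge0//; clear -e1; lra.
  have e11 : 0 < 1 + e by clear -e0; lra.
  by rewrite -(pmulr_rgt0 b e11); clear -B1; lra.
have x2 : 0 < x 0 0 * x 0 0 by exact: mulr_gt0.
have key : s ^+ 2 < b * (x 0 0 * x 0 0).
  apply: le_lt_trans CS _.
  have e10 : 0 <= (1 + e) * sdot x x by rewrite mulr_ge0//; clear -e0; lra.
  have B2 : (1 - e) * sdot a a <= (1 + e) * b by clear -B1; lra.
  have K1 := ler_wpM2r e10 B2.
  have K2 : (1 + e) * b * ((1 + e) * sdot x x) < (1 + e) * b * ((1 - e) * (x 0 0 * x 0 0)).
    rewrite ltr_pM2l; first by clear -X1; lra.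
    by rewrite mulr_gt0//; clear -e0; lra.
  have ee : 0 < (1 - e) * (1 + e) by rewrite mulr_gt0//; clear -e0 e1; lra.
  rewrite -(ltr_pM2l ee); move: K1 K2; clear; lra.
have : 0 < b * x 0 0 by exact: mulr_gt0.
move=> bx.
have ab : a 0 0 ^+ 2 = b by rewrite expr2.
have key2 : (a 0 0 * s) ^+ 2 < (b * x 0 0) ^+ 2.
  rewrite exprMn ab [ltRHS]expr2.
  have -> : b * x 0 0 * (b * x 0 0) = b * (b * (x 0 0 * x 0 0)) by ring.
  by rewrite ltr_pM2l.
have : `|a 0 0 * s| < b * x 0 0.
  rewrite -(@ltr_pXn2r _ 2)// ?nnegrE//; last exact: ltW.
  by rewrite real_normK ?num_real.
rewrite ltr_norml => /andP[L _].
have -> : a 0 0 * (a 0 0 * x 0 0 + s) = b * x 0 0 + a 0 0 * s by rewrite /b; ring.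
by clear -L; lra.
Qed.

End AdaptedFrames.

(** * The time orientation in a frame *)

Section Orientation.
Context {R : realType} {n : nat} (M : spacetime R n).
Local Notation E := 'rV[R]_n.+1.
Local Notation g := (@metric R n M).
Local Notation e0 := (delta_mx 0 0 : E).
Implicit Types (p q : M) (P : 'M[R]_n.+1) (a v w x y z V : E).

Lemma mink_frame p P v w : orthonormal_frame p P -> mink v w = ip g p (v *m P) (w *m P).
Proof. by move=> HP; rewrite -minkmxE -HP /ip trmx_mul !mulmxA. Qed.

Lemma adapted_frame p v : ip g p v v = -1 ->
  exists2 P, orthonormal_frame p P & e0 *m P = v.
Proof.
move=> vv; have [P0 H0] := orthonormal_frame_exists p; have Pu := frame_unit H0.
pose y : E := v *m invmx P0.
have yP : y *m P0 = v by rewrite /y mulmxKV.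
have yy : mink y y = -1.
  by rewrite (mink_frame _ _ H0) yP.
have [H H1 H2] := lorentz_frame_exists yy.
exists (H *m P0); last by rewrite mulmxA H2 yP.
by rewrite /orthonormal_frame trmx_mul -!mulmxA (mulmxA P0) (mulmxA (P0 *m _)) H0 mulmxA H1.
Qed.

Lemma covector0 p P V : (covector p P V) 0 0 = ip g p V (e0 *m P).
Proof. by rewrite -dot_delta /covector dotE -mulmxA -trmx_mul. Qed.

Lemma normalize_timelike p v : ip g p v v < 0 ->
  exists2 k, 0 < k & ip g p (k *: v) (k *: v) = -1.
Proof.
move=> vv; pose s := Num.sqrt (- ip g p v v).
have s0 : 0 < s by rewrite sqrtr_gt0; lra.
have s2 : s ^+ 2 = - ip g p v v by rewrite sqr_sqrtr//; lra.
exists s^-1; first by rewrite invr_gt0.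
have -> : ip g p (s^-1 *: v) (s^-1 *: v) = s ^- 2 * ip g p v v.
  rewrite /ip linearZ /= -!scalemxAl -scalemxAr !mxE mulrA; congr (_ * _).
  by rewrite expr2 invfM.
rewrite -[ip g p v v]opprK -s2 mulrN mulVf// expf_neq0// gt_eqF//.
Qed.

Lemma ipZr p v w (k : R) : ip g p v (k *: w) = k * ip g p v w.
Proof. by rewrite /ip linearZ /= -scalemxAr mxE. Qed.

Lemma ipNr p v w : ip g p v (- w) = - ip g p v w.
Proof. by rewrite -scaleN1r ipZr mulN1r. Qed.

Definition future_frame p P := orthonormal_frame p P /\ ip g p (orient p) (e0 *m P) < 0.

Lemma orient_frame p : exists P, [/\ future_frame p P &
  exists2 k, 0 < k & e0 *m P = k *: orient p].
Proof.
have [k k0 kk] := normalize_timelike (orient_timelike p).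
have [P HP Pe] := adapted_frame kk.
exists P; split; last by exists k.
split => //; rewrite Pe ipZr pmulr_rlt0//; exact: orient_timelike.
Qed.

Lemma orient_frame_sign p P k V : 0 < k -> e0 *m P = k *: orient p ->
  (covector p P V) 0 0 = k * ip g p (orient p) V.
Proof. by move=> k0 Pk; rewrite covector0 Pk ipZr ipC. Qed.

(** A vector orthogonal to the timelike orientation field is spacelike. *)
Lemma orient_sign p V : ip g p V V <= -1 ->
  0 < ip g p (orient p) V \/ ip g p (orient p) V < 0.
Proof.
move=> VV; have [P [[FP _] [k k0 Pk]]] := orient_frame p.
have [?|?|V0] := ltgtP 0 (ip g p (orient p) V); [by left|by right|exfalso].
have := orient_frame_sign V k0 Pk; rewrite -V0 mulr0 => w0.
move: VV; rewrite -(mink_covector FP) /mink w0.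
by have := sdot_ge0 (covector p P V); lra.
Qed.

Section Sign.
Variables (p : M) (P : 'M[R]_n.+1).
Hypothesis FP : future_frame p P.
Let frameP : orthonormal_frame p P := FP.1.
Let Pu := frame_unit frameP.

Definition orient_coords y : E := coframe p P (param p P y) (orient (param p P y)).

Lemma orient_coords_cvg : orient_coords y @[y --> (0 : E)] --> orient p *m invmx P.
Proof.
have [_] := orient_continuous (s := M) p => H.
have cp := param_continuous (param_dom0 p P); rewrite /prop_for /continuous_at param0 in cp.
have cP : (fun _ : E => invmx P : 'M[R]_n.+1) @ nbhs (0 : E) --> invmx P by exact: cvg_cst.
exact: cvg_mulmx (@cvg_comp _ _ _ (param p P) _ _ _ _ cp H) cP.
Qed.

Lemma orient_coords0 : let z := orient p *m invmx P in 0 < z 0 0 /\ sdot z z < z 0 0 ^+ 2.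
Proof.
move=> z; have zP : z *m P = orient p by rewrite /z mulmxKV.
have [_ X0] := FP.
(* The vector z gives the coordinates of the orientation vector in an orthonormal
   frame whose first vector is future-directed. *)
have zz : mink z z = ip g p (orient p) (orient p).
  by rewrite (mink_frame _ _ frameP) zP.
have z0 : ip g p (orient p) (e0 *m P) = - z 0 0.
  by rewrite -mink_delta0 minkC (mink_frame _ _ frameP) zP.
have := orient_timelike p; rewrite -zz /mink expr2.
by move: X0; rewrite z0; split; lra.
Qed.

(** By continuity, near p, the sign of the time component of a timelike covector
    tells its time orientation. *)
Lemma sign_near : exists2 r, 0 < r & forall y a, `|y| < r ->
  cometric p P y a <= -1 -> 0 < a 0 0 * dot a (orient_coords y).
Proof.
set z := orient p *m invmx P.
have [z0 zz] : 0 < z 0 0 /\ sdot z z < z 0 0 ^+ 2 := orient_coords0.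
have S0 := sdot_ge0 z.
have Z0 : 0 < z 0 0 ^+ 2 by rewrite exprn_gt0.
pose e := (z 0 0 ^+ 2 - sdot z z) / (2 * (z 0 0 ^+ 2 + sdot z z)).
have dn : 0 < 2 * (z 0 0 ^+ 2 + sdot z z) by clear -S0 Z0; lra.
have e0 : 0 < e by rewrite divr_gt0// subr_gt0.
have eE : e * (2 * (z 0 0 ^+ 2 + sdot z z)) = z 0 0 ^+ 2 - sdot z z by rewrite /e divfK// gt_eqF.
have e1 : e < 1 by rewrite /e ltr_pdivrMr//; clear -S0 Z0; lra.
clearbody e.
pose F x : R := (1 - e) * (x 0 0 * x 0 0) - (1 + e) * sdot x x.
have cF : continuous F.
  move=> x; have c1 := @coord0_continuous R n x; have c2 := @sdot_continuous R n x.
  have ck (k : R) : (fun _ : E => k) @ nbhs x --> k by exact: cvg_cst.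
  exact: cvgB (cvgM (ck _) (cvgM c1 c1)) (cvgM (ck _) c2).
have Fz : 0 < F z by rewrite /F -expr2; clear -eE zz; lra.
have cx : {for z, continuous (fun x : E => x 0 0)} by exact: coord0_continuous.
have n1 : \forall y \near (0 : E), 0 < F (orient_coords y).
  have c3 := @cvg_comp _ _ _ orient_coords F _ _ _ orient_coords_cvg (cF z).
  exact: cvgr_gt c3 _ Fz.
have n2 : \forall y \near (0 : E), 0 < orient_coords y 0 0.
  have c3 := @cvg_comp _ _ _ orient_coords (fun x : E => x 0 0) _ _ _ orient_coords_cvg cx.
  exact: cvgr_gt c3 _ z0.
have [r1 r10 H1] := near0_eps (filterI n1 n2).
have [r2 r20 H2] := cometric_near_minkowski frameP e0.
exists (Num.min r1 r2); first by rewrite lt_min r10.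
move=> y a; rewrite lt_min => /andP[yr1 yr2] Qa.
have := H2 y a yr2; rewrite ler_norml => /andP[A1 _].
have [] := H1 y yr1; move: (orient_coords y) => x X1 x0; apply: (same_sign (e := e)) => //.
  by rewrite e0 e1.
by move: A1 Qa; rewrite /mink /dot; lra.
Qed.

End Sign.
End Orientation.

(** * Solutions with past-directed supergradients *)

Section Oriented.
Context {R : realType} {n : nat}.
Local Notation E := 'rV[R]_n.+1.
Local Notation e0 := (delta_mx 0 0 : E).

Lemma near_param0 (M : manifold R n) (p : M) (P : 'M[R]_n.+1) (Q : M -> Prop) :
  (\forall q \near p, Q q) -> \forall y \near (0 : E), Q (param p P y).
Proof.
move=> HQ; have cp := param_continuous (param_dom0 p P).
by rewrite /prop_for /continuous_at param0 in cp; exact: cp.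
Qed.

Section OneSpacetime.
Variable M : spacetime R n.
Local Notation g := (@metric R n M).
Implicit Types (p q : M) (P : 'M[R]_n.+1) (a v w x y z V : E) (f : M -> R).

Lemma ip_inj p V W : (forall v, ip g p V v = ip g p W v) -> V = W.
Proof.
move=> H; suff : V *m g p = W *m g p.
  by move=> /(congr1 (mulmx^~ (invmx (g p)))); rewrite !mulmxK// metric_unit.
by apply/rowP => i; have := H (delta_mx 0 i); rewrite /ip !trmx_delta -!colE !mxE.
Qed.

(** Continuous partial derivatives and differentiability give a continuous
    gradient. *)
Lemma C1_on_gradient p (O : set M) f : C1_on O f ->
  C1_gradient (cmap (at_ p) @` (dom (at_ p) `&` O)) (f \o cinv (at_ p))
    (fun x => \row_i 'D_(delta_mx 0 i) (f \o cinv (at_ p)) x).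
Proof.
move=> Cf x Ox; have [C1 C2] := Cf p.
split; last first.
  apply: (@cvg_mx _ _ (nbhs x)) => i j; rewrite ord1 mxE => {i}.
  have ck := C2 j x Ox.
  have Hk : (fun y : E => (\row_i 'D_(delta_mx 0 i) (f \o cinv (at_ p)) y) 0 j) =
     (fun y => 'D_(delta_mx 0 j) (f \o cinv (at_ p)) y) by apply/funext => y; rewrite mxE.
  exact: (eq_ind_r (fun f : E -> R => f z @[z --> x] --> 'D_(delta_mx 0 j) _ x) ck Hk).
split; first exact: C1.
apply/funext => v; rewrite linear_expand dotC dotE mxE; apply: eq_bigr => i _.
by rewrite !mxE deriveE//; exact: C1.
Qed.

(** The converse of [touched_above_super]: supergradients at points near p
    correspond to touching test functions in coordinates. *)
Lemma super_touched_above p P f y V : orthonormal_frame p P -> param_dom p P y ->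
  supergradient f (param p P y) V ->
  exists2 a, touched_above (f \o param p P) y a & V = vector_of_covector p P y a.
Proof.
move=> frameP yd [ O [psi [[oO Oy] C1 psiy fpsi [dpsi Dpsi]]]].
have Pu := frame_unit frameP.
set q := param p P y in oO Oy psiy dpsi Dpsi *.
have pq : dom (at_ p) q := dom_param yd.
pose W := [set x | param_dom p P x /\ O (param p P x)].
have oW : open W.
  by rewrite openE => x [xd Ox]; exact: near_param.
have Cg := @C1_on_gradient p O psi C1.
pose dF x := (\row_i 'D_(delta_mx 0 i) (psi \o cinv (at_ p)) (aff p P x)) *m P^T.
have CF : C1_gradient W (psi \o param p P) dF.
  move=> x [xd Ox].
  have Ix : (cmap (at_ p) @` (dom (at_ p) `&` O)) (aff p P x).
    by exists (param p P x); [split => //; exact: dom_param|exact: cmap_param].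
  have [G cG] := Cg _ Ix; split.
    have D := is_diff_comp (is_diff_aff p P x) (G : is_diff (aff p P x) _ _).
    apply: (is_diff_dot_eq (df := dot (\row_i 'D_(delta_mx 0 i) (psi \o cinv (at_ p)) (aff p P x))
      \o mulmx^~ P)) => // v.
    exact: dot_mulmx.
  have c1 := continuous_comp (@aff_continuous _ _ _ p P x) cG.
  have cP : (fun _ : E => P^T : 'M[R]_n.+1) @ nbhs x --> P^T by exact: cvg_cst.
  exact: cvg_mulmx c1 cP.
exists (dF y).
  exists W, (psi \o param p P), dF; split.
    by split => //; split.
  by move=> x [xd Ox]; exact: fpsi.
apply: (@ip_inj q) => v; rewrite ip_vector_of_covector// Dpsi.
have Iq : (cmap (at_ p) @` (dom (at_ p) `&` O)) (cmap (at_ p) q).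
  by exists q.
have [[d D] _] := Cg _ Iq.
have [_ D2] := differential_chart pq d.
apply: etrans (D2 v) _; apply: etrans (congr1 (@^~ _) D) _.
have qE : aff p P y = cmap (at_ p) q by rewrite cmap_param.
by rewrite /dF qE -dot_mulmx /coframe mulmxKV.
Qed.

Definition super_past_near f p :=
  \forall q \near p, forall V, supergradient f q V -> 0 < ip g q (orient q) V.

Lemma super_past_near_near f p : super_past_near f p ->
  \forall q \near p, super_past_near f q.
Proof. exact: near_join. Qed.

Lemma ip_orient_covector p P y a : orthonormal_frame p P -> param_dom p P y ->
  ip g (param p P y) (orient (param p P y)) (vector_of_covector p P y a) =
  dot a (orient_coords p P y).
Proof. by move=> frameP yd; rewrite ipC ip_vector_of_covector. Qed.

Section InFrame.
Variables (p : M) (P : 'M[R]_n.+1) (f : M -> R).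
Hypotheses (FP : future_frame p P) (vf : viscosity_solution f).
Let frameP : orthonormal_frame p P := FP.1.
Local Notation u := (f \o param p P).

Lemma frame_continuous y : param_dom p P y -> {for y, continuous u}.
Proof.
move=> yd; have [cf _] := vf.
exact: (continuous_comp (param_continuous yd) (cf (param p P y))).
Qed.

Lemma frame_super y a : param_dom p P y -> touched_above u y a -> cometric p P y a <= -1.
Proof.
move=> yd ua; have [_ /(_ (param p P y))[H _]] := vf.
by rewrite -(ip_vector_of_covector_sq frameP a yd); exact/H/(touched_above_super frameP yd).
Qed.

Lemma frame_sub y a : param_dom p P y -> touched_below u y a -> -1 <= cometric p P y a.
Proof.
move=> yd ua; have [_ /(_ (param p P y))[_ H]] := vf.
by rewrite -(ip_vector_of_covector_sq frameP a yd); exact/H/(touched_below_sub frameP yd).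
Qed.

Lemma frame_past : super_past_near f p -> exists2 r, 0 < r & forall y, `|y| < r ->
  param_dom p P y /\ forall a, touched_above u y a -> cometric p P y a <= -1 /\ 0 < a 0 0.
Proof.
move=> fp; have [r1 r10 H1] := param_dom_ball p P.
have [r2 r20 H2] := sign_near FP.
have [r3 r30 H3] := near0_eps (near_param0 P fp).
pose r := Num.min r1 (Num.min r2 r3).
exists r; first by rewrite !lt_min r10 r20 r30.
move=> y; rewrite !lt_min => /andP[yr1 /andP[yr2 yr3]].
have yd := H1 y yr1; split => // a ua.
have Qa := frame_super yd ua; split => //.
have := H3 y yr3 _ (touched_above_super frameP yd ua).
rewrite ip_orient_covector// => ax; have := H2 y a yr2 Qa.
by rewrite pmulr_lgt0.
Qed.

(** Past-directed supergradients make f grow towards the future at the rate of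
    proper time. *)
Lemma frame_increasing : super_past_near f p -> flat_increasing u.
Proof.
move=> /frame_past[r r0 H].
apply: (@flat_increasing_of_touching _ _ (cometric p P) u r (cometric_near_minkowski frameP) r0).
- by move=> y /H[yd _]; exact: frame_continuous.
- by move=> y a /H[_]; exact.
Qed.

End InFrame.

Lemma increasing_touch_past p P f psi V : future_frame p P -> flat_increasing (f \o param p P) ->
  is_gradient psi p V -> psi p = f p ->
  (\forall q \near p, f q <= psi q) \/ (\forall q \near p, psi q <= f q) ->
  ip g p V V <= -1 /\ 0 < (covector p P V) 0 0.
Proof.
move=> [frameP _] uinc gV psip near.
have gu := gradient_param P gV.
have [||w0 ww] := increasing_touch uinc gu.
- by rewrite /= param0.
- by case: near => /(near_param0 P) near; [left|right].
by rewrite -(mink_covector frameP).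
Qed.

(** A subgradient V has square at most -1 by growth and at least -1 as f is a
    solution, hence exactly -1, and -V is the first vector of an orthonormal frame
    in which the differential of the test function is e0. *)
Lemma differentiable_at_subgradient_past p f V : viscosity_solution f -> super_past_near f p ->
  subgradient f p V -> is_gradient f p V /\ 0 < ip g p (orient p) V.
Proof.
move=> vf fp fV; have := fV; move=> [ O [psi [[oO Op] C1 psip psif gV]]].
have near_psi : \forall q \near p, psi q <= f q.
  by apply: filterS (open_nbhs_nbhs (conj oO Op)) => q; exact: psif.
have [P [FP [k k0 Pk]]] := orient_frame p.
have uinc := frame_increasing FP vf fp.
have [VV w0] := increasing_touch_past FP uinc gV psip (or_intror near_psi).
have XV : 0 < ip g p (orient p) V.
  by move: w0; rewrite (orient_frame_sign V k0 Pk) pmulr_rgt0.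
split => //.
have VV1 : ip g p V V = -1.
  apply/eqP; rewrite eq_le VV; have [_ /(_ p)[_ H]] := vf; exact: H.
have VN : ip g p (- V) (- V) = -1 by rewrite ipNr ipC ipNr opprK.
have [P' frameP' P'e] := adapted_frame VN.
have FP' : future_frame p P'.
  by split => //; rewrite P'e ipNr; lra.
have covV : covector p P' V = e0.
  have -> : V = - (e0 *m P') by rewrite P'e opprK.
  rewrite /covector -!mulNmx -!mulmxA (mulmxA P') frameP'.
  apply/rowP => i; rewrite mul_mx_diag !mxE.
  by rewrite eqxx; case: (i == 0); rewrite /= ?mulr0n ?mulr1n ?oppr0 ?mul0r ?mulN1r ?opprK.
have [r r0 Hr] := frame_past FP' vf fp.
have gu := gradient_param P' gV; rewrite covV in gu.
have near_u := near_param0 P' near_psi.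
have gf : has_gradient (f \o param p P') 0 e0.
  apply: (@differentiable_at_subgradient _ _ (cometric p P') (f \o param p P') r) => //.
  - exact: cometric_near_minkowski.
  - exact: frame_increasing.
  - by move=> y /Hr[yd _]; exact: frame_continuous.
  - by move=> y a /Hr[yd _]; exact: frame_sub.
  - move=> d d0; have [r1 r10 H1] := gradient_eps gu d0.
    have [r2 r20 H2] := near0_eps near_u.
    exists (Num.min r1 r2); first by rewrite lt_min r10.
    move=> y; rewrite lt_min => /andP[yr1 yr2].
    have := H2 y yr2; have := H1 y yr1.
    rewrite /= param0 psip dot_e0 ler_norml => /andP[+ _].
    by clear; lra.
have := gradient_param_inv frameP' gf.
by rewrite -covV vectorK.
Qed.

End OneSpacetime.

End Oriented.

(** * From limiting gradients to supergradients; the minimum *)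

Section Propagation.
Context {R : realType} {n : nat}.
Local Notation E := 'rV[R]_n.+1.
Local Notation e0 := (delta_mx 0 0 : E).

(** Near p, f is differentiable at some point q, with past-directed gradient V,
    and V is a limiting gradient at q: points with subgradients accumulate at q,
    their subgradients are gradients, and they can be taken close to V. *)
Lemma past_near_not_future (M : spacetime R n) (f : M -> R) (p : M) :
  viscosity_solution f -> super_past_near f p -> ~ future_oriented f.
Proof.
move=> vf fp ff.
have [P0 [FP0 _]] := orient_frame p.
have [r0 r00 H0] := param_dom_ball p P0.
have [r1 r10 H1] := near0_eps (near_param0 P0 (super_past_near_near fp)).
have r01 : 0 < Num.min r0 r1 by rewrite lt_min r00.
have [|z0 [a0 [z0r uz0]]] := exists_touched_below (u := f \o param p P0) r01.
  by move=> y; rewrite lt_min => /andP[/H0 yd _]; exact: frame_continuous.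
move: z0r; rewrite lt_min => /andP[/H0 zd0 /H1 fp'].
have fV := touched_below_sub FP0.1 zd0 uz0.
move: (param p P0 z0) (vector_of_covector _ _ _ _) fp' fV => q V fq fV.
have [gV XV] := differentiable_at_subgradient_past vf fq fV.
have [P [FP _]] := orient_frame q.
have frameP := FP.1.
have gu := gradient_param P gV.
have [r2 r20 H2] := param_dom_ball q P.
have [r3 r30 H3] := near0_eps (near_param0 P (super_past_near_near fq)).
(* Points z tending to 0, with subgradients tending to the differential of f. *)
have key k : exists zb : E * E, [/\ zb.1 != 0, `|zb.1| < Num.min r2 r3, `|zb.1| <= k.+1%:R^-1,
    touched_below (f \o param q P) zb.1 zb.2 & `|zb.2 - covector q P V| <= k.+1%:R^-1].
  pose e : R := Num.min (Num.min r2 r3) k.+1%:R^-1.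
  have e_gt0 : 0 < e by rewrite !lt_min r20 r30 invr_gt0 ltr0n.
  have cu y : `|y| < r2 -> {for y, continuous (f \o param q P)}.
    by move=> /H2 yd; exact: frame_continuous.
  have [z [b [z0' ze uz be]]] := touched_below_near_gradient r20 cu gu e_gt0.
  exists (z, b); split => //=.
  - by apply: lt_le_trans ze _; rewrite ge_min lexx.
  - by apply/ltW/(lt_le_trans ze); rewrite ge_min lexx orbT.
  - by apply: le_trans be _; rewrite ge_min lexx orbT.
have [zb Hzb] := choice key.
pose z k := (zb k).1; pose b k := (zb k).2.
have inv0 : (k.+1%:R^-1 : R) @[k --> \oo] --> (0 : R) by exact: cvg_harmonic.
have zd k : param_dom q P (z k).
  by have [_ + _ _ _] := Hzb k; rewrite lt_min => /andP[/H2].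
have cz : z k @[k --> \oo] --> (0 : E).
  apply/cvgr0Pnorm_le => e e_gt0.
  move/cvgr0Pnorm_le: inv0 => /(_ e e_gt0); apply: filterS => k ke.
  have [_ _ + _ _] := Hzb k; move=> /le_trans; apply.
  by apply: le_trans ke; exact: ler_norm.
have cb : b k @[k --> \oo] --> covector q P V.
  apply/cvgrPdistC_le => e e_gt0.
  move/cvgr0Pnorm_le: inv0 => /(_ e e_gt0); apply: filterS => k ke.
  have [_ _ _ _] := Hzb k; move=> /le_trans; apply.
  by apply: le_trans ke; exact: ler_norm.
pose qk k := param q P (z k); pose vk k := vector_of_covector q P (z k) (b k).
have lim : limiting_gradient f q V.
  exists qk, vk; split.
  - move=> k qE; have [/eqP z0' _ _ _ _] := Hzb k; apply: z0'.
    have Pu := frame_unit frameP.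
    by rewrite -/(z k) -(paramK Pu (zd k)) -/(qk k) qE -[X in coordf _ _ X](param0 q P)
      paramK//; exact: param_dom0.
  - move=> k; have [_ + _ ub _] := Hzb k; rewrite lt_min => /andP[_ /H3 fqk].
    have := touched_below_sub frameP (zd k) ub => fk.
    by have [] := differentiable_at_subgradient_past vf fqk fk.
  split.
    have cp := param_continuous (param_dom0 q P).
    rewrite /prop_for /continuous_at param0 in cp.
    exact: (@cvg_comp _ _ _ z (param q P) _ _ _ cz cp).
  have Hk : (fun k => tcoord (at_ q) (qk k) (vk k)) =
     (fun k => b k *m invmx (gram q P (@metric R n M) (z k)) *m P).
    by apply/funext => k; rewrite tcoord_frame//; exact: dom_param.
  rewrite Hk -(vectorK frameP V).
  have cK := @cvg_comp _ _ _ z (fun y => invmx (gram q P (@metric R n M) y)) _ _ _ cz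
    (cvg_cometric_mx frameP).
  have cP : (fun _ : nat => P : 'M[R]_n.+1) @ \oo --> P by exact: cvg_cst.
  exact: cvg_mulmx (cvg_mulmx cb cK) cP.
have [_ [_ ]] := ff q V lim.
by rewrite ltNge (ltW XV).
Qed.

Lemma time_reverse_field (M : spacetime R n) : continuous_field (fun p : M => - orient p).
Proof.
move=> p; have [c1 c2] := orient_continuous (s := M) p; split; first exact: c1.
have H : (fun q : M => tcoord (at_ p) q (- orient q)) = (fun q => - tcoord (at_ p) q (orient q)).
  by apply/funext => q; rewrite /tcoord linearN.
rewrite H; exact: cvgN.
Qed.

Lemma time_reverse_timelike (M : spacetime R n) (p : M) :
  ip (@metric R n M) p (- orient p) (- orient p) < 0.
Proof. by rewrite ipNr ipC ipNr opprK; exact: orient_timelike. Qed.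

(** Past and future are exchanged, while gradients and solutions are unchanged. *)
Definition time_reverse (M : spacetime R n) : spacetime R n :=
  @Spacetime R n M (@metric R n M) (fun p => - orient p) (st_connected (s := M))
    (metric_lorentzian M) (@time_reverse_field M) (@time_reverse_timelike M).

Lemma ip_time_reverse (M : spacetime R n) (p : M) (V : E) :
  ip (@metric R n (time_reverse M)) p (@orient R n (time_reverse M) p) V =
  - ip (@metric R n M) p (orient p) V.
Proof. by rewrite /= [LHS](ipC (M := M)) ipNr (ipC (M := M)). Qed.

Lemma past_oriented_reverse (M : spacetime R n) (f : M -> R) :
  past_oriented f -> @future_oriented R n (time_reverse M) f.
Proof.
move=> pf x V fV; have [tV [cV XV]] := pf x V fV.
split; first exact: tV.
split; first exact: cV.
by rewrite ip_time_reverse oppr_lt0.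
Qed.

Lemma future_oriented_reverse (M : spacetime R n) (f : M -> R) :
  future_oriented f -> @past_oriented R n (time_reverse M) f.
Proof.
move=> pf x V fV; have [tV [cV XV]] := pf x V fV.
split; first exact: tV.
split; first exact: cV.
by rewrite ip_time_reverse oppr_gt0.
Qed.

Lemma near_coordf (M : manifold R n) (p : M) (P : 'M[R]_n.+1) (Q : E -> Prop) : P \in unitmx ->
  (\forall y \near (0 : E), Q y) -> \forall q \near p, dom (at_ p) q /\ Q (coordf p P q).
Proof.
move=> Pu HQ; apply: filterI.
  by apply: open_nbhs_nbhs; split; [exact: dom_open|exact: at_dom].
have cc := continuous_comp (cmap_cvg (at_dom p)) (@affinv_continuous _ _ _ p P (cmap (at_ p) p)).
have c0 : coordf p P p = 0.
  by rewrite -{2}(param0 p P) paramK//; exact: param_dom0.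
have HQ0 : nbhs (coordf p P p) Q by rewrite c0.
exact: (cc _ HQ0).
Qed.

(** [touched_above_future] applies since a covector without time component is
    spacelike for all metrics close to the Minkowski metric, so that it cannot be
    that of a supergradient. *)
Lemma future_supergradient_near (M : spacetime R n) (f : M -> R) (p : M) (V : E) :
  viscosity_solution f -> supergradient f p V -> ip (@metric R n M) p (orient p) V < 0 ->
  @super_past_near R n (time_reverse M) f p.
Proof.
move=> vf [ O [psi [[oO Op] C1 psip fpsi gV]]] XV.
have [P [FP [k k0 Pk]]] := orient_frame p.
have frameP := FP.1; have Pu := frame_unit frameP.
have gu := gradient_param P gV.
have w0 : (covector p P V) 0 0 < 0 by rewrite (orient_frame_sign V k0 Pk) pmulr_rlt0.
have half0 : (0 : R) < 2^-1 by rewrite invr_gt0.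
have [r1 r10 H1] := param_dom_ball p P.
have [r2 r20 H2] := cometric_near_minkowski frameP half0.
have [r3 r30 H3] := sign_near FP.
pose r := Num.min r1 r2.
have r0 : 0 < r by rewrite lt_min r10.
have cu y : `|y| < r -> {for y, continuous (f \o param p P)}.
  by rewrite lt_min => /andP[/H1 yd _]; exact: frame_continuous.
have nz y b : `|y| < r -> touched_above (f \o param p P) y b -> b 0 0 != 0.
  rewrite lt_min => /andP[/H1 yd yr2] ub; apply/eqP => b0.
  have := frame_super FP vf yd ub; have := H2 y b yr2.
  rewrite /mink /dot b0 mulr0 oppr0 !add0r ler_norml => /andP[+ _].
  by have := sdot_ge0 b; clear; lra.
have psi0 : (psi \o param p P) 0 = (f \o param p P) 0 by rewrite /= param0.
have near_f : \forall y \near (0 : E), (f \o param p P) y <= (psi \o param p P) y.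
  apply: (near_param0 P (Q := fun q => f q <= psi q)).
  by apply: filterS (open_nbhs_nbhs (conj oO Op)) => q; exact: fpsi.
have [s s0 Hs] := touched_above_future r0 cu nz gu psi0 near_f w0.
have near_small : \forall y \near (0 : E), `|y| < Num.min r1 (Num.min r3 s).
  apply/nbhs_ballP; exists (Num.min r1 (Num.min r3 s)) => /=.
    by rewrite !lt_min r10 r30.
  by move=> y; rewrite -ball_normE /= sub0r normrN.
have nearq := @near_coordf M p P (fun y => `|y| < _) Pu near_small.
apply: (@filterS M (nbhs p) _ _ _ _ nearq) => q [pq]; rewrite !lt_min => /andP[/H1 yd /andP[yr3 ys]].
rewrite -(coordfK Pu pq) => W.
move: (coordf p P q) yd yr3 ys => y yd yr3 ys fW.
have [a ua ->] := super_touched_above frameP yd fW.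
rewrite ip_time_reverse oppr_gt0 ip_orient_covector//.
have := H3 y a yr3 (frame_super FP vf yd ua).
by rewrite nmulr_rgt0//; exact: Hs ua.
Qed.

(** Otherwise the supergradients near p would be future-directed, so that, after
    time reversal, limiting gradients of the wrong orientation would exist. *)
Lemma supergradient_past (M : spacetime R n) (f : M -> R) (p : M) (V : E) :
  viscosity_solution f -> past_oriented f -> supergradient f p V ->
  0 < ip (@metric R n M) p (orient p) V.
Proof.
move=> vf pf fV.
have VV : ip (@metric R n M) p V V <= -1 by have [_ /(_ p)[+ _]] := vf; apply.
have [//|XV] := orient_sign VV; exfalso.
have fp := future_supergradient_near vf fV XV.
exact: (@past_near_not_future (time_reverse M) f p vf fp (past_oriented_reverse pf)).
Qed.

Lemma flat_increasing_min (u v : E -> R) : flat_increasing u -> flat_increasing v ->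
  flat_increasing (fun y => Num.min (u y) (v y)).
Proof.
move=> Hu Hv e e01; have [r1 r10 H1] := Hu e e01; have [r2 r20 H2] := Hv e e01.
exists (Num.min r1 r2); first by rewrite lt_min r10.
move=> z w c; rewrite !lt_min => /andP[z1 z2] /andP[w1 w2] w0 c0 cw.
have A := H1 z w c z1 w1 w0 c0 cw; have B := H2 z w c z2 w2 w0 c0 cw.
rewrite le_min; apply/andP; split.
  by apply: le_trans A; rewrite lerD2r ge_min lexx.
by apply: le_trans B; rewrite lerD2r ge_min lexx orbT.
Qed.

(** The growth of both functions passes to their minimum, and growth controls the
    functions touching it from above. *)
Lemma min_viscosity_past (M : spacetime R n) (f1 f2 : M -> R) :
  viscosity_solution f1 -> viscosity_solution f2 -> past_oriented f1 -> past_oriented f2 ->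
  viscosity_solution (fun p => Num.min (f1 p) (f2 p)).
Proof.
move=> vf1 vf2 pf1 pf2; split.
  by move=> p; exact: (continuous_min (vf1.1 p) (vf2.1 p)).
move=> p; split => V [ O [psi [oOp C1 psip fpsi gV]]].
  have [P [FP _]] := orient_frame p.
  have i1 : flat_increasing (f1 \o param p P).
    by apply: frame_increasing => //; apply: nearW => q W; exact: supergradient_past.
  have i2 : flat_increasing (f2 \o param p P).
    by apply: frame_increasing => //; apply: nearW => q W; exact: supergradient_past.
  have nf : \forall q \near p, Num.min (f1 q) (f2 q) <= psi q.
    by apply: filterS (open_nbhs_nbhs oOp) => q; exact: fpsi.
  by have [] := increasing_touch_past FP (flat_increasing_min i1 i2) gV psip (or_introl nf).
have [le|/ltW le] := leP (f1 p) (f2 p).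
  have [_ /(_ p)[_ ]] := vf1; apply; exists O, psi; split => //.
    by rewrite psip; exact/min_idPl.
  by move=> q Oq; apply: le_trans (fpsi q Oq) _; rewrite ge_min lexx.
have [_ /(_ p)[_ ]] := vf2; apply; exists O, psi; split => //.
  by rewrite psip; exact/min_idPr.
by move=> q Oq; apply: le_trans (fpsi q Oq) _; rewrite ge_min lexx orbT.
Qed.

End Propagation.

(** * The maximum *)

Section Maximum.
Context {R : realType} {n : nat}.
Local Notation E := 'rV[R]_n.+1.
Local Notation e0 := (delta_mx 0 0 : E).

(** All frames are considered because the relevant one is adapted to the
    subgradient under study. *)
Definition chart_lipschitz (M : manifold R n) (f : M -> R) (p : M) :=
  forall P : 'M[R]_n.+1, P \in unitmx -> exists r L : R, [/\ 0 < r, 0 <= L &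
    forall y z, `|y| < r -> `|z| < r ->
      `|f (param p P y) - f (param p P z)| <= L * `|y - z|].

(** The frame -P points to the past for the given orientation, hence to the future
    for the reversed one, and has coordinates -y. *)
Lemma frame_decreasing (M : spacetime R n) (f : M -> R) (p : M) (P : 'M[R]_n.+1) :
  viscosity_solution f -> @super_past_near R n (time_reverse M) f p -> future_frame p P ->
  exists2 u, flat_increasing u & forall y, f (param p P y) = u (- y).
Proof.
move=> vf fp [frameP XP]; exists (f \o @param R n (time_reverse M) p (- P)); last first.
  by move=> y; rewrite /= /param /aff mulmxN mulNmx opprK.
apply: (@frame_increasing R n (time_reverse M)) => //; split.
  by rewrite /orthonormal_frame mulNmx mulNmx linearN mulmxN opprK.
by rewrite ip_time_reverse oppr_lt0 mulmxN ipNr oppr_gt0.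
Qed.

(** The frame whose first vector is the future-directed unit vector proportional
    to V. *)
Lemma scaled_frame (M : spacetime R n) (p : M) (V : E) : ip (@metric R n M) p V V < -1 ->
  0 < ip (@metric R n M) p (orient p) V ->
  exists P lam, [/\ future_frame p P, 1 < lam & covector p P V = lam *: e0].
Proof.
move=> VV XV; have VV0 : ip (@metric R n M) p V V < 0 by lra.
have [k k0 kV] := normalize_timelike VV0.
have kV' : ip (@metric R n M) p (- (k *: V)) (- (k *: V)) = -1 by rewrite ipNr ipC ipNr opprK.
have [P frameP PV] := adapted_frame kV'.
exists P, k^-1; split.
- by split => //; rewrite PV ipNr ipZr oppr_lt0; exact: mulr_gt0.
- rewrite invf_gt1//.
  have : k * k * ip (@metric R n M) p V V = -1.
    by rewrite -kV ipZr ipC ipZr mulrA.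
  have := mulr_gt0 k0 k0; move: k0 VV; clear; move: (ip _ _ _ _) => x; nra.
have -> : V = - k^-1 *: (e0 *m P).
  by rewrite PV scaleNr scalerN opprK scalerA mulVf ?scale1r// gt_eqF.
rewrite /covector -scalemxAl -scalemxAl -!mulmxA (mulmxA P) frameP.
rewrite scaleNr -scalerN; congr (_ *: _).
apply/rowP => i; rewrite mul_mx_diag !mxE.
by case: (i == 0); rewrite eqxx /= ?mul1r ?opprK// mulr1 oppr0.
Qed.

(** On the cones narrower than the light cone f1 increases and f2 decreases from
    their common value, so that the maximum is f1, which is therefore too steep
    there. *)
Lemma max_subgradient_past (M : spacetime R n) (f1 f2 : M -> R) (p : M) (V : E) :
  viscosity_solution f1 -> viscosity_solution f2 ->
  super_past_near f1 p -> @super_past_near R n (time_reverse M) f2 p ->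
  chart_lipschitz f1 p -> f1 p = f2 p ->
  subgradient (fun q => Num.max (f1 q) (f2 q)) p V ->
  0 < ip (@metric R n M) p (orient p) V ->
  -1 <= ip (@metric R n M) p V V.
Proof.
move=> vf1 vf2 p1 p2 lip f12 [ O [psi [[oO Op] C1 psip psif gV]]] XV.
rewrite leNgt; apply/negP => VV.
have [P [lam [FP lam1 covV]]] := scaled_frame VV XV.
have [frameP _] := FP; have Pu := frame_unit frameP.
have i1 := frame_increasing FP vf1 p1.
have [u2 i2 u2E] := frame_decreasing vf2 p2 FP.
have gu := gradient_param P gV; rewrite covV in gu.
have [r0 [L [r00 L0 Hlip]]] := lip P Pu.
have [r1 r10 H1] := param_dom_ball p P.
have near_psi : \forall y \near (0 : E),
    psi (param p P y) <= Num.max (f1 (param p P y)) (f2 (param p P y)).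
  apply: (near_param0 P (Q := fun q => psi q <= Num.max (f1 q) (f2 q))).
  by apply: filterS (open_nbhs_nbhs (conj oO Op)) => q; exact: psif.
have [r2 r20 H2] := near0_eps near_psi.
pose d := (lam - 1) / 4; have d0 : 0 < d by rewrite /d; lra.
have [r3 r30 H3] := gradient_eps gu d0.
pose r := Num.min r0 r1; have r_gt0 : 0 < r by rewrite lt_min r00.
have rr0 y : `|y| < r -> `|y| < r0 by rewrite lt_min => /andP[].
have rr1 y : `|y| < r -> param_dom p P y by rewrite lt_min => /andP[_ /H1].
apply: (@steep_on_cone_false _ _ (cometric p P) (f1 \o param p P) ((1 + lam) / 2) L r) => //.
- exact: cometric_near_minkowski.
- lra.
- by move=> y z /rr0 yr /rr0 zr; exact: Hlip.
- by move=> y /rr1 yd; exact: frame_continuous.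
- by move=> y a /rr1 yd; exact: frame_sub.
move=> c /andP[c0 c1].
(* With this loss the cone of aperture c is contained in the region where growth
   applies, with a vanishing lower bound. *)
pose e := (1 - c ^+ 2) / 4.
have c2 : c ^+ 2 < 1 by rewrite expr_lt1// ltW.
have c20 : 0 < c ^+ 2 by exact: exprn_gt0.
have e01 : 0 < e < 1 by rewrite /e; apply/andP; split; lra.
have /andP[e_gt0 e_lt1] := e01.
have ee : c ^+ 2 / (1 - e) <= 1 / (1 + e).
  rewrite ler_pdivrMr; last lra.
  rewrite mulrAC ler_pdivlMr; last lra.
  by rewrite /e; move: c2 c20; clear; move: (c ^+ 2) => x x1 x0; nra.
have [s1 s10 I1] := i1 e e01; have [s2 s20 I2] := i2 e e01.
exists (Num.min (Num.min r2 r3) (Num.min s1 s2)); first by rewrite !lt_min r20 r30 s10 s20.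
move=> z; rewrite !lt_min => /andP[/andP[z2 z3] /andP[zs1 zs2]] z00 zc.
have cone : 0 ^+ 2 <= z 0 0 ^+ 2 / (1 + e) - sdot z z / (1 - e).
  rewrite expr0n/= subr_ge0.
  apply: (@le_trans _ _ ((c * z 0 0) ^+ 2 / (1 - e))).
    by rewrite ler_pM2r// invr_gt0; lra.
  rewrite exprMn mulrAC [leRHS]mulrC -[(1 + e)^-1]mul1r.
  by rewrite ler_wpM2r// sqr_ge0.
(* On the cone, z is controlled by its time coordinate, so that the error term of
   psi is absorbed by lowering the slope from lam to (1 + lam) / 2. *)
have znorm : `|z| <= 2 * z 0 0.
  rewrite -(@ler_pXn2r _ 2)// ?nnegrE// ?mulr_ge0//.
  apply: le_trans (norm_sq_le_dot z) _; rewrite /dot.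
  have : (c * z 0 0) ^+ 2 <= z 0 0 ^+ 2.
    by rewrite exprMn -[leRHS]mul1r ler_wpM2r ?sqr_ge0// ltW.
  by move: zc; rewrite !expr2; clear; have := sqr_ge0 (z 0 0); rewrite expr2; lra.
have [z0|z0] := eqVneq (z 0 0) 0.
  have -> : z = 0 by apply/eqP; rewrite -normr_le0; move: znorm; rewrite z0 mulr0.
  by rewrite mxE mulr0 addr0.
have zpos : 0 < z 0 0 by rewrite lt_neqAle eq_sym z0.
have n0 (s : R) : 0 < s -> `|0 : E| < s by rewrite normr0.
have up1 : f1 p <= f1 (param p P z).
  have := I1 0 z 0 (n0 _ s10); rewrite add0r addr0 /= param0; exact.
have down2 : f2 (param p P z) <= f2 p.
  rewrite u2E -[X in _ <= f2 X](param0 p P) u2E oppr0.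
  have := I2 (- z) z 0; rewrite normrN addNr addr0; apply => //.
  exact: n0.
have := H2 z z2; rewrite (max_idPl _); last by apply: le_trans down2 _; rewrite -f12.
have := H3 z z3; rewrite /= param0 psip -f12 maxxx.
have -> : dot (lam *: e0) z = lam * z 0 0 by rewrite dotE -scalemxAl mxE -dotE dot_e0.
rewrite ler_norml => /andP[lo _] hi.
have dz : d * `|z| <= d * (2 * z 0 0) by rewrite ler_pM2l.
by move: lo hi dz; rewrite /d; clear; move: `|z| (psi _) (f1 _) (f1 p) => *; lra.
Qed.

Lemma C1_on_sub (M : manifold R n) (O O' : set M) (psi : M -> R) :
  O' `<=` O -> C1_on O psi -> C1_on O' psi.
Proof.
move=> sO Cp p; have [C1 C2] := Cp p.
have s x : (cmap (at_ p) @` (dom (at_ p) `&` O')) x -> (cmap (at_ p) @` (dom (at_ p) `&` O)) x.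
  by move=> [q [pq Oq] <-]; exists q => //; split => //; exact: sO.
by split; [move=> x /s; exact: C1|move=> i x /s; exact: C2].
Qed.

(** Where f is the larger function, the maximum coincides with f nearby. *)
Lemma subgradient_local (M : spacetime R n) (f f' : M -> R) (p : M) (V : E) :
  continuous f -> continuous f' -> f' p < f p ->
  subgradient (fun q => Num.max (f q) (f' q)) p V -> subgradient f p V.
Proof.
move=> cf cf' lt [ O [psi [[oO Op] C1 psip psif gV]]].
pose O' := O `&` [set q | f' q < f q].
exists O', psi; split.
- split; last by split.
  apply: openI => //.
  have -> : [set q | f' q < f q] = [set q | 0 < f q - f' q].
    by apply/seteqP; split => q; rewrite /= subr_gt0.
  apply: (open_comp _ (@open_gt R 0)) => q _.
  exact: (@continuousB R R^o M f f' q (cf q) (cf' q)).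
- by apply: C1_on_sub C1; exact: subIsetl.
- by rewrite psip; apply/max_idPl; exact: ltW.
- by move=> q [Oq lq]; have := psif q Oq; rewrite (max_idPl _)// ltW.
- exact: gV.
Qed.

Lemma super_past_near_of_past (M : spacetime R n) (f : M -> R) (p : M) :
  viscosity_solution f -> past_oriented f -> super_past_near f p.
Proof. by move=> vf pf; apply: nearW => q V; exact: supergradient_past. Qed.

Lemma super_future_near_of_future (M : spacetime R n) (f : M -> R) (p : M) :
  viscosity_solution f -> future_oriented f -> @super_past_near R n (time_reverse M) f p.
Proof.
move=> vf ff.
exact: (@super_past_near_of_past (time_reverse M) f p vf (future_oriented_reverse ff)).
Qed.

(** At a point where both functions agree, a subgradient violating the inequality
    is timelike, and which of the two functions it contradicts depends on its time
    orientation. *)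
Lemma max_viscosity (M : spacetime R n) (f1 f2 : M -> R) :
  viscosity_solution f1 -> viscosity_solution f2 -> past_oriented f1 -> future_oriented f2 ->
  (forall p, chart_lipschitz f1 p) -> (forall p, chart_lipschitz f2 p) ->
  viscosity_solution (fun p => Num.max (f1 p) (f2 p)).
Proof.
move=> vf1 vf2 pf1 ff2 lip1 lip2; split.
  by move=> p; exact: (continuous_max (vf1.1 p) (vf2.1 p)).
move=> p; split => V.
  move=> [ O [psi [oOp C1 psip fpsi gV]]].
  have [le|/ltW le] := leP (f1 p) (f2 p).
    have [_ /(_ p)[+ _]] := vf2; apply; exists O, psi; split => //.
      by rewrite psip; exact/max_idPr.
    by move=> q Oq; apply: le_trans (fpsi q Oq); rewrite le_max lexx orbT.
  have [_ /(_ p)[+ _]] := vf1; apply; exists O, psi; split => //.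
    by rewrite psip; exact/max_idPl.
  by move=> q Oq; apply: le_trans (fpsi q Oq); rewrite le_max lexx.
move=> sV; have [lt|lt|eq12] := ltgtP (f1 p) (f2 p).
- have [_ /(_ p)[_ ]] := vf2; apply; apply: (subgradient_local vf2.1 vf1.1 lt).
  have maxC : (fun q => Num.max (f2 q) (f1 q)) = (fun q => Num.max (f1 q) (f2 q)).
    by apply/funext => q; rewrite maxC.
  exact: (eq_ind_r (fun f => subgradient f p V) sV maxC).
- by have [_ /(_ p)[_ ]] := vf1; apply; exact: (subgradient_local vf1.1 vf2.1 lt sV).
rewrite leNgt; apply/negP => VV; have := VV; rewrite ltNge => /negP; apply.
have p1 := super_past_near_of_past p vf1 pf1.
have p2 := super_future_near_of_future p vf2 ff2.
have [XV|XV] := orient_sign (ltW VV).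
  exact: (max_subgradient_past vf1 vf2 p1 p2 (lip1 p) eq12 sV XV).
have maxC : (fun q => Num.max (f2 q) (f1 q)) = (fun q => Num.max (f1 q) (f2 q)).
  by apply/funext => q; rewrite maxC.
apply: (@max_subgradient_past (time_reverse M) f2 f1 p V vf2 vf1 p2 _ (lip2 p) (esym eq12)).
- have rr : super_past_near f1 p := p1.
  apply: filterS rr => q H W /H; rewrite ip_time_reverse.
  by rewrite ip_time_reverse opprK.
- exact: (eq_ind_r (fun f => subgradient f p V) sV maxC).
- by rewrite ip_time_reverse oppr_gt0.
Qed.

End Maximum.

(** * Riemannian distance and coordinate distance *)

Section RiemannianDistance.
Context {R : realType} {n : nat} (M : manifold R n) (h : M -> 'M[R]_n.+1).
Local Notation E := 'rV[R]_n.+1.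
Implicit Types (p q : M) (P : 'M[R]_n.+1) (v y z : E) (f : M -> R).

Lemma curve_length_ge0 gam k t w : 0 <= curve_length h gam k t w.
Proof. by apply: sumr_ge0 => i _; apply: Rintegral_ge0 => r _; exact: sqrtr_ge0. Qed.

Lemma rdist_ge0 p q : 0 <= rdist h p q.
Proof.
rewrite /rdist; set A := (X in inf X).
have [->|/set0P A0] := eqVneq A set0; first by rewrite inf0.
apply: lb_le_inf => // l [gam [a [b [k [t [w [_ _ _ ->]]]]]]].
exact: curve_length_ge0.
Qed.

(** The lengths of curves being nonnegative, the infimum is at most the length of
    any given curve. *)
Lemma rdist_le_length (gam : R -> M) (w : R -> E) : C1_curve gam w 0 1 ->
  rdist h (gam 0) (gam 1) <=
  \int[lebesgue_measure]_(r in [set` `[0, 1]]) Num.sqrt (ip h (gam r) (w r) (w r)).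
Proof.
move=> Cg; apply: ge_inf.
  by exists 0 => l [g [a [b [k [t [w' [_ _ _ ->]]]]]]]; exact: curve_length_ge0.
exists gam, 0, 1, 1%N, (fun i => i%:R), (fun=> w); split => //.
  by split => // -[|//] _; split => //; exact: ltr01.
by rewrite /curve_length big_ord1.
Qed.

Section Segment.
Variables (p : M) (P : 'M[R]_n.+1) (y v : E).
Let gam t := param p P (y + t *: v).
Let vel t := v *m frame_mx p P (gam t).

Lemma segment_velocity r : param_dom p P (y + r *: v) -> let c := at_ (gam r) in
  (u - r)^-1 *: (cmap c (gam u) - cmap c (gam r)) @[u --> r^'] --> vel r.
Proof.
move=> yr c.
have pr : dom (at_ p) (gam r) := dom_param yr.
have px : trans_dom p (gam r) (aff p P (y + r *: v)).
  by rewrite -cmap_param//; apply: trans_dom_at => //; exact: at_dom.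
have dt := differentiable_trans px.
have -> : vel r = 'd (trans p (gam r)) (aff p P (y + r *: v)) (v *m P).
  by rewrite /vel -tvec_frame /tvec cmap_param.
have D : k^-1 *: ((trans p (gam r) \o shift (aff p P (y + r *: v))) (k *: (v *m P)) -
    trans p (gam r) (aff p P (y + r *: v))) @[k --> 0^'] -->
    'D_(v *m P) (trans p (gam r)) (aff p P (y + r *: v)) := diff_derivable dt.
have sub0 : u - r @[u --> r^'] --> (0 : R)^'.
  have -> : (0 : R)^' = (r - r)^' by rewrite subrr.
  apply: (@continuous_injective_withinNx _ _ (fun u : R => u - r)) => [|u].
    by apply: (@continuousB R R^o R^o id (fun=> r)); [exact: cvg_id|exact: cst_continuous].
  by move=> /addIr.
rewrite deriveE// in D.
have D' := cvg_comp _ _ sub0 D.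
have FE : (fun u => (u - r)^-1 *: (cmap c (gam u) - cmap c (gam r))) =
    (fun k => k^-1 *: ((trans p (gam r) \o shift (aff p P (y + r *: v))) (k *: (v *m P)) -
    trans p (gam r) (aff p P (y + r *: v)))) \o (fun u => u - r).
  apply/funext => u /=; congr (_ *: (_ - _)).
  have -> : (u - r) *: (v *m P) + aff p P (y + r *: v) = aff p P (y + u *: v).
    rewrite /aff !mulmxDl -!scalemxAl; move: (cmap _ p) (y *m P) (v *m P) => a b w.
    by apply/rowP => i; rewrite !mxE; ring.
  by [].
by rewrite FE.
Qed.

Lemma segment_continuous r : param_dom p P (y + r *: v) -> {for r, continuous gam}.
Proof.
move=> yr; have cs : {for r, continuous (fun t : R => y + t *: v)}.
  by apply: cvgD; [exact: cvg_cst|apply: cvgZr_tmp; exact: cvg_id].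
exact: continuous_comp cs (param_continuous yr).
Qed.

Lemma segment_tangent_cvg r : param_dom p P (y + r *: v) ->
  tangent_cvg (nbhs r) gam vel (gam r) (vel r).
Proof.
move=> yr; split; first exact: segment_continuous.
have pr : dom (at_ p) (gam r) := dom_param yr.
have px : trans_dom p (gam r) (cmap (at_ p) (gam r)) by apply: trans_dom_at => //; exact: at_dom.
have near_r : \forall t \near r, dom (at_ p) (gam t) /\ dom (at_ (gam r)) (gam t).
  have O : nbhs (gam r) (dom (at_ p) `&` dom (at_ (gam r))).
    apply: open_nbhs_nbhs; split; first by apply: openI; exact: dom_open.
    by split => //; exact: at_dom.
  exact: (segment_continuous yr O).
have cg := segment_continuous yr.
have cm := continuous_comp cg (cmap_cvg pr).
have cv : (fun _ : R => v *m P) @ nbhs r --> v *m P by exact: cvg_cst.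
have C := @cvg_dtrans R n M p (gam r) _ _ R (nbhs r) _ _ _ px cm cv.
rewrite {2}/vel -tvec_frame.
apply: cvg_trans (C _); apply: near_eq_cvg.
apply: filterS near_r => t [pt rt].
by rewrite /vel -tvec_frame; apply/esym/dtrans_at => //; exact: at_dom.
Qed.

(** A segment in coordinates is a curve of class C^1 whose velocity is constant in
    the coordinate frame. *)
Lemma segment_C1 : (forall t, 0 <= t <= 1 -> param_dom p P (y + t *: v)) -> C1_curve gam vel 0 1.
Proof.
move=> yd r; rewrite in_itv/= => /yd yr; split.
  by apply: cvg_trans (segment_velocity yr); apply: cvg_app; exact: cvg_within.
have [t1 t2] := segment_tangent_cvg yr; split.
  by apply: cvg_trans t1; apply: cvg_app; exact: cvg_within.
by apply: cvg_trans t2; apply: cvg_app; exact: cvg_within.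
Qed.

End Segment.

Section Local.
Variables (p : M) (P : 'M[R]_n.+1).
Hypothesis h_smooth : smooth_form h.

Lemma segment_speed_continuous y v t : param_dom p P (y + t *: v) ->
  {for t, continuous (fun t : R => Num.sqrt ((v *m gram p P h (y + t *: v) *m v^T) 0 0))}.
Proof.
move=> yt; have cs : {for t, continuous (fun t : R => y + t *: v)}.
  by apply: cvgD; [exact: cvg_cst|apply: cvgZr_tmp; exact: cvg_id].
have cg := continuous_comp cs (gram_continuous h_smooth yt).
have cv : (fun _ : R => v) @ nbhs t --> v by exact: cvg_cst.
have cvT : (fun _ : R => v^T) @ nbhs t --> v^T by exact: cvg_cst.
have cq := @cvg_mx_entry _ _ _ _ _ _ _ 0 0 (cvg_mulmx (cvg_mulmx cv cg) cvT).
exact: (continuous_comp (f := fun t : R => (v *m gram p P h (y + t *: v) *m v^T) 0 0) (cq _ _)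
  (@sqrt_continuous R _)).
Qed.

Lemma dot_le_norm_sq v : dot v v <= n.+1%:R * `|v| ^+ 2.
Proof.
rewrite dotE mxE.
apply: (@le_trans _ _ (\sum_(i < n.+1) `|v| ^+ 2)); last by rewrite sumr_const card_ord mulr_natl.
apply: ler_sum => i _; rewrite mxE -expr2 -real_normK ?num_real//.
by rewrite ler_pXn2r ?nnegrE// coord_le_norm.
Qed.

(** The integrand of the length of the segment is bounded by a multiple of the
    length of the coordinate vector, as the Gram matrix of h is bounded. *)
Lemma rdist_segment r C y z : (forall x, `|x| < r -> param_dom p P x /\ `|gram p P h x| <= C) ->
  `|y| < r -> `|z| < r ->
  rdist h (param p P y) (param p P z) <=
  Num.sqrt (n.+1%:R * n.+1%:R * C * n.+1%:R) * `|y - z|.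
Proof.
move=> Hr yr zr; set K := Num.sqrt _; pose v := z - y.
have xr t : 0 <= t <= 1 -> `|y + t *: v| < r.
  move=> t01; apply: segment_norm_lt t01 _ _; first by rewrite scale0r addr0.
  by rewrite scale1r addrC subrK.
have C0 : 0 <= C by have [_] := Hr y yr; apply: le_trans.
have := rdist_le_length (segment_C1 (fun t H => (Hr _ (xr t H)).1)).
rewrite scale0r addr0 scale1r (addrC y v) subrK => /le_trans; apply.
have H t : `[0, 1]%classic t -> Num.sqrt ((v *m gram p P h (y + t *: v) *m v^T) 0 0) <= K * `|y - z|.
  rewrite /= in_itv/= => /xr/Hr[_ gC].
  rewrite -[`|y - z|]ger0_norm// -sqrtr_sqr -sqrtrM; last by rewrite !mulr_ge0.
  apply: ler_wsqrtr; apply: le_trans (ler_norm _) _.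
  apply: le_trans (quad_form_small _ _) _.
  rewrite -[leRHS]mulrA (distrC y) -/v; apply: ler_pM; rewrite ?mulr_ge0//.
  - by rewrite /dot addr_ge0 ?sdot_ge0// -expr2 sqr_ge0.
  - by rewrite ler_wpM2l// mulr_ge0.
  - exact: dot_le_norm_sq.
pose mu := @lebesgue_measure R.
have mu01 : mu `[0, 1]%classic = 1%:E by rewrite /mu lebesgue_measure_itv/= lte01 oppr0 adde0.
have I1 : mu.-integrable `[0, 1]%classic (EFin \o
    (fun t : R => Num.sqrt ((v *m gram p P h (y + t *: v) *m v^T) 0 0))).
  apply: continuous_compact_integrable; first exact: segment_compact.
  apply: continuous_in_subspaceT => t; rewrite inE/= in_itv/= => /xr/Hr[yt _].
  exact: segment_speed_continuous.
have I2 : mu.-integrable `[0, 1]%classic (EFin \o (fun _ : R => K * `|y - z|)).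
  apply: continuous_compact_integrable; first exact: segment_compact.
  by apply: continuous_subspaceT; exact: cst_continuous.
have D := @le_Rintegral _ (measurableTypeR R) R mu _ _ _ (measurable_itv `[0, 1]) I1 I2 H.
have cst01 : \int[mu]_(_ in `[0, 1]) (K * `|y - z|) = K * `|y - z|.
  apply: etrans (@Rintegral_cst _ (measurableTypeR R) R mu _ (measurable_itv `[0, 1]) _) _.
  exact: etrans (congr1 (fun x => _ * fine x) mu01) (mulr1 _).
rewrite cst01 in D; apply: le_trans D.
rewrite le_eqVlt; apply/orP; left; apply/eqP.
by apply: eq_Rintegral => t _; rewrite gramE.
Qed.

End Local.

(** Near p the Gram matrix of h is bounded by continuity, and then the Riemannian
    distance is at most a multiple of the coordinate distance. *)
Lemma locally_lipschitz_chart f p : riemannian h -> locally_lipschitz h f -> chart_lipschitz f p.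
Proof.
move=> [sh _ _] lf P Pu; have [U [Up [L HL]]] := lf p.
have [r1 r10 H1] := param_dom_ball p P.
have [r2 r20 H2] := near0_eps (near_param0 P (Q := U) Up).
have cg := gram_continuous sh (param_dom0 p P).
have near_g : \forall y \near (0 : E), `|gram p P h y| <= `|gram p P h 0| + 1.
  move/cvgrPdist_le: cg => /(_ 1 ltr01); apply: filterS => x Hx.
  move: (gram p P h x) (gram p P h 0) Hx => G G0 Hx.
  have -> : G = G0 - (G0 - G) by rewrite opprB addrC subrK.
  apply: le_trans (ler_normB _ _) _; rewrite lerD2l; exact: Hx.
have [r3 r30 H3] := near0_eps near_g.
pose C := `|gram p P h 0| + 1.
exists (Num.min r1 (Num.min r2 r3)), (`|L| * Num.sqrt (n.+1%:R * n.+1%:R * C * n.+1%:R)); split.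
- by rewrite !lt_min r10 r20 r30.
- by rewrite mulr_ge0// sqrtr_ge0.
have Hr x : `|x| < Num.min r1 (Num.min r2 r3) -> param_dom p P x /\ `|gram p P h x| <= C.
  by rewrite !lt_min => /andP[/H1 xd /andP[_ /H3]].
move=> y z yr zr; have := rdist_segment sh Hr yr zr.
move: yr zr; rewrite !lt_min => /andP[_ /andP[/H2 yU _]] /andP[_ /andP[/H2 zU _]] D.
apply: le_trans (HL _ _ yU zU) _; rewrite -[leRHS]mulrA.
apply: (@le_trans _ _ (`|L| * rdist h (param p P y) (param p P z))).
  by rewrite ler_wpM2r ?rdist_ge0// ler_norm.
by rewrite ler_wpM2l.
Qed.

Lemma locally_lipschitz_combine (op : R -> R -> R) f1 f2 :
  (forall a b c d, `|op a b - op c d| <= Num.max `|a - c| `|b - d|) ->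
  locally_lipschitz h f1 -> locally_lipschitz h f2 -> locally_lipschitz h (fun p => op (f1 p) (f2 p)).
Proof.
move=> Hop l1 l2 p; have [U1 [pU1 [L1 H1]]] := l1 p; have [U2 [pU2 [L2 H2]]] := l2 p.
exists (U1 `&` U2); split; first exact: filterI.
exists (Num.max L1 L2) => x y [xU1 xU2] [yU1 yU2].
apply: le_trans (Hop _ _ _ _) _; rewrite ge_max; apply/andP; split.
  by apply: le_trans (H1 _ _ xU1 yU1) _; rewrite ler_wpM2r ?rdist_ge0// le_max lexx.
by apply: le_trans (H2 _ _ xU2 yU2) _; rewrite ler_wpM2r ?rdist_ge0// le_max lexx orbT.
Qed.

End RiemannianDistance.

(** * The theorem *)

Section Lattice.
Context {R : realType}.

Lemma dist_max (a b c d : R) : `|Num.max a b - Num.max c d| <= Num.max `|a - c| `|b - d|.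
Proof.
set m := Num.max `|_| `|_|.
have : `|a - c| <= m by rewrite le_max lexx.
have : `|b - d| <= m by rewrite le_max lexx orbT.
rewrite !ler_norml => /andP[? ?] /andP[? ?].
by case: (leP a b) => ?; case: (leP c d) => ?; lra.
Qed.

Lemma dist_min (a b c d : R) : `|Num.min a b - Num.min c d| <= Num.max `|a - c| `|b - d|.
Proof.
set m := Num.max `|_| `|_|.
have : `|a - c| <= m by rewrite le_max lexx.
have : `|b - d| <= m by rewrite le_max lexx orbT.
rewrite !ler_norml => /andP[? ?] /andP[? ?].
by case: (leP a b) => ?; case: (leP c d) => ?; lra.
Qed.

End Lattice.

Unset Implicit Arguments.

Theorem theorem4 (R : realType) (n : nat) (M : spacetime R n)
    (M_gh : globally_hyperbolic M)
    (h : M -> 'M[R]_n.+1) (h_complete : complete_riemannian h)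
    (phi varphi : M -> R)
    (phi_sol : solutions h phi) (varphi_sol : solutions h varphi)
    (phi_cons : consistent phi) (varphi_cons : consistent varphi) :
  ((past_oriented phi /\ past_oriented varphi) \/
   (future_oriented phi /\ future_oriented varphi) ->
   solutions h (fun p => Num.min (phi p) (varphi p))) /\
  ((past_oriented phi /\ future_oriented varphi) \/
   (future_oriented phi /\ past_oriented varphi) ->
   solutions h (fun p => Num.max (phi p) (varphi p))).
Proof.
have [h_riem _] := h_complete.
have [phi_lip phi_visc] := phi_sol; have [var_lip var_visc] := varphi_sol.
have phi_chart p : chart_lipschitz phi p by exact: (@locally_lipschitz_chart R n M h _ p h_riem).
have var_chart p : chart_lipschitz varphi p by exact: (@locally_lipschitz_chart R n M h _ p h_riem).
split=> [[[pphi pvar]|[fphi fvar]]|[[pphi fvar]|[fphi pvar]]]; split.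
- exact: locally_lipschitz_combine dist_min phi_lip var_lip.
- exact: min_viscosity_past.
- exact: locally_lipschitz_combine dist_min phi_lip var_lip.
- exact: (@min_viscosity_past R n (time_reverse M) phi varphi phi_visc var_visc
    (future_oriented_reverse fphi) (future_oriented_reverse fvar)).
- exact: locally_lipschitz_combine dist_max phi_lip var_lip.
- exact: max_viscosity.
- exact: locally_lipschitz_combine dist_max phi_lip var_lip.
have -> : (fun p => Num.max (phi p) (varphi p)) = (fun p => Num.max (varphi p) (phi p)).
  by apply/funext => p; rewrite maxC.
exact: max_viscosity.
Qed.
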